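(* Let $n$ be a positive integer. There exist positive continuous functions $\epsilon_n(t)$ and $C_n(t)$ of $t>0$, depending only on $n$, with $\lim_{t\to0}\epsilon_n(t)=\lim_{t\to0}C_n(t)=0$, such that for every compact $n$-dimensional Alexandrov space $M$ of nonnegative curvature we have $$\epsilon_n(\tilde v(M))\le\mathrm{ob}(M)\le C_n(\tilde v(M)).$$
   Context: Alexandrov spaces of curvature $\ge\kappa$ are taken in the sense of Burago–Gromov–Perelman and are assumed finite-dimensional. $|x,y|$ denotes distance. The normalized volume of a compact $n$-dimensional Alexandrov space $M$ is $\tilde v(M)=\mathcal H^n(M)/(\mathrm{diam}\,M)^n$, where $\mathcal H^n$ is the $n$-dimensional Hausdorff measure. For a point $p$, $\Sigma_p$ is the space of directions at $p$ with its angle metric $\angle$. For $p\ne q$, $\Uparrow_p^q\subset\Sigma_p$ is the set of all directions at $p$ of minimal geodesics from $p$ to $q$, and $\uparrow_p^q$ denotes an element of $\Uparrow_p^q$. For a set $A\subset \Sigma_p$, $\angle(A,\xi)$ is the distance in $\Sigma_p$ from $\xi$ to $A$. For compact $M$ put $R=\mathrm{rad}(M)=\inf_{p\in M}\sup_{q\in M}|p,q|$. With $B(p,r)$ the open ball, for $p\ne q\in M$ define $$\mathrm{ob}(p;q)=\sup_{x\in B(p,R/2)^c}\angle(\Uparrow_p^q,\uparrow_p^x)-\pi/2$$ (supremum over all $x\in M$ with $|p,x|\ge R/2$ and all $\uparrow_p^x\in\Uparrow_p^x$), $\mathrm{ob}(p,q)=\max\{\mathrm{ob}(p;q),\mathrm{ob}(q;p)\}$,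 and the obtuse constant of $M$ $$\mathrm{ob}(M)=\liminf_{|p,q|\to0}\mathrm{ob}(p,q)\in[0,\pi/2],$$ the liminf being over pairs $p\neq q$ in $M$. *)

(* Defs.v *)
From HB Require Import structures.
From mathcomp Require Import all_boot all_order all_algebra.
From mathcomp Require Import all_classical all_reals all_analysis.
Set Implicit Arguments.
Unset Strict Implicit.
Unset Printing Implicit Defensive.
Import Order.TTheory GRing.Theory Num.Theory.
Import numFieldNormedType.Exports.
Local Open Scope classical_set_scope.
Local Open Scope ring_scope.

(* Length of the restriction of [g] to [[a, b]]: the supremum of the lengths of
   inscribed polygons, over the same partitions as [total_variation]. *)
Definition curve_length {R : realType} {M : metricType R}
    (a b : R) (g : R -> M) : \bar R :=
  ereal_sup [set (\sum_(0 <= i < size s)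
      mdist (g (nth b (a :: s) i)) (g (nth b (a :: s) i.+1)))%:E
    | s in itv_partition a b].

Definition curve_joining {R : realType} {M : metricType R}
    (x y : M) : set (R -> M) :=
  [set g : R -> M | {within `[(0 : R), 1], continuous g} /\ g 0 = x /\ g 1 = y].

Definition intrinsic_metric {R : realType} (M : metricType R) : Prop :=
  forall x y : M,
    ereal_inf [set curve_length 0 1 g | g in curve_joining x y]
      = (mdist x y)%:E.

Definition complete_metric {R : realType} (M : metricType R) : Prop :=
  forall F : set_system M,
    ProperFilter F -> cauchy F -> exists x : M, F --> x.

(* Angle, opposite to the side of length [c], of the Euclidean triangle with
   sides [a], [b], [c]; meaningful when [0 < a], [0 < b] and the triangle
   inequalities hold. *)
Definition euclidean_angle {R : realType} (a b c : R) : R :=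
  acos ((a ^+ 2 + b ^+ 2 - c ^+ 2) / (2 * a * b)).

Definition comparison_angle {R : realType} {M : metricType R}
    (a b c : M) : R :=
  euclidean_angle (mdist a b) (mdist a c) (mdist b c).

(* Burago, Gromov and Perelman's four-point condition, required locally. *)
Definition curvature_ge0 {R : realType} (M : metricType R) : Prop :=
  forall x : M, exists2 U : set M, nbhs x U &
    forall a b c d : M, U a -> U b -> U c -> U d ->
      uniq [:: a; b; c; d] ->
      comparison_angle a b c + comparison_angle a c d + comparison_angle a d b
        <= 2 * pi.

(* Burago, Gromov and Perelman ask for local completeness only; the two
   coincide for compact spaces. *)
Record alexandrov_ge0 {R : realType} (M : metricType R) : Prop := {
  alexandrov_complete : complete_metric M ;
  alexandrov_intrinsic : intrinsic_metric M ;
  alexandrov_curvature : curvature_ge0 M }.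

(* The real-valued [sup] makes this meaningful for bounded sets only; the
   diameter of the empty set is 0. *)
Definition set_diam {R : realType} {M : metricType R} (A : set M) : R :=
  sup [set mdist x y | x in A & y in A].

(* The empty set must weigh 0 even for [s = 0], whereas [0 `^ 0 = 1]. *)
Definition diam_pow {R : realType} {M : metricType R}
    (s : R) (A : set M) : R :=
  if A == set0 then 0 else set_diam A `^ s.

Definition hausdorff_cover {R : realType} {M : metricType R}
    (delta : R) (A : set M) : set (nat -> set M) :=
  [set U | A `<=` \bigcup_i U i /\
           forall i x y, U i x -> U i y -> mdist x y <= delta].

(* s-dimensional Hausdorff outer measure, without normalizing constant. *)
Definition hausdorff_outer {R : realType} {M : metricType R}
    (s : R) (A : set M) : \bar R :=
  ereal_sup [set ereal_inf [set (\sum_(0 <= i <oo) (diam_pow s (U i))%:E)%E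
                           | U in hausdorff_cover delta A]
            | delta in [set delta : R | 0 < delta]].

Definition hausdorff_dim {R : realType} (M : metricType R) : \bar R :=
  ereal_inf [set s%:E | s in
    [set s : R | 0 <= s /\ hausdorff_outer s [set: M] = 0%E]].

(* omega_n = 2 pi omega_(n-2) / n, the Lebesgue volume. *)
Fixpoint unit_ball_volume {R : realType} (n : nat) : R :=
  match n with
  | 0 => 1
  | 1 => 2
  | m.+2 => 2 * pi / (m.+2)%:R * unit_ball_volume m
  end.

(* Normalized so as to agree with Lebesgue measure on Euclidean n-space. *)
Definition hausdorff_measure {R : realType} {M : metricType R}
    (n : nat) (A : set M) : \bar R :=
  ((unit_ball_volume n / 2 ^+ n)%:E * hausdorff_outer n%:R A)%E.

Definition normalized_volume {R : realType} (n : nat) (M : metricType R) : R :=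
  fine (hausdorff_measure n [set: M]) / set_diam [set: M] ^+ n.

(* Geodesics have unit speed and are total maps whose
   values outside the prescribed interval are irrelevant. *)
Definition minimal_geodesic {R : realType} {M : metricType R}
    (p q : M) : set (R -> M) :=
  [set g : R -> M | [/\ g 0 = p, g (mdist p q) = q &
     {in `[0, mdist p q] &, forall s t : R, mdist (g s) (g t) = `|s - t|}]].

Definition geodesic_from {R : realType} {M : metricType R}
    (p : M) : set (R -> M) :=
  [set g : R -> M | g 0 = p /\ exists2 l : R, 0 < l &
     {in `[0, l] &, forall s t : R, mdist (g s) (g t) = `|s - t|}].

(* The angle at their origin between two unit speed geodesics. The limit exists
   in Alexandrov spaces. *)
Definition geodesic_angle {R : realType} {M : metricType R}
    (g h : R -> M) : R :=
  lim (euclidean_angle st.1 st.2 (mdist (g st.1) (h st.2))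
        @[st --> filter_prod 0^'+ 0^'+]).

(* A direction is an equivalence class of geodesics, for the relation of making
   a zero angle. *)
Definition direction {R : realType} {M : metricType R}
    (p : M) (g : R -> M) : set (R -> M) :=
  [set h : R -> M | geodesic_from p h /\ geodesic_angle g h = 0].

(* The angle does not depend on the representatives, so the infimum is over a
   singleton. The space of directions at p is the metric completion of the set
   of all [direction p g]; only points and distances of the latter are used. *)
Definition direction_angle {R : realType} {M : metricType R}
    (xi eta : set (R -> M)) : R :=
  inf [set geodesic_angle g h | g in xi & h in eta].

Definition angle_to_set {R : realType} {M : metricType R}
    (A : set (set (R -> M))) (xi : set (R -> M)) : R :=
  inf [set direction_angle eta xi | eta in A].

Definition directions_to {R : realType} {M : metricType R}
    (p q : M) : set (set (R -> M)) :=
  [set direction p g | g in minimal_geodesic p q].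

Definition radius {R : realType} (M : metricType R) : R :=
  inf [set sup [set mdist p q | q in [set: M]] | p in [set: M]].

Definition ob_at {R : realType} {M : metricType R} (p q : M) : R :=
  sup [set angle_to_set (directions_to p q) xi | xi in
         \bigcup_(x in ~` ball p (radius M / 2)) directions_to p x]
  - pi / 2.

Definition ob_pair {R : realType} {M : metricType R} (p q : M) : R :=
  Num.max (ob_at p q) (ob_at q p).

(* [entourage] is the filter of the pairs (p, q) with |p, q| tending to 0. *)
Definition obtuse_constant {R : realType} (M : metricType R) : \bar R :=
  limf_einf (fun pq : M * M => (ob_pair pq.1 pq.2)%:E)
    (within [set pq | pq.1 != pq.2] entourage).

(* Main.v *)
Require Import Defs.
From mathcomp Require Import all_boot all_order all_algebra.
From mathcomp Require Import all_classical all_reals all_analysis.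
From mathcomp Require Import ring lra zify.
Set Implicit Arguments.
Unset Strict Implicit.
Unset Printing Implicit Defensive.
Import Order.TTheory GRing.Theory Num.Theory.
Import numFieldNormedType.Exports.
Local Open Scope classical_set_scope.
Local Open Scope ring_scope.

(* The four-point condition is first recast as an inequality between distances,
   [strainer_ineq], that holds globally (Toponogov) and from which everything else
   follows.

   Lower bound. If [p] and [q] are close and [ob_pair p q < e], then all points far
   from both see [p] and [q] at angles almost pi / 2. Shrinking them towards [p] to
   the size [d p q] gives a set [Y] where the function [|p, .|^2 - |q, .|^2] is
   small, whereas contracting a ball at [q] by a factor [1 - 4 e] makes it
   large. Hence the contracted ball and [Y] are disjoint, and iterating shows
   that [Y], so also [M], has volume at most of order [e].

   Upper bound. If [ob_pair] is at least [delta] on close pairs, strained points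
   of multiplicity [k < n] can be improved to [k + 1] at a comparable
   scale. Otherwise the fibres of the distance coordinates would be thin; but
   they contain pairs of arbitrarily close points, because [M] does not embed in
   dimension [k], and a direction making an obtuse angle with such a pair is
   seen to be impossible. With [n] strainers the coordinates are open at a
   definite scale, which bounds the volume of [M] from below. *)

(* [lra] becomes slow in large contexts. The terms in [kept] are the section
   hypotheses, whose clearing would make it fail. *)
Ltac clear_facts kept := repeat match goal with
  | H : is_true _ |- _ => lazymatch kept with context [H] => fail | _ => clear H end
  | H : ?P |- _ => lazymatch type of P with
      | Prop => lazymatch P with forall _, _ => clear H end
    end
  end.

(** Volumes are never compared directly. Outer measure above [V] yields packings with
    [N * (2 * e) ^+ n > V] at every small scale [e], and [packing_bound] caps the packings of a
    ball, in the role of Bishop-Gromov. Packing numbers behave well under maps that shrink distances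
    by at most a known factor, as homotheties do in nonnegative curvature; such maps need not be
    continuous or measurable. The dimension enters only through [packing_bound] and [packing_dim].

    An angle is the supremum of the comparison angles of its hinge. An upper bound on it therefore
    controls hinges of every size, a lower bound only very small ones. This asymmetry shapes the
    proof: nearly right angles are used at once at the scale of far points, whereas an obtuse angle
    is seen only at an unknown scale, and strained coordinates, being almost affine, carry
    information down to that scale from a definite one.

    The lower bound is linear in the volume, so [eps] is a rational function. The upper bound gives
    for each [delta] a volume threshold whose dependence on [delta] is uncontrolled; an infimum of
    affine functions still makes a continuous [C] out of it. *)

(** * Comparison inequalities between distances *)

Section comparison.
Context {R : realType} {M : metricType R}.
Implicit Types (x y z a b w p q : M) (h t u : R).
Local Notation d := (@mdist R M).

(** Twice the scalar product, at the vertex [z], of the sides of the comparison triangle. Unlike the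
    comparison angle it makes sense when points coincide. *)
Definition inner z x y : R := d z x ^+ 2 + d z y ^+ 2 - d x y ^+ 2.

Lemma innerC z x y : inner z x y = inner z y x.
Proof. by rewrite /inner (metric_sym x y); ring. Qed.

Lemma inner_base z x : inner z z x = 0.
Proof. by rewrite /inner mdistxx; ring. Qed.

Lemma inner_diag z x : inner z x x = 2 * d z x ^+ 2.
Proof. by rewrite /inner mdistxx; ring. Qed.

Lemma inner_le z x y : inner z x y <= 2 * d z x * d z y.
Proof.
rewrite /inner.
have h1 : d z x - d z y <= d x y.
  by have := metric_triangle z y x; rewrite (metric_sym y x); lra.
have h2 : d z y - d z x <= d x y by have := metric_triangle z x y; lra.
have : (d z x - d z y) ^+ 2 <= d x y ^+ 2 by nra.
by nra.
Qed.

Lemma inner_ge z x y : - (2 * d z x * d z y) <= inner z x y.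
Proof.
rewrite /inner.
have h1 : d x y <= d z x + d z y.
  by have := metric_triangle x z y; rewrite (metric_sym x z).
have h0 := mdist_ge0 x y.
by nra.
Qed.

(* If the angle at [z] between [a] and [b] is nearly pi, then the comparison
   angles of [x] with [a] and with [b] add up to at most about pi. All
   denominators are cleared, so that no point needs to be distinct from [z]. *)
Definition strainer_ineq z x a b : Prop := forall h, 0 <= h ->
  inner z a b <= 2 * (h ^+ 2 - 1) * d z a * d z b ->
  - (6 * h * d z x * d z a * d z b) <= inner z x a * d z b + inner z x b * d z a.

Definition curved_within (rho : R) : Prop := forall z x a b,
  d z x < rho -> d z a < rho -> d z b < rho -> strainer_ineq z x a b.

(** Put [e = pi - acos c1], so that [1 - cos e <= h ^+ 2] and [sin e <= 2 * h]. The other two angles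
    add up to at most [pi + e], and expanding the cosine of [pi + e - acos c2] loses only these two
    terms. *)
Lemma cos_sum_ge (c1 c2 c3 h : R) :
  -1 <= c1 <= 1 -> -1 <= c2 <= 1 -> -1 <= c3 <= 1 -> 0 <= h ->
  acos c1 + acos c2 + acos c3 <= 2 * pi -> c1 <= h ^+ 2 - 1 ->
  - (3 * h) <= c2 + c3.
Proof.
move=> h1 h2 h3 h0 hs hc.
have [h1h|h1h] := leP 1 h; first by lra.
have pi0 := pi_gt0 R.
set e := pi - acos c1.
have ea : 0 <= e by rewrite /e subr_ge0 acos_lepi.
have e_pi : e <= pi by rewrite /e gerBl acos_ge0.
have cose : cos e = - c1 by rewrite /e -acosN // acosK // in_itv /=; lra.
have sine : sin e ^+ 2 = 1 - c1 ^+ 2 by have := cos2Dsin2 e; rewrite cose; lra.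
have sine0 : 0 <= sin e by apply: sin_ge0_pi; rewrite ea e_pi.
have hsin : sin e <= 2 * h.
  rewrite leNgt; apply/negP => hlt.
  have : sin e ^+ 2 > (2 * h) ^+ 2 by nra.
  rewrite sine; nra.
have a2 : 0 <= acos c2 by exact: acos_ge0.
have a2pi : acos c2 <= pi by exact: acos_lepi.
have a3 : 0 <= acos c3 by exact: acos_ge0.
have a3pi : acos c3 <= pi by exact: acos_lepi.
have k2 : cos (acos c2) = c2 by rewrite acosK // in_itv.
have k3 : cos (acos c3) = c3 by rewrite acosK // in_itv.
have hsum : acos c2 + acos c3 <= pi + e by rewrite /e; lra.
have s2 := sin_acos h2.
have s20 : 0 <= sin (acos c2) by apply: sin_ge0_pi; rewrite a2.
have s21 : sin (acos c2) <= 1 by exact: sin_le1.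
have [elt|ege] := ltP (acos c2) e.
  have : cos e <= cos (acos c2).
    rewrite le_eqVlt; apply/orP; right.
    by rewrite ltr_cos // in_itv /= ?ea ?e_pi ?a2 ?a2pi.
  by rewrite cose k2; nra.
have : cos (pi + e - acos c2) <= cos (acos c3).
  rewrite leNgt; apply/negP => hlt.
  rewrite ltr_cos ?in_itv /= in hlt; [by lra| by lra|by rewrite a3 a3pi].
rewrite k3 (_ : pi + e - acos c2 = (e - acos c2) + pi); last by ring.
rewrite cosDpi cosB cose k2.
have : sin e * sin (acos c2) <= 2 * h by nra.
by nra.
Qed.

Lemma ccos_itv (z x y : M) : z != x -> z != y ->
  -1 <= (d z x ^+ 2 + d z y ^+ 2 - d x y ^+ 2) / (2 * d z x * d z y) <= 1.
Proof.
rewrite -!mdist_gt0 => zx zy.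
have pos : 0 < 2 * d z x * d z y by rewrite !mulr_gt0.
rewrite ler_pdivlMr // ler_pdivrMr //.
by have := inner_le z x y; have := inner_ge z x y; rewrite /inner; lra.
Qed.

(** The angle condition concerns distinct points only. For coinciding points the inequality comes
    from the bounds on [inner]; in particular [a = b] forces [1 <= h]. *)
Lemma strainer_ineq_of_angles z x a b :
  (uniq [:: z; a; b; x] ->
   comparison_angle z a b + comparison_angle z b x + comparison_angle z x a
     <= 2 * pi) ->
  strainer_ineq z x a b.
Proof.
move=> H h h0 hab.
have dx0 := mdist_ge0 z x; have da0 := mdist_ge0 z a; have db0 := mdist_ge0 z b.
have [->|zx] := eqVneq x z.
  by rewrite !inner_base mdistxx; lra.
have [->|za] := eqVneq a z.
  by rewrite innerC inner_base mdistxx; lra.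
have [->|zb] := eqVneq b z.
  by rewrite (innerC z x z) inner_base mdistxx; lra.
have {}zx : 0 < d z x by rewrite mdist_gt0 eq_sym.
have {}za : 0 < d z a by rewrite mdist_gt0 eq_sym.
have {}zb : 0 < d z b by rewrite mdist_gt0 eq_sym.
have [abE|ab] := eqVneq a b.
  subst b; move: hab; rewrite inner_diag => hab.
  have hh : 2 <= h ^+ 2.
    have : 2 * d z a ^+ 2 * (2 - h ^+ 2) <= 0 by lra.
    by rewrite pmulr_rle0 ?mulr_gt0 ?exprn_gt0 //; lra.
  have h1 : 1 <= h by nra.
  have hg := inner_ge z x a.
  have : 0 <= (2 * d z x * d z a + inner z x a) * d z a by apply: mulr_ge0; lra.
  have : 0 <= (h - 1) * (d z x * d z a * d z a) by rewrite !mulr_ge0 //; lra.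
  have : 0 <= d z x * d z a * d z a by rewrite !mulr_ge0.
  lra.
have [xaE|xa] := eqVneq x a.
  subst x; rewrite inner_diag.
  have := inner_ge z a b => hg.
  have : 0 <= (2 * d z a * d z b + inner z a b) * d z a by apply: mulr_ge0; lra.
  have : 0 <= 6 * h * d z a * d z a * d z b by rewrite !mulr_ge0.
  lra.
have [xbE|xb] := eqVneq x b.
  subst x; rewrite inner_diag (innerC z b a).
  have := inner_ge z a b => hg.
  have : 0 <= (2 * d z a * d z b + inner z a b) * d z b by apply: mulr_ge0; lra.
  have : 0 <= 6 * h * d z b * d z a * d z b by rewrite !mulr_ge0.
  lra.
have zxN : z != x by rewrite -mdist_gt0.
have zaN : z != a by rewrite -mdist_gt0.
have zbN : z != b by rewrite -mdist_gt0.
have {}H := H _.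
have /H : uniq [:: z; a; b; x].
  by rewrite /= !inE !negb_or zxN zaN zbN ab (eq_sym a x) xa (eq_sym b x) xb.
rewrite /comparison_angle /euclidean_angle => {}H.
have := cos_sum_ge (ccos_itv zaN zbN) (ccos_itv zbN zxN) (ccos_itv zxN zaN) h0 H.
have pab : 0 < 2 * d z a * d z b by rewrite !mulr_gt0.
rewrite ler_pdivrMr // => /(_ _)/wrap[].
  by move: hab; rewrite /inner; lra.
rewrite -!/(inner _ _ _) (innerC z b x) => K.
have P : 0 < 2 * d z x * d z a * d z b by rewrite !mulr_gt0.
rewrite -(ler_pM2l P) in K.
suff -> : inner z x a * d z b + inner z x b * d z a =
    2 * d z x * d z a * d z b * (inner z x b / (2 * d z b * d z x) +
      inner z x a / (2 * d z x * d z a)) by apply: le_trans K; lra.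
by field; rewrite !gt_eqF.
Qed.

(** [rho] is a Lebesgue number for the neighbourhoods on which the four-point condition holds. *)
Lemma curvature_ge0_curved_within : compact [set: M] -> curvature_ge0 M ->
  exists2 rho, 0 < rho & curved_within rho.
Proof.
move=> /compact_near_coveringP cM curv.
have [rho rho0 H] : exists2 rho : R, 0 < rho & forall z : M, setT z ->
    forall x a b, d z x < rho -> d z a < rho -> d z b < rho ->
    strainer_ineq z x a b.
  have : \forall r \near 0^'+, [set: M] `<=` (fun z : M =>
    forall x a b, d z x < r -> d z a < r -> d z b < r -> strainer_ineq z x a b).
    apply: cM => z _.
    have [U /nbhs_ballP [e /= e0 eU] HU] := curv z.
    exists (ball z (e / 2), [set r : R | 0 < r < e / 2]) => /=.
      split; first by apply: nbhsx_ballx; rewrite divr_gt0.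
      by near=> r; rewrite /=; apply/andP; split; near: r;
        [exact: nbhs_right_gt | apply: nbhs_right_lt; rewrite divr_gt0].
    move=> [z' r] /= [zz' /andP[r0 re]] x a b dx da db.
    rewrite ballEmdist /= in zz'.
    have inU y : d z' y < r -> U y.
      move=> h; apply: eU; rewrite /= ballEmdist /=.
      by have := metric_triangle z z' y; lra.
    apply: strainer_ineq_of_angles => un.
    by apply: HU => //; apply: inU => //; rewrite mdistxx.
  move=> Hn; near (0 : R)^'+ => r; exists r; first by near: r; exact: nbhs_right_gt.
  by near: r; exact: Hn.
by exists rho => // z x a b; exact: H.
Unshelve. all: by end_near. Qed.

Definition between t x y z : Prop :=
  [/\ 0 <= t <= 1, d x z = t * d x y & d z y = (1 - t) * d x y].

(** The comparison angle at [z] between [x] and [y] is exactly pi, so the strainer inequality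
    applies with [h = 0]. In the plane this is Stewart's theorem, with equality. *)
Lemma between_ineq rho t x y z w : curved_within rho ->
  d z x < rho -> d z y < rho -> d z w < rho -> between t x y z ->
  (1 - t) * d w x ^+ 2 + t * d w y ^+ 2 - t * (1 - t) * d x y ^+ 2 <= d w z ^+ 2.
Proof.
move=> C zx zy zw [t01 xz zyE].
have := C z w x y zw zx zy 0 (lexx 0).
rewrite /inner expr0n /= (metric_sym z x) xz zyE (metric_sym z w) => /(_ _)/wrap[].
  by rewrite le_eqVlt; apply/orP; left; apply/eqP; ring.
have [xy _|xy] := eqVneq (d x y) 0.
  have -> : z = x by apply/esym/mdist_positivity; rewrite xz xy mulr0.
  by rewrite (mdist_positivity _ _ xy) mdistxx; lra.
have {}xy : 0 < d x y by rewrite lt_def xy mdist_ge0.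
move=> H; rewrite -subr_ge0 -(pmulr_rge0 _ xy); move: H.
rewrite (metric_sym w x) (metric_sym w y); lra.
Qed.

(* Comparison angles at [p] do not decrease when points slide towards [p]. *)
Lemma inner_between rho t u p x y x' y' : curved_within rho ->
  d p x + d p y < rho -> between t p x x' -> between u p y y' ->
  inner p x' y' <= t * u * inner p x y.
Proof.
move=> C lt bx by'.
have [/andP[t0 t1] px' x'x] := bx; have [/andP[u0 u1] py' y'y] := by'.
have x0 := mdist_ge0 p x; have y0 := mdist_ge0 p y.
have tx : t * d p x <= d p x by rewrite ler_piMl.
have uy : u * d p y <= d p y by rewrite ler_piMl.
have tx0 : 0 <= t * d p x by rewrite mulr_ge0.
have uy0 : 0 <= u * d p y by rewrite mulr_ge0.
have x'y : d x' y <= d p x + d p y.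
  by have := metric_triangle x' p y; rewrite (metric_sym x' p) px'; lra.
have y'x' : d y' x' <= d p x + d p y.
  by have := metric_triangle y' p x'; rewrite (metric_sym y' p) px' py'; lra.
have := @between_ineq _ _ _ _ _ x' C _ _ _ by'.
rewrite (metric_sym y' p) py' y'y => /(_ ltac:(lra) ltac:(lra) ltac:(lra)) H1.
have := @between_ineq _ _ _ _ _ y C _ _ _ bx.
rewrite (metric_sym x' p) px' x'x => /(_ ltac:(lra) ltac:(lra) ltac:(lra)).
move: H1; rewrite /inner (metric_sym x' p) px' py' (metric_sym y x') (metric_sym y p) (metric_sym y x).
move=> H1 H2; have {}H2 := ler_wpM2l u0 H2; lra.
Qed.

End comparison.
Arguments curved_within {R} M rho.

(** * Geodesics in compact length spaces *)

Section geodesics.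
Context {R : realType} {M : metricType R}.
Implicit Types (x y z a b w p q : M) (h t u : R).
Local Notation d := (@mdist R M).

Lemma mdist_cvg {T : Type} {F : set_system T} {FF : Filter F} (f g : T -> M) x y :
  f @ F --> x -> g @ F --> y -> d (f t) (g t) @[t --> F] --> d x y.
Proof.
move=> fx gy; apply/cvgrPdist_lt => e e0.
have e2 : 0 < e / 2 by rewrite divr_gt0.
have Fx : F (f @^-1` ball x (e / 2)) by exact: (fx _ (nbhsx_ballx x _ e2)).
have Fy : F (g @^-1` ball y (e / 2)) by exact: (gy _ (nbhsx_ballx y _ e2)).
apply: filterS2 Fx Fy => t /=; rewrite !ballEmdist /= => xf yg.
have h1 := metric_triangle x (f t) y.
have h2 := metric_triangle (f t) (g t) y.
have h3 := metric_triangle (f t) x (g t).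
have h4 := metric_triangle x y (g t).
rewrite (metric_sym (g t) y) in h2; rewrite (metric_sym (f t) x) in h3.
by rewrite ltr_norml; lra.
Qed.

Lemma mdist_continuousr x : continuous (d x).
Proof. by move=> y; apply: mdist_cvg; [exact: cvg_cst | exact: cvg_id]. Qed.

Lemma mdist_continuousl x : continuous (d ^~ x).
Proof. by move=> y; apply: mdist_cvg; [exact: cvg_id | exact: cvg_cst]. Qed.

Lemma near_midpoint x y (e : R) : intrinsic_metric M -> 0 < e ->
  exists z, d x z = d x y / 2 /\ d z y <= d x y / 2 + e.
Proof.
move=> im e0.
have [xy|xy] := eqVneq (d x y) 0.
  by exists x; rewrite mdistxx xy; split; [rewrite mul0r|lra].
have {}xy : 0 < d x y by rewrite lt_def xy mdist_ge0.
have /ereal_inf_lt [_ [g [cg [g0 g1]] <-]] : (ereal_inf [set curve_length 0 1 g |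
    g in curve_joining x y] < (d x y + e)%:E)%E.
  by rewrite im lte_fin ltrDl.
move=> lt.
have cf : {within `[(0 : R), 1], continuous (fun t => d x (g t))}.
  by move=> t; apply: (continuous_comp (cg t)); exact: mdist_continuousr.
have [|c] := IVT (v := d x y / 2) ler01 cf.
  rewrite g0 g1 mdistxx minElt maxElt xy; lra.
rewrite in_itv /= => /andP[c0 c1] xc; exists (g c); split => //.
have {}c0 : 0 < c.
  rewrite lt_def c0 andbT; apply/eqP => cE; move: xc; rewrite cE g0 mdistxx; lra.
have {}c1 : c < 1.
  rewrite lt_def c1 andbT; apply/eqP => cE; move: xc; rewrite -cE g1; lra.
have : (((\sum_(0 <= i < 2) d (g (nth 1 [:: 0; c; 1] i)) (g (nth 1 [:: 0; c; 1] i.+1)))%:E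
   <= curve_length 0 1 g)%E).
  apply: ereal_sup_ubound; exists [:: c; 1] => //=; split => /=; last by rewrite eqxx.
  by rewrite c0 c1.
rewrite big_nat_recr //= big_nat1 /= g0 g1 => /le_lt_trans/(_ lt).
by rewrite lte_fin xc; lra.
Qed.

Hypotheses (cM : compact [set: M]) (iM : intrinsic_metric M).

Lemma midpoint x y : exists z, d x z = d x y / 2 /\ d z y = d x y / 2.
Proof.
pose f z := `|d x z - d x y / 2| + `|d z y - d x y / 2|.
have cf : continuous f.
  move=> z; apply: cvgD; apply: cvg_norm; apply: cvgB; try exact: cvg_cst.
    exact: mdist_continuousr.
  exact: mdist_continuousl.
have [|z _ minz] := compact_EVT_min _ cM (continuous_subspaceT cf).
  by exists x.
have f0 : f z <= 0.
  apply/ler_addgt0Pl => e e0; rewrite addr0.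
  have [w [xw wy]] := near_midpoint x y iM e0.
  apply: le_trans (minz w _) _; first by rewrite inE.
  rewrite /f xw subrr normr0 add0r ler_norml.
  by have := metric_triangle x w y; rewrite xw; lra.
have := normr_ge0 (d x z - d x y / 2).
have := normr_ge0 (d z y - d x y / 2).
rewrite /f in f0 => h1 h2; exists z.
have /eqP : `|d x z - d x y / 2| = 0 by lra.
have /eqP : `|d z y - d x y / 2| = 0 by lra.
by rewrite !normr_eq0 !subr_eq0 => /eqP-> /eqP->.
Qed.

Lemma dyadic_chain n x y : exists c : nat -> M, [/\ c 0%N = x, c (2 ^ n)%N = y &
  forall i, (i < 2 ^ n)%N -> d (c i) (c i.+1) = d x y / 2 ^+ n].
Proof.
elim: n x y => [|n IH] x y.
  exists (fun i => if i == 0%N then x else y); split => // i.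
  by rewrite expn0 ltnS leqn0 => /eqP ->; rewrite /= expr0 divr1.
have [m [xm my]] := midpoint x y.
have [c1 [c10 c1n H1]] := IH x m; have [c2 [c20 c2n H2]] := IH m y.
exists (fun i => if (i <= 2 ^ n)%N then c1 i else c2 (i - 2 ^ n)%N); split => //.
  rewrite expnS mul2n -addnn; case: ifPn; last by rewrite addnK.
  by rewrite -subn_eq0 addnK expn_eq0.
move=> i; rewrite expnS mul2n -addnn => iltn.
have E (D : R) : D / 2 / 2 ^+ n = D / 2 ^+ n.+1.
  by rewrite exprS invfM mulrA.
case: (ltngtP i (2 ^ n)%N) => [il|ig|ie].
- by rewrite H1 // xm E.
- by rewrite subSn ?(ltnW ig) // H2 ?my ?E // ltn_subLR // ltnW.
- rewrite ie c1n subSnn -c20 H2 ?my ?E //.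
  by rewrite expn_gt0.
Qed.

(** The chain is no longer than the distance between its ends, so all triangle inequalities along it
    are equalities. *)
Lemma chain_dist (c : nat -> M) N (h : R) :
  (forall i, (i < N)%N -> d (c i) (c i.+1) <= h) -> N%:R * h <= d (c 0%N) (c N) ->
  forall i j, (i <= j <= N)%N -> d (c i) (c j) = (j - i)%:R * h.
Proof.
move=> H H0.
have U i j : (i <= j)%N -> (j <= N)%N -> d (c i) (c j) <= (j - i)%:R * h.
  elim: j => [|j IH]; first by rewrite leqn0 => /eqP -> _; rewrite mdistxx subnn mul0r.
  rewrite leq_eqVlt => /orP[/eqP -> _|]; first by rewrite mdistxx subnn mul0r.
  rewrite ltnS => ij jN; apply: le_trans (metric_triangle _ (c j) _) _.
  rewrite subSn // -natr1 mulrDl mul1r; apply: lerD; last exact: H.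
  by apply: IH => //; exact: ltnW.
move=> i j /andP[ij jN]; apply/eqP; rewrite eq_le U //=.
have h1 := U 0%N i isT (leq_trans ij jN).
have h2 := U j N jN (leqnn N).
have h3 := metric_triangle (c 0%N) (c i) (c N).
have h4 := metric_triangle (c i) (c j) (c N).
have : (N%:R : R) = (i - 0)%:R + (j - i)%:R + (N - j)%:R.
  by rewrite -!natrD subn0 subnKC // subnKC.
by move=> E; rewrite E in H0; lra.
Qed.

Lemma ultra_cvg (U : set_system nat) (f : nat -> M) : UltraFilter U ->
  exists z, f @ U --> z.
Proof.
move=> UU.
have FU : ProperFilter U by exact: ultra_proper.
have [z [_ clz]] : [set: M] `&` cluster (f @ U) !=set0 by apply: cM; exact: filterT.
exists z => B Bz.
have [//|UC] := in_ultra_setVsetC (f @^-1` B) UU.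
have [w [/= wB Bw]] := clz (~` B) B UC Bz.
by case: wB.
Qed.

Definition isometric_on (g : R -> M) (l : R) :=
  {in `[0, l] &, forall s t, d (g s) (g t) = `|s - t|}.

(** Dyadic chains of [2 ^ n] equal steps are isometric up to one step. Limits along an ultrafilter
    exist for all parameters simultaneously, which spares a diagonal subsequence and an extension by
    continuity. *)
Lemma geodesic_exists x y :
  exists g : R -> M, [/\ g 0 = x, g (d x y) = y & isometric_on g (d x y)].
Proof.
have [xy|xy] := eqVneq (d x y) 0.
  exists (fun=> x); split => //; first by exact: mdist_positivity.
  move=> s t; rewrite xy !in_itv /= => hs ht; rewrite mdistxx.
  by have /le_anti <- := hs; have /le_anti <- := ht; rewrite subrr normr0.
set D := d x y in xy *.
have D0 : 0 < D by rewrite lt_def xy mdist_ge0.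
have /choice[c Hc] n := dyadic_chain n x y.
have [U [UU sU]] := ultraFilterLemma eventually_filter.
pose k n t := Num.truncn (t / D * 2 ^+ n).
have /choice[g Hg] t := ultra_cvg (fun n => c n (k n t)) UU.
have kle n t : 0 <= t <= D -> (k n t <= 2 ^ n)%N.
  move=> /andP[t0 tD]; rewrite truncn_le_nat -[((2 ^ n).+1)%:R]natr1 natrX.
  rewrite ltr_pwDr // ler_piMl ?exprn_ge0 //.
  by rewrite ler_pdivrMr // mul1r.
have kbnd n t : 0 <= t -> (k n t)%:R <= t / D * 2 ^+ n < (k n t)%:R + 1.
  move=> t0; rewrite natr1; apply: truncn_itv.
  by rewrite mulr_ge0 ?exprn_ge0 // divr_ge0 // ltW.
have FU : ProperFilter U by exact: ultra_proper.
have dist n (s t : R) : 0 <= s <= D -> 0 <= t <= D ->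
    d (c n (k n s)) (c n (k n t)) = `|(k n s)%:R - (k n t)%:R| * (D / 2 ^+ n).
  move=> hs ht; have [c0 cN cS] := Hc n.
  have E : forall i j, (i <= j <= 2 ^ n)%N -> d (c n i) (c n j) = (j - i)%:R * (D / 2 ^+ n).
    apply: chain_dist; first by move=> i /cS ->.
    by rewrite c0 cN natrX mulrC mulfVK // expf_neq0.
  have [le|/ltnW le] := leqP (k n s) (k n t).
    by rewrite E ?le ?kle // natrB // ler0_norm ?opprB // subr_le0 ler_nat.
  by rewrite metric_sym E ?le ?kle // natrB // ger0_norm // subr_ge0 ler_nat.
have iso (s t : R) : 0 <= s <= D -> 0 <= t <= D -> d (g s) (g t) = `|s - t|.
  move=> hs ht.
  have h1 : d (c n (k n s)) (c n (k n t)) @[n --> U] --> d (g s) (g t).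
    exact: mdist_cvg.
  apply: (@cvg_unique _ (@Rhausdorff R) _ _ _ _ h1).
  have h2 : d (c n (k n s)) (c n (k n t)) @[n --> \oo] --> `|s - t|.
    apply/cvgrPdist_le => e e0.
    have : (fun n => D / 2 ^+ n) @ \oo --> (0 : R).
      rewrite -(mulr0 D); apply: cvgM; first exact: cvg_cst.
      under eq_fun do rewrite -exprVn.
      by apply: cvg_expr; rewrite ger0_norm // ?invf_lt1 ?ltr1n.
    move=> /cvgrPdist_le /(_ _ e0); apply: filterS => n.
    rewrite sub0r normrN ger0_norm ?divr_ge0 ?exprn_ge0 ?(ltW D0) // => ne.
    rewrite dist //.
    have ks := kbnd n s; have kt := kbnd n t.
    have {ks}/andP[ks1 ks2] := ks ltac:(lra).
    have {kt}/andP[kt1 kt2] := kt ltac:(lra).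
    have P : 0 < D / 2 ^+ n by rewrite divr_gt0 // exprn_gt0.
    have Es : s = (s / D * 2 ^+ n) * (D / 2 ^+ n).
      by field; rewrite xy expf_neq0.
    have Et : t = (t / D * 2 ^+ n) * (D / 2 ^+ n).
      by field; rewrite xy expf_neq0.
    rewrite [in `|s - t|]Es [in `|_ - t|]Et -mulrBl normrM (gtr0_norm P) -mulrBl normrM (gtr0_norm P).
    apply: le_trans ne; rewrite ler_piMl ?(ltW P) //.
    apply: le_trans (ler_dist_dist _ _) _.
    by rewrite ler_norml; lra.
  by move=> B /h2; exact: sU.
exists g; split.
- have h0 : c n (k n 0) @[n --> U] --> x.
    rewrite (_ : (fun n => c n (k n 0)) = cst x); first exact: cvg_cst.
    by apply/funext => n; rewrite /k mul0r mul0r truncn0; have [] := Hc n.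
  exact: (@cvg_unique M (@metric_hausdorff R M) _ _ _ _ (Hg 0) h0).
- have h0 : c n (k n D) @[n --> U] --> y.
    rewrite (_ : (fun n => c n (k n D)) = cst y); first exact: cvg_cst.
    apply/funext => n; rewrite /k divff // mul1r.
    by rewrite -natrX natrK; have [] := Hc n.
  exact: (@cvg_unique M (@metric_hausdorff R M) _ _ _ _ (Hg D) h0).
- by move=> s t; rewrite !in_itv /=; exact: iso.
Qed.

End geodesics.

(** * Globalization of the comparison (Toponogov) *)

Section globalization.
Context {R : realType} {M : metricType R}.
Implicit Types (x y z w p q : M) (g h : R -> M) (a b c s t u : R).
Local Notation d := (@mdist R M).

Lemma isometric_on_le g a b : b <= a -> isometric_on g a -> isometric_on g b.
Proof.
move=> ba ig s t; rewrite !in_itv /= => /andP[s0 sb] /andP[t0 tb].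
by apply: ig; rewrite in_itv /= ?s0 ?t0 /= (le_trans _ ba).
Qed.

Lemma isometric_onE g a s t : isometric_on g a -> 0 <= s <= a -> 0 <= t <= a ->
  d (g s) (g t) = `|s - t|.
Proof. by move=> ig hs ht; apply: ig; rewrite in_itv. Qed.

Lemma isometric_on_shift g a c : 0 <= c -> isometric_on g a ->
  isometric_on (fun s => g (c + s)) (a - c).
Proof.
move=> c0 ig s t; rewrite !in_itv /= => hs ht.
rewrite (isometric_onE ig); [|by lra|by lra].
by congr (`| _ |); ring.
Qed.

Lemma isometric_on_rev g a c : c <= a -> isometric_on g a ->
  isometric_on (fun s => g (c - s)) c.
Proof.
move=> ca ig s t; rewrite !in_itv /= => hs ht.
rewrite (isometric_onE ig); [|by lra|by lra].
by rewrite distrC; congr (`| _ |); ring.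
Qed.

Lemma isometric_on0 g a s : isometric_on g a -> 0 <= s <= a -> d (g 0) (g s) = s.
Proof.
move=> ig sa; rewrite (isometric_onE ig) //; last by lra.
by rewrite sub0r normrN ger0_norm; lra.
Qed.

Lemma isometric_between g a s t : isometric_on g a -> 0 <= s <= t -> 0 < t <= a ->
  between (s / t) (g 0) (g t) (g s).
Proof.
move=> ig /andP[s0 st] /andP[t0 ta]; split.
- by rewrite divr_ge0 ?(ltW t0) //= ler_pdivrMr // mul1r.
- by rewrite !(isometric_on0 ig) ?divfK ?gt_eqF //; lra.
- rewrite (isometric_onE ig) ?(isometric_on0 ig) //; try lra.
  rewrite ler0_norm; last by lra.
  by field; rewrite gt_eqF.
Qed.

(* [spread g h] is 2 sin (theta / 2), where theta is the angle between [g] and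
   [h] at their common origin. *)
Definition spread g h : R := sup [set k | exists2 m, 0 < m &
  forall s, 0 < s <= m -> k * s <= d (g s) (h s)].

Lemma spreadC g h : spread g h = spread h g.
Proof.
rewrite /spread; congr (sup _); apply/seteqP; split=> k [m m0 H]; exists m => // s;
  by rewrite metric_sym; exact: H.
Qed.

Section spread.
Variables (g h : R -> M) (a b : R).
Hypotheses (a0 : 0 < a) (b0 : 0 < b) (gh : g 0 = h 0).
Hypotheses (ig : isometric_on g a) (ih : isometric_on h b).

Lemma dist_hinge_le s : 0 <= s <= a -> 0 <= s <= b -> d (g s) (h s) <= 2 * s.
Proof.
move=> sa sb; have := metric_triangle (g s) (g 0) (h s).
by rewrite (metric_sym (g s) (g 0)) (isometric_on0 ig) // gh (isometric_on0 ih) //; lra.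
Qed.

Lemma spread_has_sup : has_sup [set k | exists2 m, 0 < m &
  forall s, 0 < s <= m -> k * s <= d (g s) (h s)].
Proof.
split; first by exists 0, 1 => // s _; rewrite mul0r mdist_ge0.
exists 2 => k [m m0 H].
pose s := Num.min m (Num.min a b).
have s0 : 0 < s by rewrite !lt_min m0 a0 b0.
have sm : s <= m by rewrite ge_min lexx.
have sa : s <= a by rewrite !ge_min lexx !orbT.
have sb : s <= b by rewrite !ge_min lexx !orbT.
have H1 := H s; have H2 := @dist_hinge_le s.
rewrite -(ler_pM2r s0); apply: le_trans (H1 _) (H2 _ _); lra.
Qed.

Lemma spread_ge0 : 0 <= spread g h.
Proof.
apply: ub_le_sup; first by case: spread_has_sup.
by exists 1 => // s _; rewrite mul0r mdist_ge0.
Qed.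

Lemma spread_le k m : 0 < m ->
  (forall s, 0 < s <= m -> d (g s) (h s) <= k * s) -> spread g h <= k.
Proof.
move=> m0 H; apply: ge_sup; first by case: spread_has_sup.
move=> k' [m' m'0 H'].
pose s := Num.min m m'.
have s0 : 0 < s by rewrite lt_min m0.
have sm : s <= m by rewrite ge_min lexx.
have sm' : s <= m' by rewrite ge_min lexx orbT.
by rewrite -(ler_pM2r s0); apply: le_trans (H' _ _) (H _ _); rewrite s0.
Qed.

Lemma spread_le2 : spread g h <= 2.
Proof.
apply: (@spread_le _ (Num.min a b)); first by rewrite lt_min a0.
by move=> s; rewrite le_min => /and3P[s0 sa sb]; apply: dist_hinge_le; lra.
Qed.

Lemma spread_near e : 0 < e -> exists2 m, 0 < m <= Num.min a b &
  forall s, 0 < s <= m -> (spread g h ^+ 2 - 4 * e) * s ^+ 2 <= d (g s) (h s) ^+ 2.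
Proof.
move=> e0; have [k [m m0 H] lt] := sup_adherent e0 spread_has_sup.
exists (Num.min m (Num.min a b)); first by rewrite !lt_min m0 a0 b0 ge_min lexx orbT.
move=> s; rewrite !le_min => /and4P[s0 sm sa sb].
have {}H := H s _; have {}H := H ltac:(lra).
have K0 := spread_ge0; have K2 := spread_le2.
have D0 := mdist_ge0 (g s) (h s).
rewrite -/(spread g h) in lt.
have [neg|pos] := leP (spread g h ^+ 2 - 4 * e) 0.
  by apply: (@le_trans _ _ 0); [rewrite mulr_le0_ge0 // sqr_ge0|rewrite sqr_ge0].
have eK : e < spread g h by nra.
have le : (spread g h - e) * s <= d (g s) (h s) by apply: le_trans H; rewrite ler_pM2r // ltW.
have : ((spread g h - e) * s) ^+ 2 <= d (g s) (h s) ^+ 2.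
  by rewrite ler_sqr ?nnegrE // mulr_ge0; lra.
apply: le_trans; rewrite exprMn ler_wpM2r ?sqr_ge0 //; nra.
Qed.

Variable rho : R.
Hypothesis C : curved_within M rho.

(** Both points slide towards the origin by the ratio [s / t]. So the quotient of chord by parameter
    grows as the parameter decreases, and [spread], which is its lower limit, dominates it at all
    small scales. *)
Lemma dist_hinge_mono s t : 0 < s <= t -> t <= a -> t <= b -> 2 * t < rho ->
  d (g t) (h t) * s <= d (g s) (h s) * t.
Proof.
move=> /andP[s0 st] ta tb tr; have t0 : 0 < t by lra.
have bg := @isometric_between g a s t ig ltac:(lra) ltac:(lra).
have bh := @isometric_between h b s t ih ltac:(lra) ltac:(lra).
have := @inner_between _ _ rho _ _ (g 0) (g t) (h t) (g s) (h s) C _ bg.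
rewrite gh in bg * => /(_ _ _ bh)/wrap[].
  by rewrite -{1}gh (isometric_on0 ig) ?(isometric_on0 ih); lra.
rewrite /inner -gh !(isometric_on0 ig) ?gh ?(isometric_on0 ih); try lra.
have -> : s / t * (s / t) * (t ^+ 2 + t ^+ 2 - d (g t) (h t) ^+ 2) =
    2 * s ^+ 2 - (d (g t) (h t) * s / t) ^+ 2 by field; rewrite gt_eqF.
move=> H; rewrite -ler_pdivrMr // -ler_sqr ?nnegrE ?mdist_ge0 //; first by lra.
by rewrite divr_ge0 ?mulr_ge0 ?mdist_ge0 // ltW.
Qed.

Lemma dist_hinge_spread s : 0 < s -> s <= a -> s <= b -> 2 * s < rho ->
  d (g s) (h s) <= spread g h * s.
Proof.
move=> s0 sa sb sr; rewrite -ler_pdivrMr //.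
apply: ub_le_sup; first by case: spread_has_sup.
exists s => // t /andP[t0 ts].
have := @dist_hinge_mono t s; rewrite t0 ts => /(_ isT sa sb sr) H.
by rewrite mulrAC ler_pdivrMr.
Qed.

End spread.

Local Ltac fact_lra := clear_facts I; lra.

(** The squared spread is [2 - 2 * cos theta]. Hence this is the strainer inequality for directions:
    if the cosine between [h1] and [h2] is at most [t ^+ 2 - 1], the other two cosines add up to at
    least [- 3 * t]. It is obtained from points at parameter [s], with [t + e] for [h], and the
    error [e] is arbitrary. *)
Lemma spread_strainer rho g h1 h2 a b1 b2 t : curved_within M rho -> 0 < rho ->
  0 < a -> 0 < b1 -> 0 < b2 -> g 0 = h1 0 -> h1 0 = h2 0 ->
  isometric_on g a -> isometric_on h1 b1 -> isometric_on h2 b2 ->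
  0 <= t -> 4 - 2 * t ^+ 2 <= spread h1 h2 ^+ 2 ->
  spread g h1 ^+ 2 + spread g h2 ^+ 2 <= 4 + 6 * t.
Proof.
move=> C r0 a0 b10 b20 gh hh ig ih1 ih2 t0 Ht.
apply/ler_addgt0Pl => e' e'0.
pose e := Num.min 1 (e' / 10).
have e0 : 0 < e by rewrite lt_min ltr01 divr_gt0.
have e1 : e <= 1 by rewrite ge_min lexx.
have ee : e <= e' / 10 by rewrite ge_min lexx orbT.
have ee0 : 0 < e ^+ 2 / 2 by rewrite divr_gt0 // exprn_gt0.
have gh2 : g 0 = h2 0 by rewrite gh.
have [m1] := spread_near b10 b20 hh ih1 ih2 ee0.
have [m2] := spread_near a0 b10 gh ig ih1 ee0.
have [m3] := spread_near a0 b20 gh2 ig ih2 ee0.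
rewrite !le_min => /and3P[m30 m3a m3b] H3 /and3P[m20 m2a m2b] H2 /and3P[m10 m1a m1b] H1.
pose s := Num.min (Num.min m1 (rho / 2)) (Num.min m2 m3).
have s0 : 0 < s by rewrite !lt_min m10 m20 m30 divr_gt0.
have sm1 : s <= m1 by rewrite !ge_min lexx.
have sr : s <= rho / 2 by rewrite !ge_min lexx !orbT.
have sm2 : s <= m2 by rewrite !ge_min lexx !orbT.
have sm3 : s <= m3 by rewrite !ge_min lexx !orbT.
have {}H1 := H1 s ltac:(move: s0 sm1; fact_lra).
have {}H2 := H2 s ltac:(move: s0 sm2; fact_lra).
have {}H3 := H3 s ltac:(move: s0 sm3; fact_lra).
have dg : d (g 0) (g s) = s by rewrite (isometric_on0 ig); move: s0 sm2 m2a; fact_lra.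
have dh1 : d (g 0) (h1 s) = s by rewrite gh (isometric_on0 ih1); move: s0 sm1 m1a; fact_lra.
have dh2 : d (g 0) (h2 s) = s by rewrite gh2 (isometric_on0 ih2); move: s0 sm1 m1b; fact_lra.
have := C (g 0) (g s) (h1 s) (h2 s) _ _ _ (t + e) _ _.
rewrite /inner dg dh1 dh2 => H.
have {}H := H ltac:(move: s0 sr r0; fact_lra) ltac:(move: s0 sr r0; fact_lra) ltac:(move: s0 sr r0; fact_lra)
  ltac:(move: t0 e0; fact_lra).
have s20 : 0 < s ^+ 2 by rewrite exprn_gt0.
have : (4 - 2 * t ^+ 2 - 4 * (e ^+ 2 / 2)) * s ^+ 2 <= d (h1 s) (h2 s) ^+ 2.
  by apply: le_trans H1; rewrite ler_pM2r //; move: Ht ee0; fact_lra.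
have te : 0 <= t * e * s ^+ 2 by rewrite !mulr_ge0 // ltW.
move=> K; have {}H := H ltac:(move: K te; fact_lra).
have : 0 <= s * (4 * s ^+ 2 - d (g s) (h1 s) ^+ 2 - d (g s) (h2 s) ^+ 2 + 6 * (t + e) * s ^+ 2).
  by move: H; fact_lra.
rewrite pmulr_rge0 // => {}H.
have : 0 <= (4 + 6 * (t + e) + 4 * e ^+ 2 - spread g h1 ^+ 2 - spread g h2 ^+ 2) * s ^+ 2.
  by move: H H2 H3; fact_lra.
rewrite pmulr_lge0 // => {}H.
have : e ^+ 2 <= e by rewrite expr2 ler_piMl // ltW.
by move: H ee; fact_lra.
Qed.

(** Toponogov's hinge comparison for legs of total length less than [L]: as the squared spread is
    [2 - 2 * cos theta], the right-hand side is the law of cosines. *)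
Definition hinge_bound L : Prop := forall g h a b, 0 <= a -> 0 <= b ->
  g 0 = h 0 -> isometric_on g a -> isometric_on h b -> a + b < L ->
  d (g a) (h b) ^+ 2 <= (a - b) ^+ 2 + a * b * spread g h ^+ 2.

Lemma hinge_bound_local rho : curved_within M rho -> hinge_bound rho.
Proof.
move=> C g h a b; rewrite le_eqVlt => /predU1P[<- b0 gh ig ih _|a0].
  by rewrite gh (isometric_on0 ih) ?b0 ?lexx //; lra.
rewrite le_eqVlt => /predU1P[<- gh ig ih _|b0 gh ig ih ab].
  by rewrite -gh metric_sym (isometric_on0 ig) ?(ltW a0) ?lexx //; lra.
pose s := Num.min (Num.min a b) (rho / 4).
have s0 : 0 < s by rewrite !lt_min a0 b0; lra.
have sa : s <= a by rewrite !ge_min lexx.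
have sb : s <= b by rewrite !ge_min lexx orbT.
have sr : s <= rho / 4 by rewrite !ge_min lexx orbT.
have bg := @isometric_between g a s a ig ltac:(move: s0 sa; fact_lra) ltac:(move: a0; fact_lra).
have bh := @isometric_between h b s b ih ltac:(move: s0 sb; fact_lra) ltac:(move: b0; fact_lra).
have da : d (g 0) (g a) = a by rewrite (isometric_on0 ig); move: a0; fact_lra.
have db : d (g 0) (h b) = b by rewrite gh (isometric_on0 ih); move: b0; fact_lra.
have ds : d (g 0) (g s) = s by rewrite (isometric_on0 ig); move: s0 sa; fact_lra.
have ds' : d (g 0) (h s) = s by rewrite gh (isometric_on0 ih); move: s0 sb; fact_lra.
rewrite -gh in bh.
have := @inner_between _ _ rho _ _ (g 0) (g a) (h b) (g s) (h s) C _ bg bh.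
rewrite /inner da db ds ds' => /(_ ab) H.
have K := @dist_hinge_spread g h a b a0 b0 gh ig ih rho C s s0 sa sb ltac:(move: s0 sr; fact_lra).
have K2 : d (g s) (h s) ^+ 2 <= (spread g h * s) ^+ 2.
  by rewrite ler_sqr ?nnegrE ?mdist_ge0 // mulr_ge0 ?(spread_ge0 a0 b0) ?ltW.
have E : s / a * (s / b) * (a ^+ 2 + b ^+ 2 - d (g a) (h b) ^+ 2) =
    s ^+ 2 / (a * b) * (a ^+ 2 + b ^+ 2 - d (g a) (h b) ^+ 2).
  by field; rewrite !gt_eqF.
rewrite E in H.
have P : 0 < s ^+ 2 / (a * b) by rewrite divr_gt0 ?exprn_gt0 ?mulr_gt0.
rewrite -subr_ge0 -(pmulr_rge0 _ P).
have -> : s ^+ 2 / (a * b) * ((a - b) ^+ 2 + a * b * spread g h ^+ 2 - d (g a) (h b) ^+ 2) =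
  s ^+ 2 / (a * b) * (a ^+ 2 + b ^+ 2 - d (g a) (h b) ^+ 2) - 2 * s ^+ 2 + s ^+ 2 * spread g h ^+ 2.
  by field; rewrite !gt_eqF.
lra.
Qed.

End globalization.

Section globalization_step.
Context {R : realType} {M : metricType R}.
Hypotheses (cM : compact [set: M]) (iM : intrinsic_metric M).
Implicit Types (x y z w p q : M) (g h : R -> M) (a b c s t u : R).
Local Notation d := (@mdist R M).
Local Ltac fact_lra := clear_facts I; lra.

(* The Lang-Schroeder trick: the long hinge [g], [h] is cut at the point
   [h b1] with [a + 3 * b1 = 2/3 * L], so that the bound is available for both
   hinges adjacent to the segment from [h 0] to [h b1]. *)
Lemma hinge_step rho L g h a b : curved_within M rho -> 0 < rho ->
  hinge_bound (M := M) (2 / 3 * L) -> 0 < a -> a <= b -> g 0 = h 0 ->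
  isometric_on g a -> isometric_on h b -> 2 / 3 * L <= a + b < L ->
  exists g' h' a' b', [/\ 0 <= a', 0 <= b', g' 0 = h' 0,
    isometric_on g' a' & isometric_on h' b'] /\
    [/\ g' a' = g a, h' b' = h b, a' + b' <= a + b,
    (a' - b') ^+ 2 + a' * b' * spread g' h' ^+ 2 <=
      (a - b) ^+ 2 + a * b * spread g h ^+ 2 &
    (a + b) ^+ 2 - ((a - b) ^+ 2 + a * b * spread g h ^+ 2) <=
      36 * L * ((a + b) - (a' + b'))].
Proof.
move=> C r0 HB a0 ab gh ig ih /andP[L1 L2].
pose b1 := (2 / 3 * L - a) / 3.
have b1E : 3 * b1 = 2 / 3 * L - a by rewrite /b1; field.
have b1L : L < 18 * b1 by lra.
have b1b : b1 < b by lra.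
have b10 : 0 < b1 by lra.
have [sg [sg0 sgc isg]] := geodesic_exists cM iM (h b1) (g a).
set c := d (h b1) (g a) in sgc isg.
have c0 : 0 <= c by exact: mdist_ge0.
have dg : d (g 0) (g a) = a by rewrite (isometric_on0 ig); move: a0; fact_lra.
have dh : d (h 0) (h b1) = b1 by rewrite (isometric_on0 ih); move: b10 b1b; fact_lra.
have cab : c <= a + b1.
  have := metric_triangle (h b1) (h 0) (g a).
  by rewrite (metric_sym (h b1) (h 0)) dh -gh dg -/c; fact_lra.
have ih1 : isometric_on h b1 by apply: isometric_on_le ih; move: b1b; fact_lra.
have := HB g h a b1 (ltW a0) (ltW b10) gh ig ih1 ltac:(move: b1E b10; fact_lra).
rewrite metric_sym -/c => H1.
pose h' s := h (b1 + s); pose hr s := h (b1 - s).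
have ih' : isometric_on h' (b - b1) by apply: isometric_on_shift => //; move: b10 b1b; fact_lra.
have ihr : isometric_on hr b1 by apply: isometric_on_rev ih; move: b1b; fact_lra.
have h'0 : h' 0 = h b1 by rewrite /h' addr0.
have hr0 : hr 0 = h b1 by rewrite /hr subr0.
have H2 := HB sg hr c b1 c0 (ltW b10) (etrans sg0 (esym hr0)) isg ihr ltac:(move: cab b1E b10; fact_lra).
have := H2; rewrite sgc /hr subrr -/hr -gh metric_sym dg => {}H2.
(* [hr] and [h'] leave [h b1] in opposite directions, so their spread is 2, and [spread_strainer]
   with [t = 0] says that the adjacent angles add up to at most pi. The factor [c] takes care of the
   degenerate segment. *)
have H3 : c * spread sg h' ^+ 2 <= c * (4 - spread sg hr ^+ 2).
  have [->|cn] := eqVneq c 0; first by rewrite !mul0r.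
  have cp : 0 < c by rewrite lt_def cn.
  rewrite ler_wpM2l //.
  have Kop : spread hr h' = 2.
    apply/eqP; rewrite eq_le (@spread_le2 _ _ hr h' b1 (b - b1)) ?h'0 ?subr_gt0 //=.
    have [S1 S2] := @spread_has_sup _ _ hr h' b1 (b - b1) b10 ltac:(move: b1b; fact_lra)
      (etrans hr0 (esym h'0)) ihr ih'.
    apply: ub_le_sup S2 _ _.
    exists (Num.min b1 (b - b1)); first by rewrite lt_min b10 subr_gt0.
    move=> s; rewrite le_min => /and3P[s0 s1 s2].
    rewrite /hr /h' (isometric_onE ih); [|by move: s0 s1 b1b; fact_lra|by move: s0 s2 b10; fact_lra].
    by rewrite ler0_norm; move: s0; fact_lra.
  have := @spread_strainer _ _ rho sg hr h' c b1 (b - b1) 0 C r0 cp b10 ltac:(move: b1b; fact_lra)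
    (etrans sg0 (esym hr0)) (etrans hr0 (esym h'0)) isg ihr ih' (lexx _).
  rewrite Kop => /(_ ltac:(fact_lra)); fact_lra.
have bb1 : 0 <= b - b1 by move: b1b; fact_lra.
have {}H3 := ler_wpM2l bb1 H3.
have {}H1 := ler_wpM2l (le_trans (ltW a0) ab) H1.
have {}H2 := ler_wpM2l bb1 H2.
exists sg, h', c, (b - b1); split; first by split => //; rewrite h'0.
split => //.
- by rewrite /h'; congr (h _); ring.
- by move: cab; fact_lra.
- have H3' := ler_wpM2l (ltW b10) H3.
  rewrite -(ler_pM2l b10).
  clear -H1 H2 H3'; move: (spread sg h' ^+ 2) (spread g h ^+ 2) (spread sg hr ^+ 2) H1 H2 H3'.
  by move=> k1 k2 k3 H1 H2 H3; nra.
- have bE : a + b - (c + (b - b1)) = a + b1 - c by ring.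
  rewrite bE.
  have : b1 * ((a + b) ^+ 2 - ((a - b) ^+ 2 + a * b * spread g h ^+ 2)) <=
     b * ((a + b1 - c) * (a + b1 + c)).
    clear -H1; move: (spread g h ^+ 2) H1 => k H1; lra.
  move=> H4; rewrite -(ler_pM2l b10); apply: le_trans H4 _.
  have e0 : 0 <= a + b1 - c by move: cab; fact_lra.
  have : (a + b1 - c) * (a + b1 + c) <= (a + b1 - c) * (2 * L).
    by apply: ler_wpM2l => //; move: cab b1E b10 a0 L1 L2 b1b; fact_lra.
  move=> H5; have b0 : 0 <= b by move: a0 ab; fact_lra.
  apply: le_trans (ler_wpM2l b0 H5) _.
  have : b * (a + b1 - c) * (2 * L) <= 18 * b1 * (a + b1 - c) * (2 * L).
    by apply: ler_wpM2r; [move: a0 ab L2; fact_lra|apply: ler_wpM2r => //; move: b1L L2 a0; fact_lra].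
  by fact_lra.
Qed.

(** Given a counterexample with ends [p], [q], consider all hinges with these ends, in either order,
    whose law of cosines gives at most [mu < d p q ^+ 2]. By [hinge_step] each one that violates the
    bound can be replaced by one whose total length is smaller by at least
    [(d p q ^+ 2 - mu) / (36 * L)]. A hinge within that amount of the infimum of the total lengths
    is thus contradictory; no minimal hinge has to exist. *)
Lemma hinge_bound_enlarge rho L : curved_within M rho -> 0 < rho ->
  hinge_bound (M := M) (2 / 3 * L) -> hinge_bound (M := M) L.
Proof.
move=> C r0 HB g0 h0 a0 b0 a00 b00 gh0 ig0 ih0 abL; rewrite leNgt; apply/negP => lt.
set p := g0 a0 in lt; set q := h0 b0 in lt; set mu := (_ + _) in lt.
have L0 : 0 < L by lra.
pose St x y s := exists g h a b, [/\ 0 <= a, a <= b, g 0 = h 0, isometric_on g a & isometric_on h b]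
   /\ [/\ g a = x, h b = y, a + b = s, s < L & (a - b) ^+ 2 + a * b * spread g h ^+ 2 <= mu].
pose A := [set s | St p q s \/ St q p s].
have inA g h a b : 0 <= a -> 0 <= b -> g 0 = h 0 -> isometric_on g a -> isometric_on h b ->
    (g a = p /\ h b = q) \/ (g a = q /\ h b = p) -> a + b < L ->
    (a - b) ^+ 2 + a * b * spread g h ^+ 2 <= mu -> A (a + b).
  move=> Ha Hb gh ig ih Hpq Hab Hmu.
  case: (leP a b) => [ab|/ltW ba]; case: Hpq => [[Hp Hq]|[Hp Hq]].
  - by left; exists g, h, a, b.
  - by right; exists g, h, a, b.
  - right; exists h, g, b, a; do 2!split => //; first by rewrite addrC.
    by rewrite spreadC -[X in X ^+ 2]opprB sqrrN (mulrC b).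
  - left; exists h, g, b, a; do 2!split => //; first by rewrite addrC.
    by rewrite spreadC -[X in X ^+ 2]opprB sqrrN (mulrC b).
have A_inf : has_inf A.
  split; first by exists (a0 + b0); apply: (inA g0 h0) => //; left.
  exists 0 => s [] [g [h [a [b [[Ha Hb _ _ _] [_ _ <- _ _]]]]]]; lra.
pose e := (d p q ^+ 2 - mu) / (36 * L).
have L36 : 0 < 36 * L by lra.
have e0 : 0 < e by rewrite divr_gt0 // subr_gt0.
have [s sA slt] := inf_adherent e0 A_inf.
have [x [y [pq [g [h [a [b [[Ha ab gh ig ih] [ga hb sE sL Hmu]]]]]]]]] :
    exists x y, ((x = p /\ y = q) \/ (x = q /\ y = p)) /\ St x y s.
  by case: sA => H; [exists p, q|exists q, p]; split => //; [left|right].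
have dpq : d p q = d x y by case: pq => [[-> ->]|[-> ->]] //; rewrite metric_sym.
have muxy : mu < d (g a) (h b) ^+ 2 by rewrite ga hb -dpq.
have a1 : 0 < a.
  rewrite lt_def Ha andbT; apply/negP => /eqP aE.
  move: muxy Hmu; rewrite aE gh (isometric_on0 ih); last by move: ab Ha aE; fact_lra.
  by fact_lra.
have L1 : 2 / 3 * L <= a + b.
  rewrite leNgt; apply/negP => Hlt.
  have := HB g h a b Ha (le_trans Ha ab) gh ig ih Hlt; move: muxy Hmu; fact_lra.
have [g' [h' [a' [b' [[a'0 b'0 gh' ig' ih'] [g'a h'b s' mu' def]]]]]] :=
  hinge_step C r0 HB a1 ab gh ig ih ltac:(move: L1 sE sL; fact_lra).
have : A (a' + b').
  apply: (inA g' h') => //; [|by move: s' sE sL; fact_lra|by move: mu' Hmu; fact_lra].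
  by rewrite g'a h'b ga hb.
move=> /(ge_inf A_inf.2) Hinf.
have tri : d (g a) (h b) <= a + b.
  have := metric_triangle (g a) (g 0) (h b).
  rewrite (metric_sym (g a) (g 0)) (isometric_on0 ig); last by move: a1; fact_lra.
  by rewrite gh (isometric_on0 ih); move: Ha ab; fact_lra.
have d0 := mdist_ge0 (g a) (h b).
have tri2 : d (g a) (h b) ^+ 2 <= (a + b) ^+ 2 by rewrite ler_sqr ?nnegrE; move: tri d0; fact_lra.
have : 36 * L * ((a + b) - (a' + b')) < 36 * L * e by rewrite ltr_pM2l //; move: Hinf slt sE; fact_lra.
have -> : 36 * L * e = d p q ^+ 2 - mu by rewrite /e mulrC divfK // gt_eqF.
rewrite dpq -ga -hb; move: def Hmu mu' tri2; fact_lra.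
Qed.

End globalization_step.

Section global_comparison.
Context {R : realType} {M : metricType R}.
Hypotheses (cM : compact [set: M]) (iM : intrinsic_metric M).
Local Notation d := (@mdist R M).

Lemma hinge_bound_global (rho L : R) : curved_within M rho -> 0 < rho ->
  hinge_bound (M := M) L.
Proof.
move=> C r0.
have H n : hinge_bound (M := M) ((3 / 2) ^+ n * rho).
  elim: n => [|n IH]; first by rewrite mul1r; exact: hinge_bound_local.
  apply: (hinge_bound_enlarge cM iM C r0).
  have -> : 2 / 3 * ((3 / 2) ^+ n.+1 * rho) = (3 / 2) ^+ n * rho by rewrite exprS; field.
  exact: IH.
have [n nL] : exists n, L <= (3 / 2) ^+ n * rho.
  have B n : 1 + n%:R / 2 <= (3 / 2 : R) ^+ n.
    elim: n => [|n IH]; first by rewrite mul0r addr0 expr0.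
    have : 0 <= (n%:R : R) by [].
    by rewrite exprS -natr1; nra.
  exists (Num.truncn (2 * L / rho)).+1.
  have := B (Num.truncn (2 * L / rho)).+1.
  have := truncnS_gt (2 * L / rho).
  rewrite ltr_pdivrMr // => H1 H2.
  apply: le_trans (ler_wpM2r (ltW r0) H2); lra.
by move=> g h a b a0 b0 gh ig ih ab; apply: (H n) => //; lra.
Qed.

(** The hinge comparison says that angles at [z] are at least the comparison angles. So the
    hypothesis passes from [a], [b] to the spread of the geodesics, [spread_strainer] applies there,
    and its conclusion passes back to comparison angles. *)
Lemma strainer_ineq_global (rho : R) (z x a b : M) : curved_within M rho -> 0 < rho ->
  strainer_ineq z x a b.
Proof.
move=> C r0 h h0.
have [gx [gx0 gx1 igx]] := geodesic_exists cM iM z x.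
have [ga [ga0 ga1 iga]] := geodesic_exists cM iM z a.
have [gb [gb0 gb1 igb]] := geodesic_exists cM iM z b.
have [->|zx] := eqVneq x z.
  by rewrite !inner_base mdistxx; lra.
have [->|za] := eqVneq a z.
  by rewrite (innerC z x z) !inner_base mdistxx; lra.
have [->|zb] := eqVneq b z.
  by rewrite (innerC z x z) !inner_base mdistxx; lra.
have {}zx : 0 < d z x by rewrite mdist_gt0 eq_sym.
have {}za : 0 < d z a by rewrite mdist_gt0 eq_sym.
have {}zb : 0 < d z b by rewrite mdist_gt0 eq_sym.
have HB := hinge_bound_global (L := d z x + d z a + d z b + 1) C r0.
have Hxa := HB gx ga _ _ (ltW zx) (ltW za) (etrans gx0 (esym ga0)) igx iga ltac:(lra).
have Hxb := HB gx gb _ _ (ltW zx) (ltW zb) (etrans gx0 (esym gb0)) igx igb ltac:(lra).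
have Hab := HB ga gb _ _ (ltW za) (ltW zb) (etrans ga0 (esym gb0)) iga igb ltac:(lra).
rewrite gx1 ga1 gb1 in Hxa Hxb Hab.
rewrite /inner => H.
have P : 0 < d z a * d z b by rewrite mulr_gt0.
have K : 4 - 2 * h ^+ 2 <= spread ga gb ^+ 2.
  by rewrite -(ler_pM2l P); lra.
have := spread_strainer C r0 zx za zb (etrans gx0 (esym ga0)) (etrans ga0 (esym gb0)) igx iga igb h0 K.
move=> S.
have P2 : 0 <= d z x * d z a * d z b by rewrite !mulr_ge0 // ltW.
have {}S := ler_wpM2l P2 S.
have {}Hxa := ler_wpM2l (ltW zb) Hxa.
have {}Hxb := ler_wpM2l (ltW za) Hxb.
lra.
Qed.

End global_comparison.

(** * Homotheties and packings *)

Section space.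
Context {R : realType} {M : metricType R}.
Local Notation d := (@mdist R M).

Definition geodesic_space : Prop := forall x y : M,
  exists g : R -> M, [/\ g 0 = x, g (d x y) = y & isometric_on g (d x y)].

Definition curved : Prop := forall z x a b : M, strainer_ineq z x a b.

Lemma between_exists (t : R) (x y : M) : geodesic_space -> 0 <= t <= 1 ->
  exists z, between t x y z.
Proof.
move=> geo t01; have [g [g0 g1 ig]] := geo x y.
have D0 := mdist_ge0 x y.
have tD : 0 <= t * d x y <= d x y by rewrite mulr_ge0 ?ler_piMl //; lra.
exists (g (t * d x y)); split => //; first by rewrite -{1}g0 (isometric_on0 ig).
rewrite -{2}g1 (isometric_onE ig) //; last by lra.
by rewrite ler0_norm; lra.
Qed.

Lemma curved_between (t : R) (x y z w : M) : curved -> between t x y z ->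
  (1 - t) * d w x ^+ 2 + t * d w y ^+ 2 - t * (1 - t) * d x y ^+ 2 <= d w z ^+ 2.
Proof.
move=> C; have C' : curved_within M (d z x + d z y + d z w + 1) by move=> *; exact: C.
have := mdist_ge0 z x; have := mdist_ge0 z y; have := mdist_ge0 z w => h1 h2 h3.
by apply: between_ineq C' _ _ _; lra.
Qed.

Lemma curved_inner (t u : R) (p x y x' y' : M) : curved ->
  between t p x x' -> between u p y y' -> inner p x' y' <= t * u * inner p x y.
Proof.
move=> C; have C' : curved_within M (d p x + d p y + 1) by move=> *; exact: C.
by apply: inner_between C' _; rewrite ltrDl.
Qed.

Lemma between1 (x y : M) : between 1 x y y.
Proof. by split; [rewrite lexx ler01|rewrite mul1r|rewrite subrr mul0r mdistxx]. Qed.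

(** Geodesics from [p] spread no faster than in the plane, so a homothety of ratio [t] shrinks
    distances by a factor [t] at worst. It is picked by choice and need not be continuous. *)
Lemma contraction (p : M) (t : R) : geodesic_space -> curved -> 0 <= t <= 1 ->
  exists c : M -> M, (forall x, between t p x (c x)) /\
    (forall x y, t * d x y <= d (c x) (c y)).
Proof.
move=> geo C t01.
have /choice[c Hc] x := between_exists p x geo t01.
exists c; split => // x y; have t0 : 0 <= t by case/andP: t01.
have := curved_inner C (Hc x) (Hc y).
have [_ cx _] := Hc x; have [_ cy _] := Hc y.
rewrite /inner cx cy => H.
rewrite -ler_sqr ?nnegrE ?mulr_ge0 ?mdist_ge0 //; lra.
Qed.

Definition packing (e : R) (A : set M) (N : nat) : Prop :=
  exists f : 'I_N -> M, (forall i, A (f i)) /\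
    (forall i j, i != j -> e <= d (f i) (f j)).

Lemma packing_image (t e : R) (A B : set M) (c : M -> M) N : 0 <= t ->
  (forall x, A x -> B (c x)) -> (forall x y, t * d x y <= d (c x) (c y)) ->
  packing e A N -> packing (t * e) B N.
Proof.
move=> t0 cB cd [f [fA fe]]; exists (c \o f); split => [i|i j ij]; first exact: cB.
by apply: le_trans (cd _ _); rewrite ler_wpM2l // fe.
Qed.

Lemma packing_union (e : R) (A B C : set M) N1 N2 : A `<=` C -> B `<=` C ->
  (forall x y, A x -> B y -> e <= d x y) ->
  packing e A N1 -> packing e B N2 -> packing e C (N1 + N2).
Proof.
move=> AC BC AB [f [fA fe]] [g [gB ge]].
exists (fun i => match fintype.split i with inl i => f i | inr i => g i end); split.
  by move=> i; case: splitP => j _; [exact: AC|exact: BC].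
move=> i j; case: (splitP i) => k ik; case: (splitP j) => l jl ij.
- by apply: fe; apply: contra ij => /eqP kl; apply/eqP/val_inj; rewrite /= ik jl kl.
- exact: AB.
- by rewrite metric_sym; exact: AB.
- by apply: ge; apply: contra ij => /eqP kl; apply/eqP/val_inj; rewrite /= ik jl kl.
Qed.

Lemma set_diamP (x y : M) : compact [set: M] -> d x y <= set_diam [set: M].
Proof.
move=> cM; apply: ub_le_sup; last by exists x => //; exists y.
have [|c _ Hc] := compact_EVT_max _ cM (continuous_subspaceT (@mdist_continuousr R M x)).
  by exists x.
exists (2 * d x c) => _ [u _ [v _ <-]].
have hu := Hc u; have hv := Hc v; rewrite !inE in hu hv.
have := metric_triangle u x v; rewrite (metric_sym u x).
have {}hu := hu I; have {}hv := hv I; lra.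
Qed.

End space.
Arguments geodesic_space {R} M.
Arguments curved {R} M.

(** * Packings and Hausdorff measure *)

Section hausdorff.
Context {R : realType} {M : metricType R}.
Local Notation d := (@mdist R M).

Lemma set_diam_le (A : set M) (e : R) : A !=set0 ->
  (forall x y, A x -> A y -> d x y <= e) -> set_diam A <= e.
Proof.
move=> [x Ax] H; apply: ge_sup; first by exists (d x x), x => //; exists x.
by move=> _ [u Au [v Av <-]]; exact: H.
Qed.

Lemma set_diam_ge (A : set M) (e : R) (x y : M) :
  (forall x y, A x -> A y -> d x y <= e) -> A x -> A y -> d x y <= set_diam A.
Proof.
move=> H Ax Ay; apply: ub_le_sup; last by exists x => //; exists y.
by exists e => _ [u Au [v Av <-]]; exact: H.
Qed.

Lemma diam_pow_ge0 (s : R) (A : set M) : 0 <= diam_pow s A.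
Proof. by rewrite /diam_pow; case: ifP => // _; exact: powR_ge0. Qed.

Lemma diam_pow_le (s e : R) (A : set M) : 0 <= s -> 
  (forall x y, A x -> A y -> d x y <= e) -> diam_pow s A <= e `^ s.
Proof.
move=> s0 H; rewrite /diam_pow; case: ifPn => [_|/set0P A0]; first exact: powR_ge0.
have D : 0 <= set_diam A.
  by case: A0 => x Ax; rewrite -(mdistxx x); exact: (set_diam_ge H Ax Ax).
have le := set_diam_le A0 H.
by apply: ge0_ler_powR => //; rewrite nnegrE // (le_trans D).
Qed.

Lemma packing_max (e : R) (A : set M) N : ~ packing e A N.+1 ->
  exists2 N0, (N0 <= N)%N & packing e A N0 /\ ~ packing e A N0.+1.
Proof.
elim: N => [|N IH] H.
  exists 0%N => //; split => //.
  have e0 : 'I_0 -> False by case.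
  by exists (fun i => False_rect M (e0 i)); split; case.
have [P|nP] := pselect (packing e A N.+1); first by exists N.+1.
by have [N0 h1 h2] := IH nP; exists N0 => //; exact: leqW.
Qed.

(** The balls of radius [e] around a maximal packing cover [A], and their diameters are at most
    [2 * e]. *)
Lemma hausdorff_outer_le (s C : R) (A : set M) : 0 <= s ->
  (forall delta, 0 < delta -> exists e, 0 < e <= delta /\
     exists2 N, ~ packing e A N.+1 & N%:R * (2 * e) `^ s <= C) ->
  (hausdorff_outer s A <= C%:E)%E.
Proof.
move=> s0 H; apply: ge_ereal_sup => _ [delta /= delta0 <-].
have [|e [/andP[e0 ed] [N nP NC]]] := H (delta / 2); first by rewrite divr_gt0.
have [N0 N0N [[f [fA fe]] nP0]] := packing_max nP.
(* For [N0 <= i] this is the empty set, which weighs 0 by the convention in [diam_pow]. *)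
pose U i : set M := [set y | exists2 k : 'I_N0, k = i :> nat & d (f k) y <= e].
have Ue i x y : U i x -> U i y -> d x y <= 2 * e.
  move=> [k ki kx] [k' k'i k'y]; have kk : k = k' by apply: val_inj; rewrite /= ki.
  subst k'; have := metric_triangle x (f k) y; rewrite (metric_sym x (f k)); lra.
have cov : hausdorff_cover delta A U.
  split; last by move=> i x y Ux Uy; have := Ue _ _ _ Ux Uy; lra.
  move=> x Ax; apply: contrapT => nU; apply: nP0.
  rewrite -addn1; apply: (@packing_union _ _ e (range f) [set x] A).
  - by move=> _ [k _ <-]; exact: fA.
  - by move=> _ ->.
  - move=> _ _ [k _ <-] ->; rewrite leNgt; apply/negP => lt; apply: nU.
    by exists (val k) => //; exists k => //; exact: ltW.
  - by exists f; split => // i; exists i.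
  - by exists (fun=> x); split => // i j; rewrite !ord1 eqxx.
apply: (@le_trans _ _ (\sum_(0 <= i <oo) (diam_pow s (U i))%:E)%E).
  by apply: ereal_inf_lbound; exists U.
apply: lime_le.
  by apply: is_cvg_nneseries => n _ _; rewrite lee_fin diam_pow_ge0.
near=> n; rewrite sumEFin lee_fin; apply: le_trans NC.
have pw : 0 <= (2 * e) `^ s by exact: powR_ge0.
suff : \sum_(0 <= i < n) diam_pow s (U i) <= (minn n N0)%:R * (2 * e) `^ s.
  move=> /le_trans; apply; rewrite ler_wpM2r // ler_nat.
  by apply: leq_trans N0N; exact: geq_minr.
elim: (n) => [|m IH]; first by rewrite big_nil min0n mul0r.
rewrite big_nat_recr //=; have [mN|Nm] := ltnP m N0.
  rewrite (minn_idPl mN) -natr1 mulrDl mul1r; apply: lerD.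
    by apply: le_trans IH _; rewrite ler_wpM2r // ler_nat geq_minl.
  by apply: diam_pow_le => //; exact: Ue.
rewrite (minn_idPr (leqW Nm)); rewrite (minn_idPr Nm) in IH.
suff -> : diam_pow s (U m) = 0 by rewrite addr0.
rewrite /diam_pow; case: ifPn => // /set0P[x [k km _]].
by move: Nm; rewrite -km leqNgt ltn_ord.
Unshelve. all: by end_near. Qed.

(** The sets of a countable cover are thickened at a cost of [ep / 2 ^ i.+1] in weight for the set
    of index [i]. They then contain balls around the original points, so that compactness leaves
    finitely many; the bounds [r i] are positive even for single points. *)
Lemma hausdorff_finite_cover (s eta : R) : compact [set: M] -> 0 < s ->
  (hausdorff_outer s [set: M] < eta%:E)%E ->
  exists m (V : 'I_m -> set M) (r : 'I_m -> R),
    [/\ forall i, 0 < r i, forall i x y, V i x -> V i y -> d x y <= r i,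
        forall x, exists i, V i x & \sum_i r i `^ s < eta].
Proof.
move=> cM s0 Hs.
have : (ereal_inf [set (\sum_(0 <= i <oo) (diam_pow s (U i))%:E)%E
                           | U in hausdorff_cover 1 [set: M]] < eta%:E)%E.
  by apply: le_lt_trans Hs; apply: ereal_sup_ubound; exists 1 => //=.
move=> /ereal_inf_lt[_ [U [Ucov U1] <-]] lt.
have pos n : (0 <= (diam_pow s (U n))%:E)%E by rewrite lee_fin diam_pow_ge0.
have S0 : (0 <= \sum_(0 <= i <oo) (diam_pow s (U i))%:E)%E by exact: nneseries_ge0.
have [sg sE] : exists sg, (\sum_(0 <= i <oo) (diam_pow s (U i))%:E)%E = sg%:E.
  case: (\sum_(0 <= i <oo) _)%E S0 lt => [r _ _| |] //; first by exists r.
rewrite sE lte_fin in lt S0.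
pose ep := (eta - sg) / 2.
have ep0 : 0 < ep by rewrite divr_gt0 // subr_gt0.
pose ei i := ep / (2 ^ i.+1)%:R.
have ei0 i : 0 < ei i by rewrite divr_gt0 // ltr0n expn_gt0.
pose r i := (diam_pow s (U i) + ei i) `^ s^-1.
have base0 i : 0 < diam_pow s (U i) + ei i by rewrite ltr_wpDl // diam_pow_ge0.
have r0 i : 0 < r i by exact: powR_gt0.
have rs i : r i `^ s = diam_pow s (U i) + ei i.
  by rewrite /r -powRrM mulVf ?gt_eqF // powRr1 // ltW.
have ar i : U i !=set0 -> set_diam (U i) < r i.
  move=> U0; rewrite ltNge; apply/negP => le.
  have : r i `^ s <= set_diam (U i) `^ s.
    by apply: ge0_ler_powR; rewrite ?nnegrE ?(ltW (r0 i)) ?(ltW s0) // (le_trans (ltW (r0 i))).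
  rewrite rs /diam_pow; case: ifPn => [/eqP E|_]; first by case: U0; rewrite E.
  by rewrite gerDl leNgt ei0.
pose V i : set M := [set y | exists2 x, U i x & d x y < (r i - set_diam (U i)) / 2].
have Vr i x y : V i x -> V i y -> d x y <= r i.
  move=> [x' Ux' xx'] [y' Uy' yy'].
  have := set_diam_ge (U1 i) Ux' Uy'.
  have := metric_triangle x x' y; have := metric_triangle x' y' y.
  by rewrite (metric_sym x x'); lra.
have : \forall n \near \oo, [set: M] `<=` (fun x => exists2 i, (i < n)%N & V i x).
  move/compact_near_coveringP : cM; apply => x _.
  have [i _ Ux] := Ucov x I.
  have gap : 0 < (r i - set_diam (U i)) / 2.
    by rewrite divr_gt0 // subr_gt0 ar //; exists x.
  exists (ball x ((r i - set_diam (U i)) / 2), [set n | (i < n)%N]) => /=.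
    by split; [exact: nbhsx_ballx|exact: nbhs_infty_gt].
  move=> [y n] /= [xy iltn]; exists i => //; exists x => //.
  by rewrite ballEmdist in xy.
move=> [n _ /(_ n (leqnn n)) Vn].
exists n, (fun i => V i), (fun i => r i); split => //.
  by move=> i x y; exact: Vr.
  by move=> x; have [i ilt Vi] := Vn x I; exists (Ordinal ilt).
have : ((\sum_(i < n) r i `^ s)%:E <= (sg + ep)%:E)%E.
  rewrite EFinD -sE -sumEFin.
  apply: le_trans (epsilon_trick predT pos (ltW ep0)).
  rewrite -(big_mkord predT (fun i => (r i `^ s)%:E)).
  under eq_bigr => i _ do rewrite rs EFinD.
  by apply: nneseries_lim_ge => i _ _; rewrite adde_ge0 // lee_fin ltW.
by rewrite lee_fin => /le_lt_trans; apply; rewrite /ep; lra.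
Qed.

End hausdorff.

(** * Packing numbers and dimension *)

Section dimension.
Context {R : realType} {M : metricType R}.
Local Notation d := (@mdist R M).
Hypotheses (cM : compact [set: M]) (geo : geodesic_space M) (cur : curved M).

Lemma small_expr (t e : R) : 0 <= t <= 1 / 2 -> 0 < e -> exists k, t ^+ k < e.
Proof.
move=> t01 e0.
have H k : (k.+1)%:R * t ^+ k <= 1.
  elim: k => [|k IH]; first by rewrite expr0 mulr1.
  have k0 : 0 <= (k%:R : R) by [].
  have tk : 0 <= t ^+ k by rewrite exprn_ge0 //; lra.
  rewrite exprS; move: IH; rewrite -!natr1 => IH.
  have : (k%:R + 1 + 1) * (t * t ^+ k) <= (2 * (k%:R + 1)) * (1 / 2 * t ^+ k).
    apply: ler_pM; rewrite ?mulr_ge0 ?ler_wpM2r //; lra.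
  lra.
exists (Num.truncn (1 / e)).
have := truncnS_gt (1 / e); rewrite ltr_pdivrMr // => h1.
have := H (Num.truncn (1 / e)) => h2.
rewrite -(ltr_pM2l (_ : 0 < (Num.truncn (1 / e)).+1%:R)) ?ltr0n //; lra.
Qed.

(* If the ball contained too many separated points, contracting them towards
   every point of the ball would produce a self-similar Cantor set of dimension
   at least [s]. The nested balls are chosen so as to meet few sets of a given
   cover. *)
Lemma packing_null (s e rho : R) (q : M) N : 0 < s ->
  hausdorff_outer s [set: M] = 0%E -> 0 < e <= 2 * rho ->
  packing e [set x | d q x <= rho] N -> N%:R * (e / (12 * rho)) `^ s < 1.
Proof.
move=> s0 H0 /andP[e0 e_rho] [f [fB fe]].
have rho0 : 0 < rho by lra.
set th := e / (12 * rho).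
have th0 : 0 < th by rewrite divr_gt0 // mulr_gt0.
have th6 : th <= 1 / 6 by rewrite ler_pdivrMr ?mulr_gt0 //; lra.
rewrite ltNge; apply/negP => N1.
have [|m [V [r [r0 Vr Vcov lt]]]] := @hausdorff_finite_cover _ _ s ((th * rho) `^ s) cM s0.
  by rewrite H0 lte_fin powR_gt0 // mulr_gt0.
pose meets x t i := `[< exists2 y, V i y & d x y <= t >].
pose W x t := \sum_(i | meets x t i) r i `^ s.
have rW x t i : meets x t i -> r i `^ s <= W x t.
  move=> mi; rewrite /W (bigD1 i) //= lerDl sumr_ge0 // => *; exact: powR_ge0.
have rlt x t (u : R) i : 0 < u -> W x t < u `^ s -> meets x t i -> r i < u.
  move=> u0 Wu mi; rewrite ltNge; apply/negP => ur.
  have : u `^ s <= r i `^ s.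
    by apply: ge0_ler_powR => //; rewrite ?nnegrE ltW.
  by have := rW x t i mi; lra.
(* Contracting the packing towards [x] by [t / (4 * rho)] brings it within [t / 2] of [x], with gaps
   at least [3 * (th * t)]. The cover sets concerned have diameter less than [th * t], so each meets
   at most one of the [N] balls of radius [th * t]. By averaging, one ball meets sets of weight at
   most [W x t / N], where [1 / N <= th ^ s]. *)
have step x (t : R) : 0 < t -> d q x + t <= rho -> W x t < (th * t) `^ s ->
    exists y, d q y + th * t <= rho /\ W y (th * t) < (th * (th * t)) `^ s.
  move=> t0 xt Wxt.
  have tht : 0 < th * t by rewrite mulr_gt0.
  have xq := mdist_ge0 q x.
  pose u := t / (4 * rho).
  have r40 : 0 < 4 * rho by rewrite mulr_gt0.
  have u01 : 0 <= u <= 1.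
    apply/andP; split; first by rewrite divr_ge0 // ltW.
    by rewrite ler_pdivrMr // mul1r; lra.
  have [c [Hc1 Hc2]] := contraction x geo cur u01.
  have cx l : d x (c (f l)) <= t / 2.
    have [_ -> _] := Hc1 (f l).
    have : d x (f l) <= 2 * rho.
      have := fB l; have := metric_triangle x q (f l); rewrite (metric_sym x q) /=; lra.
    move=> H; have := ler_wpM2l (proj1 (andP u01)) H => {}H; apply: le_trans H _.
    by rewrite le_eqVlt; apply/orP; left; apply/eqP; rewrite /u; field; rewrite gt_eqF.
  have csep l l' : l != l' -> 3 * (th * t) <= d (c (f l)) (c (f l')).
    move=> ll; apply: le_trans (Hc2 _ _).
    have H := ler_wpM2l (proj1 (andP u01)) (fe _ _ ll); apply: le_trans H.
    by rewrite le_eqVlt; apply/orP; left; apply/eqP; rewrite /u /th; field; rewrite gt_eqF.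
  have [//|K] := pselect (exists l, W (c (f l)) (th * t) < (th * (th * t)) `^ s).
    move=> [l Wl]; exists (c (f l)); split => //.
    have := metric_triangle q x (c (f l)); have := cx l.
    have : th * t <= 1 / 6 * t by rewrite ler_pM2r.
    lra.
  exfalso.
  have sum_lb : N%:R * (th * (th * t)) `^ s <= \sum_l W (c (f l)) (th * t).
    rewrite mulrC mulr_natr -{1}(card_ord N) -sumr_const.
    apply: ler_sum => l _; rewrite leNgt; apply/negP => Hl; apply: K; by exists l.
  have sum_ub : \sum_l W (c (f l)) (th * t) <= W x t.
    rewrite /W (exchange_big_dep (meets x t)) /=; last first.
      move=> l i _ /asboolP[y Vy ly]; apply/asboolP; exists y => //.
      have := metric_triangle x (c (f l)) y; have := cx l.
      have : th * t <= 1 / 6 * t by rewrite ler_pM2r.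
      lra.
    apply: ler_sum => i mi.
    have ri := rlt _ _ _ _ tht Wxt mi.
    have [[l0 ml0]|none] := pselect (exists l, meets (c (f l)) (th * t) i); last first.
      by rewrite big_pred0 ?powR_ge0 // => l; apply/negP => ml; apply: none; exists l.
    rewrite (bigD1 l0) //= big_pred0 ?addr0 // => l.
    apply/negP => /andP[/asboolP[y Vy yl] ll].
    move/asboolP: ml0 => [y' Vy' y'l].
    have := csep _ _ ll; have := Vr i _ _ Vy Vy'.
    have := metric_triangle (c (f l)) y (c (f l0)); have := metric_triangle y y' (c (f l0)).
    rewrite (metric_sym y' (c (f l0))); lra.
  have E : (th * (th * t)) `^ s = th `^ s * (th * t) `^ s by rewrite powRM // ltW.
  have P : 0 < (th * t) `^ s by exact: powR_gt0.
  have : 1 * (th * t) `^ s <= N%:R * th `^ s * (th * t) `^ s by rewrite ler_pM2r.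
  rewrite -mulrA -E mul1r; lra.
have iter k : exists x, d q x + th ^+ k * rho <= rho /\
    W x (th ^+ k * rho) < (th * (th ^+ k * rho)) `^ s.
  elim: k => [|k [x [xk Wk]]].
    exists q; rewrite mdistxx add0r mul1r; split => //.
    apply: le_lt_trans lt; rewrite /W [leRHS](bigID (meets q rho)) /= lerDl.
    by apply: sumr_ge0 => *; exact: powR_ge0.
  rewrite exprS -mulrA; apply: (step x) => //.
  by rewrite mulr_gt0 // exprn_gt0.
have [m0 m00 Hm0] : exists2 m0, 0 < m0 & forall i, m0 <= r i.
  exists (\big[Num.min/1]_i r i).
    elim/big_ind: _ => [|a b a0 b0|i _]; [exact: ltr01|by rewrite lt_min a0 b0|exact: r0].
  by move=> i; rewrite (bigD1 i) //= ge_min lexx.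
(* Once the radius is below [m0], the cover set containing the centre would have to be smaller than
   the smallest set of the cover. *)
have [|k Hk] := @small_expr th (m0 / rho) _ (divr_gt0 m00 rho0); first lra.
have [x [_ Wx]] := iter k.
have [i Vi] := Vcov x.
have mi : meets x (th ^+ k * rho) i.
  by apply/asboolP; exists x => //; rewrite mdistxx mulr_ge0 ?exprn_ge0 // ltW.
have tk : 0 < th ^+ k * rho by apply: mulr_gt0 => //; exact: exprn_gt0.
have := rlt _ _ _ _ (mulr_gt0 th0 tk) Wx mi.
have := Hm0 i; rewrite ltr_pdivlMr // in Hk.
have : th * (th ^+ k * rho) <= 1 / 6 * (th ^+ k * rho).
  by rewrite ler_wpM2r // mulr_ge0 ?exprn_ge0 // ltW.
lra.
Qed.

Variable n : nat.
Hypotheses (n0 : (0 < n)%N) (dimM : hausdorff_dim M = n%:R%:E).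

(** Otherwise [ln N / ln (12 * rho / e)] exceeds the dimension, so the outer measure vanishes for
    some exponent below that ratio, against [packing_null]. *)
Lemma packing_bound (e rho : R) (q : M) N : 0 < e <= 2 * rho ->
  packing e [set x | d q x <= rho] N -> N%:R <= (12 * rho / e) ^+ n.
Proof.
move=> e_rho P; have /andP[e0 e2] := e_rho.
have rho0 : 0 < rho by lra.
rewrite leNgt; apply/negP => lt.
set x := 12 * rho / e in lt.
have x6 : 6 <= x by rewrite ler_pdivlMr //; lra.
have x0 : 0 < x by lra.
have N0 : 0 < (N%:R : R) by apply: lt_trans lt; rewrite exprn_gt0.
have lx : 0 < ln x by apply: ln_gt0; lra.
have lnlt : n%:R * ln x < ln (N%:R : R).
  by rewrite mulr_natl -lnXn // ltr_ln ?posrE // exprn_gt0.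
have : (hausdorff_dim M < (ln N%:R / ln x)%:E)%E.
  by rewrite dimM lte_fin ltr_pdivlMr.
move=> /ereal_inf_lt[_ [s [s0 Hs] <-]]; rewrite lte_fin ltr_pdivlMr // => slt.
have sn : (n%:R%:E <= s%:E :> \bar R)%E.
  by rewrite -dimM; apply: ereal_inf_lbound; exists s.
rewrite lee_fin in sn.
have sp : 0 < s by apply: lt_le_trans sn; rewrite ltr0n.
have := packing_null sp Hs e_rho P.
rewrite (_ : e / (12 * rho) = x^-1); last by rewrite /x; field; rewrite !gt_eqF.
have E : x^-1 `^ s * x `^ s = 1.
  by rewrite -powRM ?invr_ge0 ?ltW // mulVf ?gt_eqF // powR1.
rewrite -(ltr_pM2r (powR_gt0 s x0)) -mulrA E mulr1 mul1r.
rewrite /powR gt_eqF // => /ltW; rewrite leNgt => /negP; apply.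
by rewrite -[ltRHS](lnK (_ : N%:R \is Num.pos)) ?posrE // ltr_expR.
Qed.

(** If packing numbers grow at most like [e ^- k], the outer measure vanishes for the exponent
    [k + 1 / 2], which is less than [n]: the covers by balls weigh at most a constant times
    [sqrt e]. *)
Lemma packing_dim k (C e0 : R) : (k < n)%N -> 0 < e0 -> 0 <= C ->
  (forall e : R, 0 < e < e0 -> exists2 N, ~ packing e [set: M] N.+1 & N%:R * e ^+ k <= C) ->
  False.
Proof.
move=> kn e00 C0 H.
pose s : R := k%:R + 2^-1.
have s0 : 0 < s by rewrite ltr_wpDl // invr_gt0.
have Hs : hausdorff_outer s [set: M] = 0%E.
  apply/eqP; rewrite eq_le; apply/andP; split; last first.
    apply: le_trans (ereal_sup_ubound _); last by exists 1 => //=; exact: ltr01.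
    apply: le_ereal_inf_tmp => _ [U _ <-].
    by apply: nneseries_ge0 => i _ _; rewrite lee_fin diam_pow_ge0.
  apply/lee_addgt0Pr => c c0; rewrite add0e.
  apply: hausdorff_outer_le; first exact: ltW.
  move=> delta delta0.
  pose b := (c / (C * 2 `^ s + 1)).
  have D0 : 0 < C * 2 `^ s + 1 by rewrite ltr_wpDl // mulr_ge0 // powR_ge0.
  have b0 : 0 < b by rewrite divr_gt0.
  pose e := Num.min (Num.min (e0 / 2) delta) (b ^+ 2).
  have ep : 0 < e by rewrite !lt_min delta0 exprn_gt0 // divr_gt0.
  have ee0 : e < e0.
    have : e <= e0 / 2 by rewrite !ge_min lexx.
    lra.
  have ed : e <= delta by rewrite !ge_min lexx orbT.
  have eb : e <= b ^+ 2 by rewrite !ge_min lexx !orbT.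
  have [|N nP NC] := H e; first by rewrite ep.
  exists e; rewrite ep ed; split => //; exists N => //.
  have es : e `^ s = e ^+ k * Num.sqrt e.
    rewrite /s powRD; last by rewrite gt_eqF ?implybT.
    by rewrite powR_mulrn ?(ltW ep) // powR12_sqrt ?(ltW ep).
  rewrite powRM ?(ltW ep) // es.
  have sq : Num.sqrt e <= b by rewrite -(sqr_sqrtr (ltW ep)) ler_sqr ?nnegrE ?sqrtr_ge0 ?(ltW b0) // in eb.
  have s2 : 0 <= 2 `^ s by exact: powR_ge0.
  have AC (x y z w : R) : x * (y * (z * w)) = x * z * (y * w) by ring.
  rewrite AC.
  apply: le_trans (ler_wpM2r _ NC) _; first by rewrite mulr_ge0 // sqrtr_ge0.
  rewrite mulrA; apply: le_trans (ler_wpM2l _ sq) _; first exact: mulr_ge0.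
  by rewrite /b mulrA ler_pdivrMr // mulrC ler_pM2l //; lra.
have : (n%:R%:E <= s%:E :> \bar R)%E.
  by rewrite -dimM; apply: ereal_inf_lbound; exists s => //; split => //; exact: ltW.
rewrite lee_fin /s leNgt => /negP; apply.
have : (k.+1%:R : R) <= n%:R by rewrite ler_nat.
rewrite -natr1; lra.
Qed.

End dimension.

(** * Volume of a space mapped onto a cube *)

Section cube.
Context {R : realType} {M : metricType R}.
Local Notation d := (@mdist R M).

Lemma card_ord_near K (c m : nat) :
  (#|[pred k : 'I_K | (k <= c + m) && (c <= k + m)]| <= (2 * m).+1)%N.
Proof.
pose s := pmap insub (iota (c - m) (2 * m).+1) : seq 'I_K.
apply: (@leq_trans #|s|).
  apply: subset_leq_card; apply/fintype.subsetP => k /andP[k1 k2].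
  rewrite mem_pmap_sub mem_iota /=; move: (nat_of_ord k) k1 k2 => k' k1 k2.
  apply/andP; split; lia.
apply: leq_trans (card_size s) _.
by rewrite size_pmap -[leqRHS](size_iota (c - m)); exact: count_size.
Qed.

(** Counting grid points replaces Lebesgue measure. Choose preimages of a grid with [K ^ n] points,
    whose mesh [w] is below all [r i]. A set of diameter at most [r i] contains at most
    [(2 * (r i / w) + 1) ^+ n] of them, hence at most [(3 * r i / w) ^+ n]. Summation over the cover
    contradicts a total weight below [(a / 4) ^+ n]. *)
Lemma hausdorff_outer_cube n (F : 'I_n -> M -> R) (v : 'I_n -> R) (a : R) :
  (0 < n)%N -> compact [set: M] -> 0 < a ->
  (forall i x y, `|F i x - F i y| <= d x y) ->
  (forall w : 'I_n -> R, (forall i, v i <= w i <= v i + a) ->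
    exists x, forall i, F i x = w i) ->
  (((a / 4) ^+ n)%:E <= hausdorff_outer n%:R [set: M])%E.
Proof.
move=> n0 cM a0 F1 Fsurj; rewrite leNgt; apply/negP => lt.
have nR : 0 < (n%:R : R) by rewrite ltr0n.
have [m [V [r [r0 Vr Vcov Hlt]]]] := hausdorff_finite_cover cM nR lt.
have [m0 m00 Hm0] : exists2 m0, 0 < m0 & forall i, m0 <= r i.
  exists (\big[Num.min/1]_i r i).
    elim/big_ind: _ => [|x y x0 y0|i _]; [exact: ltr01|by rewrite lt_min x0 y0|exact: r0].
  by move=> i; rewrite (bigD1 i) //= ge_min lexx.
pose K := (Num.truncn (a / m0)).+1.
have K0 : 0 < (K%:R : R) by rewrite ltr0n.
pose w := a / K%:R.
have w0 : 0 < w by rewrite divr_gt0.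
have wr i : w <= r i.
  apply: le_trans (Hm0 i); rewrite ler_pdivrMr // -ler_pdivrMl // mulrC ltW //.
  exact: truncnS_gt.
have /choice[z Hz] (g : {ffun 'I_n -> 'I_K}) :
    exists x, forall i, F i x = v i + (g i)%:R * w.
  apply: Fsurj => i; have gi : (g i)%:R <= (K%:R : R) by rewrite ler_nat ltnW.
  have g0 : 0 <= (g i)%:R :> R by [].
  have : (g i)%:R * w <= a.
    apply: le_trans (ler_wpM2r (ltW w0) gi) _.
    by rewrite /w mulrC divfK // gt_eqF.
  have : 0 <= (g i)%:R * w by rewrite mulr_ge0 // ltW.
  lra.
pose A i := [pred g : {ffun 'I_n -> 'I_K} | `[< V i (z g) >]].
have cardA i : (#|A i|%:R : R) <= (3 * r i / w) ^+ n.
  have rw1 : 1 <= r i / w by rewrite ler_pdivlMr // mul1r.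
  pose m' := Num.truncn (r i / w).
  have m'le : (m'%:R : R) <= r i / w by rewrite truncn_le; lra.
  apply: (@le_trans _ _ (((2 * m').+1 ^ n)%:R)).
    rewrite ler_nat.
    have [[g0 Vg0]|none] := pselect (exists g, g \in A i); last first.
      rewrite (_ : #|A i| = 0%N) //; apply: eq_card0 => g; apply/negP => gA.
      by apply: none; exists g.
    pose B j := [pred k : 'I_K | (k <= g0 j + m') && (g0 j <= k + m')]%N.
    apply: (@leq_trans #|family B|).
      apply: subset_leq_card; apply/fintype.subsetP => g Vg; apply/familyP => j.
      rewrite !inE in Vg Vg0.
      have := le_trans (F1 j _ _) (Vr i _ _ Vg Vg0); rewrite !Hz.
      rewrite (_ : _ - _ = ((g j)%:R - (g0 j)%:R) * w); last by ring.
      rewrite normrM (gtr0_norm w0) -ler_pdivlMr // ler_norml => /andP[h1 h2].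
      have T := truncnS_gt (r i / w); rewrite -/m' -natr1 in T.
      rewrite !inE; apply/andP; split.
        have : ((g j)%:R : R) < (g0 j + m').+1%:R by rewrite -natr1 natrD; lra.
        by rewrite ltr_nat ltnS.
      have : ((g0 j)%:R : R) < (g j + m').+1%:R by rewrite -natr1 natrD; lra.
      by rewrite ltr_nat ltnS.
    rewrite card_family foldrE big_map.
    apply: (@leq_trans (\prod_(j <- enum 'I_n) (2 * m').+1)).
      by apply: leq_prod => j _; exact: card_ord_near.
    by rewrite big_const_seq count_predT -cardE card_ord iter_muln_1.
  rewrite natrX; apply: lerXn2r; rewrite ?nnegrE ?ler0n //.
    by apply: divr_ge0; [apply: mulr_ge0 => //|]; exact: ltW.
  rewrite -natr1 natrM -mulrA; lra.
have cnt : (K ^ n <= \sum_i #|A i|)%N.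
  have E i : #|A i| = (\sum_g (if g \in A i then 1 else 0))%N.
    by rewrite -sum1_card big_mkcond.
  rewrite [leqRHS](eq_bigr _ (fun i _ => E i)) exchange_big /=.
  rewrite -[X in (X ^ _)%N]card_ord -[X in (_ ^ X)%N]card_ord -card_ffun -sum1_card.
  apply: leq_sum => g _.
  have [i Vi] := Vcov (z g).
  rewrite (bigD1 i) //= (_ : (g \in A i) = true) ?leq_addr //.
  by rewrite inE; apply/asboolP.
have : (K%:R : R) ^+ n <= \sum_i (3 * r i / w) ^+ n.
  rewrite -natrX; apply: (@le_trans _ _ ((\sum_i #|A i|)%:R)); first by rewrite ler_nat.
  by rewrite natr_sum; apply: ler_sum => i _; exact: cardA.
have wn : 0 < w ^+ n by rewrite exprn_gt0.
rewrite -(ler_pM2r wn) mulr_suml.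
under eq_bigr => i _ do rewrite -exprMn divfK ?gt_eqF // exprMn.
rewrite -mulr_sumr -exprMn (_ : K%:R * w = a); last by rewrite /w mulrC divfK // gt_eqF.
rewrite leNgt => /negP; apply.
have : 3 ^+ n * \sum_i r i ^+ n < 3 ^+ n * (a / 4) ^+ n.
  rewrite ltr_pM2l ?exprn_gt0 //; apply: le_lt_trans Hlt.
  by apply: ler_sum => i _; rewrite powR_mulrn // ltW.
move=> /lt_le_trans; apply; rewrite -exprMn.
by apply: lerXn2r; rewrite ?nnegrE; lra.
Qed.

End cube.

(** * Angles and directions *)

Section angles.
Context {R : realType} {M : metricType R}.
Local Notation d := (@mdist R M).
Implicit Types (g h : R -> M) (s t a b : R).

Lemma acos_le (x y : R) : -1 <= x -> x <= y -> y <= 1 -> acos y <= acos x.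
Proof.
move=> x1 xy y1.
have hx : -1 <= x <= 1 by lra.
have hy : -1 <= y <= 1 by lra.
rewrite leNgt; apply/negP => lt.
have : cos (acos y) < cos (acos x).
  by rewrite ltr_cos // in_itv /= acos_ge0 ?acos_lepi.
by rewrite !acosK ?in_itv //; lra.
Qed.

Lemma sin_le_id (x : R) : 0 <= x -> sin x <= x.
Proof.
rewrite le_eqVlt => /predU1P[<-|x0]; first by rewrite sin0.
have [|c _] := @MVT R sin cos 0 x x0 (fun y _ => is_derive_sin y).
  exact: continuous_subspaceT (@continuous_sin R).
rewrite sin0 !subr0 => ->; rewrite ler_piMl ?(ltW x0) //; exact: cos_le1.
Qed.

Definition hinge_cos g h s t : R :=
  (s ^+ 2 + t ^+ 2 - d (g s) (h t) ^+ 2) / (2 * s * t).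

Section hinge.
Hypothesis cur : curved M.
Variables (g h : R -> M) (a b : R).
Hypotheses (a0 : 0 < a) (b0 : 0 < b) (gh : g 0 = h 0).
Hypotheses (ig : isometric_on g a) (ih : isometric_on h b).

Lemma hinge_cosE s t : 0 < s <= a -> 0 < t <= b ->
  hinge_cos g h s t * (2 * s * t) = inner (g 0) (g s) (h t).
Proof.
move=> sa tb; rewrite /hinge_cos divfK; last by rewrite gt_eqF // !mulr_gt0 //; lra.
by rewrite /inner (isometric_on0 ig) ?gh ?(isometric_on0 ih) //; lra.
Qed.

Lemma hinge_cos_itv s t : 0 < s <= a -> 0 < t <= b -> -1 <= hinge_cos g h s t <= 1.
Proof.
move=> sa tb.
have P : 0 < 2 * s * t by rewrite !mulr_gt0 //; lra.
have E := hinge_cosE sa tb.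
have h1 := inner_le (g 0) (g s) (h t); have h2 := inner_ge (g 0) (g s) (h t).
rewrite (isometric_on0 ig) in h1 h2; try lra.
rewrite gh (isometric_on0 ih) -?gh in h1 h2; try lra.
rewrite -E in h1 h2.
by rewrite -(ler_pM2r P) -[X in _ && X](ler_pM2r P); lra.
Qed.

Lemma hinge_cos_mono s t s' t' : 0 < s <= s' -> 0 < t <= t' -> s' <= a -> t' <= b ->
  hinge_cos g h s t <= hinge_cos g h s' t'.
Proof.
move=> ss tt sa tb.
have P : 0 < 2 * s * t by rewrite !mulr_gt0 //; lra.
rewrite -(ler_pM2r P) hinge_cosE; try lra.
have bg := @isometric_between _ _ g a s s' ig ltac:(lra) ltac:(lra).
have bh := @isometric_between _ _ h b t t' ih ltac:(lra) ltac:(lra).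
rewrite -gh in bh.
apply: le_trans (curved_inner cur bg bh) _.
rewrite -hinge_cosE; try lra.
rewrite le_eqVlt; apply/orP; left; apply/eqP; field.
by rewrite !gt_eqF //; lra.
Qed.

(** By [hinge_cos_mono] comparison angles grow as the hinge shrinks. So the limit defining the angle
    exists and is their supremum, which is what the two halves express. *)
Lemma geodesic_angleP :
  (forall s t, 0 < s <= a -> 0 < t <= b -> acos (hinge_cos g h s t) <= geodesic_angle g h) /\
  (forall x, x < geodesic_angle g h -> exists2 s0 : R, 0 < s0 &
     forall s t, 0 < s <= s0 -> 0 < t <= s0 -> s0 <= a /\ s0 <= b /\ x < acos (hinge_cos g h s t)).
Proof.
pose A := [set x | exists s t, [/\ 0 < s <= a, 0 < t <= b & x = acos (hinge_cos g h s t)]].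
have Asup : has_sup A.
  split; first by exists (acos (hinge_cos g h a b)), a, b; rewrite a0 b0 !lexx.
  by exists pi => _ [s [t [sa tb ->]]]; apply: acos_lepi; exact: hinge_cos_itv.
have near_sup x : x < sup A -> exists2 s0 : R, 0 < s0 &
     forall s t, 0 < s <= s0 -> 0 < t <= s0 -> s0 <= a /\ s0 <= b /\ x < acos (hinge_cos g h s t).
  move=> xA; have [_ [s [t [sa tb ->]]] lt] := sup_gt Asup.1 xA.
  exists (Num.min s t); first by rewrite lt_min; lra.
  move=> s' t' /andP[s'0]; rewrite le_min => /andP[s's s't] /andP[t'0].
  rewrite le_min => /andP[t's t't].
  split; first by rewrite ge_min; lra.
  split; first by rewrite ge_min orbC; lra.
  apply: lt_le_trans lt _; apply: acos_le.
  - by have /andP[] := @hinge_cos_itv s' t' ltac:(lra) ltac:(lra).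
  - by apply: hinge_cos_mono; lra.
  - by have /andP[] := hinge_cos_itv sa tb.
have ub s t : 0 < s <= a -> 0 < t <= b -> acos (hinge_cos g h s t) <= sup A.
  by move=> sa tb; apply: (ub_le_sup Asup.2); exists s, t.
suff -> : geodesic_angle g h = sup A by split.
apply: cvg_lim; first exact: Rhausdorff.
apply/cvgrPdist_le => e e0.
have [|s0 s00 Hs0] := near_sup (sup A - e); first by lra.
exists ([set s | 0 < s <= s0], [set s | 0 < s <= s0]) => /=.
  split; near=> s; apply/andP; split; near: s; try exact: nbhs_right_gt;
    exact: nbhs_right_le.
move=> [s t] /= [ss tt].
have [h1 [h2 h3]] := Hs0 s t ss tt.
have := ub s t ltac:(lra) ltac:(lra).
rewrite (_ : euclidean_angle _ _ _ = acos (hinge_cos g h s t)) // ler_norml; lra.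
Unshelve. all: by end_near. Qed.

Lemma geodesic_angle_itv : 0 <= geodesic_angle g h <= pi.
Proof.
have [H1 H2] := geodesic_angleP.
apply/andP; split.
  apply: le_trans (H1 a b _ _); rewrite ?a0 ?b0 ?lexx //.
  by apply: acos_ge0; apply: hinge_cos_itv; rewrite ?a0 ?b0 lexx.
rewrite leNgt; apply/negP => /H2[s0 s00 /(_ s0 s0)].
have le0 : 0 < s0 <= s0 by lra.
move=> /(_ le0 le0)[sa [sb]]; apply/negP; rewrite -leNgt.
by apply: acos_lepi; apply: hinge_cos_itv; lra.
Qed.

(** A lower bound on the supremum of the comparison angles is inherited only by sufficiently small
    hinges, whence the unspecified [s0]. The upper bound in [acute_hinge] is inherited by all of
    them. *)
Lemma obtuse_hinge (x : R) : 0 <= x <= pi / 2 -> pi / 2 + x < geodesic_angle g h ->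
  exists2 s0 : R, 0 < s0 & forall s, 0 < s <= s0 ->
    s0 <= a /\ s0 <= b /\ 2 * s ^+ 2 * (1 + sin x) < d (g s) (h s) ^+ 2.
Proof.
move=> x0 /(proj2 geodesic_angleP)[s0 s00 H]; exists s0 => // s ss.
have [sa [sb lt]] := H s s ss ss; do 2!split => //.
have s1 : 0 < s <= a by lra.
have s2 : 0 < s <= b by lra.
have itv := hinge_cos_itv s1 s2.
have : cos (acos (hinge_cos g h s s)) < cos (pi / 2 + x).
  by rewrite ltr_cos // in_itv /= ?acos_ge0 ?acos_lepi //; lra.
rewrite acosK ?in_itv // addrC cosDpihalf.
have P : 0 < 2 * s * s by rewrite !mulr_gt0 //; lra.
rewrite -(ltr_pM2r P) hinge_cosE // /inner (isometric_on0 ig) ?gh ?(isometric_on0 ih); lra.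
Qed.

Lemma acute_hinge (x s t : R) : 0 <= x <= pi / 2 -> geodesic_angle g h < pi / 2 + x ->
  0 < s <= a -> 0 < t <= b -> - (2 * x * s * t) <= inner (g 0) (g s) (h t).
Proof.
move=> x0 lt sa tb.
have itv := hinge_cos_itv sa tb.
have le : acos (hinge_cos g h s t) < pi / 2 + x.
  by apply: le_lt_trans lt; apply: (proj1 geodesic_angleP).
have : cos (pi / 2 + x) < cos (acos (hinge_cos g h s t)).
  by rewrite ltr_cos // in_itv /= ?acos_ge0 ?acos_lepi //; lra.
rewrite acosK ?in_itv // addrC cosDpihalf.
have sx : sin x <= x by apply: sin_le_id; lra.
have P : 0 < 2 * s * t by rewrite !mulr_gt0 //; lra.
rewrite -hinge_cosE // => H.
have : (- x) * (2 * s * t) <= hinge_cos g h s t * (2 * s * t) by rewrite ler_pM2r //; lra.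
lra.
Qed.

End hinge.

Hypothesis cur : curved M.

Lemma geodesic_angle_refl g a : 0 < a -> isometric_on g a -> geodesic_angle g g = 0.
Proof.
move=> a0 ig.
have [H1 H2] := geodesic_angleP cur a0 a0 erefl ig ig.
have /andP[h0 _] := geodesic_angle_itv cur a0 a0 erefl ig ig.
apply/eqP; rewrite eq_le h0 andbT leNgt; apply/negP => /H2[s0 s00 /(_ s0 s0)].
have le0 : 0 < s0 <= s0 by lra.
move=> /(_ le0 le0)[sa [sb]].
rewrite /hinge_cos mdistxx (_ : _ / _ = 1) ?acos1 ?ltxx //.
by field; rewrite gt_eqF.
Qed.

(** The comparison angles are at most the angle, hence 0, and so are the chords at equal parameters.
    Thus a direction is a germ of geodesics, and angles of directions do not depend on
    representatives. *)
Lemma geodesic_angle0_eq g h a b : 0 < a -> 0 < b -> g 0 = h 0 ->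
  isometric_on g a -> isometric_on h b -> geodesic_angle g h = 0 ->
  forall s, 0 < s -> s <= a -> s <= b -> g s = h s.
Proof.
move=> a0 b0 gh ig ih E s s0 sa sb.
have [/(_ s s) H _] := geodesic_angleP cur a0 b0 gh ig ih.
have /andP[c1 c2] := hinge_cos_itv gh ig ih (s := s) (t := s) ltac:(lra) ltac:(lra).
have {}H := H ltac:(lra) ltac:(lra); rewrite E in H.
have cE : hinge_cos g h s s = 1.
  apply/eqP; rewrite eq_le c2 leNgt; apply/negP => lt.
  by have := @acos_gt0 R (hinge_cos g h s s); rewrite c1 lt => /(_ isT); lra.
apply: mdist_positivity; apply/eqP; rewrite -sqrf_eq0; apply/eqP.
have P : 2 * s * s != 0 by rewrite gt_eqF // !mulr_gt0.
move: cE; rewrite /hinge_cos => /(congr1 (fun x => x * (2 * s * s))).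
by rewrite divfK // mul1r; lra.
Qed.

Lemma geodesic_angle_germ g h g' h' a b m : 0 < a -> 0 < b -> g 0 = h 0 ->
  isometric_on g a -> isometric_on h b -> 0 < m ->
  (forall s, 0 < s <= m -> g s = g' s) -> (forall s, 0 < s <= m -> h s = h' s) ->
  geodesic_angle g h = geodesic_angle g' h'.
Proof.
move=> a0 b0 gh ig ih m0 Hg Hh; rewrite /geodesic_angle.
congr (lim _); apply/funext => B; apply/propext; rewrite /fmap /=.
have near_eq (u1 v1 u2 v2 : R -> M) : (forall s, 0 < s <= m -> u1 s = u2 s) ->
    (forall s, 0 < s <= m -> v1 s = v2 s) ->
    filter_prod (0 : R)^'+ (0 : R)^'+ ((fun st => euclidean_angle st.1 st.2 (d (u1 st.1) (v1 st.2))) @^-1` B) ->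
    filter_prod (0 : R)^'+ (0 : R)^'+ ((fun st => euclidean_angle st.1 st.2 (d (u2 st.1) (v2 st.2))) @^-1` B).
  move=> Hu Hv H.
  have H' : filter_prod (0 : R)^'+ (0 : R)^'+ [set st : R * R | (0 < st.1 <= m) && (0 < st.2 <= m)].
    exists ([set s | 0 < s <= m], [set s | 0 < s <= m]) => /=.
      split; near=> s; apply/andP; split; near: s; try exact: nbhs_right_gt;
      exact: nbhs_right_le.
    by move=> [s t] /= [-> ->].
  apply: filterS2 H H' => -[s t] /= HB /andP[sm tm].
  by rewrite -Hu // -Hv.
split; first exact: near_eq.
by apply: near_eq => s sm; rewrite ?Hg ?Hh.
Unshelve. all: by end_near. Qed.

End angles.

Section directions.
Context {R : realType} {M : metricType R}.
Local Notation d := (@mdist R M).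
Hypotheses (cM : compact [set: M]) (geo : geodesic_space M) (cur : curved M).
Implicit Types (p q x : M) (g h : R -> M).

Lemma sup_dist_has_sup p : has_sup [set d p q | q in [set: M]].
Proof.
split; first by exists (d p p), p.
by exists (set_diam [set: M]) => _ [q _ <-]; exact: set_diamP.
Qed.

Lemma radius_le_sup p : Defs.radius M <= sup [set d p q | q in [set: M]].
Proof.
apply: ge_inf; last by exists p.
exists 0 => _ [q _ <-]; apply: (ub_le_sup (sup_dist_has_sup q).2).
by exists q; rewrite ?mdistxx.
Qed.

Lemma radius_attained p : exists x, Defs.radius M <= d p x.
Proof.
have [|x _ Hx] := compact_EVT_max _ cM (continuous_subspaceT (@mdist_continuousr R M p)).
  by exists p.
exists x; apply: le_trans (radius_le_sup p) _.
apply: ge_sup; first by case: (sup_dist_has_sup p).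
by move=> _ [q _ <-]; apply: Hx; rewrite inE.
Qed.

Lemma diam_le_radius p : set_diam [set: M] / 2 <= Defs.radius M.
Proof.
apply: lb_le_inf; first by exists (sup [set d p q | q in [set: M]]), p.
move=> _ [q _ <-]; rewrite ler_pdivrMr //.
apply: ge_sup; first by exists (d p p), p => //; exists p.
move=> _ [x _ [y _ <-]].
have hx : d q x <= sup [set d q q0 | q0 in [set: M]].
  by apply: (ub_le_sup (sup_dist_has_sup q).2); exists x.
have hy : d q y <= sup [set d q q0 | q0 in [set: M]].
  by apply: (ub_le_sup (sup_dist_has_sup q).2); exists y.
have := metric_triangle x q y; rewrite (metric_sym x q); lra.
Qed.

Lemma direction_refl p g l : 0 < l -> g 0 = p -> isometric_on g l -> direction p g g.
Proof.
move=> l0 g0 ig; split; first by split => //; exists l.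
exact: geodesic_angle_refl l0 ig.
Qed.

Lemma direction_angleE p g h a b : 0 < a -> 0 < b -> g 0 = p -> h 0 = p ->
  isometric_on g a -> isometric_on h b ->
  direction_angle (direction p g) (direction p h) = geodesic_angle g h.
Proof.
move=> a0 b0 g0 h0 ig ih; rewrite /direction_angle.
suff -> : [set geodesic_angle g0 h0 | g0 in direction p g & h0 in direction p h]
    = [set geodesic_angle g h] by rewrite inf1.
apply/seteqP; split => [_ [g' [[g'0 [l l0 ig']] ag] [h' [[h'0 [k k0 ih']] ah] <-]]|_ ->] /=.
  have Eg := geodesic_angle0_eq cur a0 l0 (etrans g0 (esym g'0)) ig ig' ag.
  have Eh := geodesic_angle0_eq cur b0 k0 (etrans h0 (esym h'0)) ih ih' ah.
  apply/esym/(@geodesic_angle_germ _ _ g h g' h' a b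
    (Num.min (Num.min a l) (Num.min b k))) => //.
  - by rewrite g0 h0.
  - by rewrite !lt_min a0 b0 l0 k0.
  - by move=> s; rewrite !le_min => /and3P[s0 /andP[? ?] _]; exact: Eg.
  - by move=> s; rewrite !le_min => /and3P[s0 _ /andP[? ?]]; exact: Eh.
exists g; first exact: direction_refl a0 g0 ig.
by exists h => //; exact: direction_refl b0 h0 ih.
Qed.

Lemma angle_to_setE p q h b : p != q -> 0 < b -> h 0 = p -> isometric_on h b ->
  angle_to_set (directions_to p q) (direction p h) =
  inf [set geodesic_angle g h | g in minimal_geodesic p q].
Proof.
rewrite -mdist_gt0 => pq b0 h0 ih; rewrite /angle_to_set; congr (inf _).
apply/seteqP; split => [_ [_ [g [g0 g1 ig] <-] <-]|_ [g [g0 g1 ig] <-]].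
  by exists g => //; rewrite (direction_angleE pq b0).
exists (direction p g); first by exists g.
by rewrite (direction_angleE pq b0).
Qed.

Lemma angle_to_set_itv p q x h : p != q -> p != x -> minimal_geodesic p x h ->
  0 <= angle_to_set (directions_to p q) (direction p h) <= pi.
Proof.
move=> pq px [h0 h1 ih]; rewrite (angle_to_setE pq _ h0 ih) ?mdist_gt0 //.
have [g [g0 g1 ig]] := geo p q.
have itv g' : minimal_geodesic p q g' -> 0 <= geodesic_angle g' h <= pi.
  move=> [g'0 _ ig']; apply: (geodesic_angle_itv cur _ _ _ ig' ih); rewrite ?mdist_gt0 //.
  by rewrite g'0 h0.
apply/andP; split.
  apply: lb_le_inf; first by exists (geodesic_angle g h), g.
  by move=> _ [g' /itv/andP[? _] <-].
apply: (@le_trans _ _ (geodesic_angle g h)).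
  apply: ge_inf; last by exists g.
  by exists 0 => _ [g' /itv/andP[? _] <-].
by have /itv/andP[] : minimal_geodesic p q g by [].
Qed.

Let far p x : (~` ball p (Defs.radius M / 2)) x <-> Defs.radius M / 2 <= d p x.
Proof. by rewrite ballEmdist /setC /=; rewrite leNgt; split => /negP. Qed.

Lemma ob_at_ubound p q : p != q -> 0 < Defs.radius M ->
  ubound [set angle_to_set (directions_to p q) xi | xi in
         \bigcup_(x in ~` ball p (Defs.radius M / 2)) directions_to p x] pi.
Proof.
move=> pq r0 _ [_ [x /far px [h Hh <-]] <-].
have px' : p != x by rewrite -mdist_gt0; lra.
by have /andP[] := angle_to_set_itv pq px' Hh.
Qed.

Lemma ob_at_le p q : p != q -> 0 < Defs.radius M -> ob_at p q <= pi / 2.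
Proof.
move=> pq r0; rewrite /ob_at.
suff : sup [set angle_to_set (directions_to p q) xi | xi in
         \bigcup_(x in ~` ball p (Defs.radius M / 2)) directions_to p x] <= pi by lra.
have ub := ob_at_ubound pq r0.
have [E|/set0P ne] := eqVneq [set angle_to_set (directions_to p q) xi | xi in
         \bigcup_(x in ~` ball p (Defs.radius M / 2)) directions_to p x] set0.
  by rewrite E sup0 pi_ge0.
exact: ge_sup.
Qed.

(** The angle to the set of directions towards [q] is an infimum, so some geodesic to [q] makes an
    angle less than [pi / 2 + e] with [h]. [acute_hinge] is then used at the full length of that
    geodesic. *)
Lemma ob_at_hinge p q x h (e s : R) : p != q -> 0 < Defs.radius M -> 0 < e <= 1 ->
  ob_at p q < e -> Defs.radius M / 2 <= d p x -> minimal_geodesic p x h ->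
  0 < s <= d p x -> - (2 * e * s * d p q) <= inner p q (h s).
Proof.
move=> pq r0 e01 ob px Hh spx; have [h0 h1 ih] := Hh.
have px' : p != x by rewrite -mdist_gt0; lra.
have : angle_to_set (directions_to p q) (direction p h) < pi / 2 + e.
  apply: le_lt_trans (_ : sup _ < _).
    apply: (ub_le_sup _); first by exists pi; exact: ob_at_ubound pq r0.
    by exists (direction p h) => //; exists x; [exact/far|exists h].
  by move: ob; rewrite /ob_at; lra.
rewrite (angle_to_setE pq _ h0 ih) ?mdist_gt0 // => /inf_lt[|_ [g [g0 g1 ig] <-] lt].
  by have [g Hg] := geo p q; exists (geodesic_angle g h), g.
have dpq : 0 < d p q by rewrite mdist_gt0.
have := @acute_hinge _ _ cur g h (d p q) (d p x) dpq ltac:(lra) (etrans g0 (esym h0)) ig ih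
  e (d p q) s _ lt _ spx.
rewrite g0 g1 => H; have e2 := pihalf_ge1 R; have {}H := H ltac:(lra).
have dd : 0 < d p q <= d p q by rewrite dpq lexx.
have {}H := H dd; lra.
Qed.

Lemma ob_at_gt p q (e : R) : p != q -> 0 < Defs.radius M -> 0 <= e -> e < ob_at p q ->
  exists x h, [/\ Defs.radius M / 2 <= d p x, minimal_geodesic p x h &
    forall g, minimal_geodesic p q g -> pi / 2 + e < geodesic_angle g h].
Proof.
move=> pq r0 e0; rewrite /ob_at => H.
have {}H : pi / 2 + e < sup [set angle_to_set (directions_to p q) xi | xi in
         \bigcup_(x in ~` ball p (Defs.radius M / 2)) directions_to p x] by lra.
have [|_ [_ [x /far px [h Hh <-]] <-] lt] := sup_gt _ H.
  apply/set0P/eqP => E; move: H; rewrite E sup0.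
  by have := pi_gt0 R; lra.
have px' : p != x by rewrite -mdist_gt0; lra.
have [h0 h1 ih] := Hh.
exists x, h; split => // g Hg; apply: lt_le_trans lt _.
rewrite (angle_to_setE pq _ h0 ih) ?mdist_gt0 //.
apply: ge_inf; last by exists g.
exists 0 => _ [g' [g'0 _ ig'] <-].
have := geodesic_angle_itv cur _ _ _ ig' ih; rewrite ?mdist_gt0.
by move=> /(_ pq px' (etrans g'0 (esym h0))) /andP[].
Qed.

End directions.

(** * Nearly right angles force small volume *)

Lemma sqr_sub_le {R : realType} (x y w s : R) : x - y <= w -> 0 <= w -> 0 <= x + y <= s ->
  x ^+ 2 - y ^+ 2 <= w * s.
Proof.
move=> xy w0 /andP[s0 s1]; rewrite subr_sqr.
by apply: le_trans (ler_wpM2r s0 xy) _; rewrite ler_wpM2l.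
Qed.

Lemma bernoulli_le {R : realType} (n : nat) (t : R) : t <= 1 -> 1 - n%:R * t <= (1 - t) ^+ n.
Proof.
move=> t1; elim: n => [|k IH]; first by rewrite mul0r expr0 subr0.
have t0 : 0 <= 1 - t by rewrite subr_ge0.
have := ler_wpM2l t0 IH; rewrite -exprS.
have : 0 <= k%:R * t ^+ 2 by rewrite mulr_ge0 // sqr_ge0.
by rewrite -natr1; lra.
Qed.

Section noncollapsed.
Context {R : realType} {M : metricType R}.
Local Notation d := (@mdist R M).
Hypotheses (cM : compact [set: M]) (geo : geodesic_space M) (cur : curved M).
Variable n : nat.
Hypotheses (n0 : (0 < n)%N) (dimM : hausdorff_dim M = n%:R%:E).
Local Ltac fact_lra := clear_facts n0; lra.
Local Notation D := (set_diam [set: M]).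

Lemma between_expand t (p x y x' y' : M) : between t p x x' -> between t p y y' ->
  t * d x y <= d x' y'.
Proof.
move=> bx by'; have [/andP[t0 _] px _] := bx; have [_ py _] := by'.
have := curved_inner cur bx by'; rewrite /inner px py => H.
by rewrite -ler_sqr ?nnegrE ?mulr_ge0 ?mdist_ge0 //; lra.
Qed.

Lemma packing_of_hausdorff (V : R) : 0 <= V -> (V%:E < hausdorff_outer n%:R [set: M])%E ->
  exists2 e0, 0 < e0 & forall e, 0 < e <= e0 ->
    exists2 N, packing e [set: M] N & V < N%:R * (2 * e) ^+ n.
Proof.
move=> V0; rewrite ltNge => /negP H.
have nR : 0 <= (n%:R : R) by [].
have [e0 e00 He0] : exists2 e0, 0 < e0 & forall e, 0 < e <= e0 ->
    forall N, N%:R * (2 * e) `^ n%:R <= V -> packing e [set: M] N.+1.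
  apply: contrapT => K; apply: H; apply: hausdorff_outer_le => // delta delta0.
  apply: contrapT => L; apply: K; exists delta => // e ed N NV.
  by apply: contrapT => nP; apply: L; exists e; split => //; exists N.
exists e0 => // e /[dup] /andP[ep _] ee0.
have P : 0 < (2 * e) ^+ n by rewrite exprn_gt0 // mulr_gt0.
exists (Num.truncn (V / (2 * e) ^+ n)).+1.
  apply: (He0 e ee0); rewrite powR_mulrn; last by rewrite mulr_ge0 // ltW.
  rewrite -ler_pdivlMr // truncn_le; exact: divr_ge0 V0 (ltW P).
by rewrite -ltr_pdivrMr //; exact: truncnS_gt.
Qed.

(* The set [Y] obtained by shrinking towards [p] the points far from [p] and
   [q] lies in a thin neighbourhood of the hyperplane through [p] orthogonal to
   [pq]. Contracting the half space [S] containing it towards [q] moves [S] off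
   [Y], so that [Y] fills a fraction of order [e] of the volume of [S]. *)
Lemma ob_pair_volume (p q : M) (e : R) : p != q -> 0 < e <= 1 / 100 ->
  d p q <= e * D / 4 -> ob_pair p q < e ->
  (hausdorff_outer n%:R [set: M] <= (8 * n%:R * e * (768 * D) ^+ n)%:E)%E.
Proof.
move=> pq /andP[e0 e1] dpq.
rewrite /ob_pair gt_max => /andP[obp obq].
have r0 : 0 < d p q by rewrite mdist_gt0.
have qp : q != p by rewrite eq_sym.
set r := d p q in dpq r0.
have D0 : 0 < D by have := set_diamP p q cM; rewrite -/r; lra.
have eD : e * D <= D / 100 by have := ler_wpM2r (ltW D0) e1; lra.
have rad := diam_le_radius cM p.
have rad0 : 0 < Defs.radius M by lra.
rewrite leNgt; apply/negP => HV.
(* Scaling by [kap / 2 = r / (32 * D)] turns [768 * D] into [24 * r], the numerator in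
   [packing_bound] for a ball of radius [2 * r]. *)
set V := 8 * n%:R * e * (768 * D) ^+ n in HV.
have V0 : 0 <= V.
  apply: mulr_ge0; last by apply: exprn_ge0; lra.
  by apply: mulr_ge0; [exact: mulr_ge0|exact: ltW].
have [d0 d00 Hpack] := packing_of_hausdorff V0 HV.
have hp (x : M) (s : R) (h : R -> M) : Defs.radius M / 2 <= d p x -> minimal_geodesic p x h ->
    0 < s <= d p x -> - (2 * e * s * r) <= inner p q (h s).
  by move=> px Hh ss; apply: (ob_at_hinge geo cur pq rad0 _ obp px Hh ss); lra.
have hq (x : M) : Defs.radius M / 2 <= d q x -> - (2 * e * d q x * r) <= inner q p x.
  move=> qx; have [h Hh] := geo q x; have [_ h1 _] := Hh.
  have := ob_at_hinge geo cur qp rad0 (e := e) (s := d q x) _ obq qx Hh.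
  rewrite h1 (metric_sym q p) -/r => /(_ ltac:(lra)); apply; rewrite lexx andbT; lra.
pose X : set M := [set x | Defs.radius M / 2 <= d p x /\ Defs.radius M / 2 <= d q x].
pose hgt w := r ^+ 2 + d p w ^+ 2 - d q w ^+ 2.
have hgtE w : hgt w = inner p q w by rewrite /inner.
pose Y : set M := [set y | [/\ d p y <= r, d q y <= 2 * r & - (2 * e * r ^+ 2) <= hgt y <= 3 * e * r ^+ 2]].
have [x0 px0] := radius_attained cM p.
(* [x0] is at least the radius away from [p], the radius is at least [D / 2], and [q] is very close
   to [p]. So shrinking all of [M] by 1/16 towards [x0] places it far from both [p] and [q], at the
   cost of a fixed factor. *)
have t1 : 0 <= (16^-1 : R) <= 1 by rewrite invr_ge0 ler0n invf_le1 ?ltr0n // ler1n.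
have [c1 [Hc1 Ec1]] := contraction x0 geo cur t1.
have c1X x : X (c1 x).
  have [_ h _] := Hc1 x.
  have h2 := set_diamP x0 x cM.
  have h3 := metric_triangle p (c1 x) x0; rewrite (metric_sym (c1 x) x0) in h3.
  have h4 := metric_triangle p q (c1 x); rewrite -/r in h4.
  by split; move: h2 h3 h4 px0 eD dpq D0 rad; fact_lra.
have /choice[c2 Hc2] (x : M) : exists y, X x -> between (r / D) p x y /\ Y y.
  have [Xx|nX] := pselect (X x); last by exists x.
  have [px qx] := Xx.
  have [h Hh] := geo p x; have [h0 h1 ih] := Hh.
  have a0 : 0 < d p x by move: px rad0; fact_lra.
  have t01 : 0 < r / D <= 1 by rewrite divr_gt0 // ler_pdivrMr //; move: dpq eD D0; fact_lra.
  pose s := r / D * d p x.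
  have s0 : 0 < s by rewrite mulr_gt0 //; move: t01 => /andP[].
  have sx : s <= d p x by rewrite /s ler_piMl //; move: t01 a0; fact_lra.
  have sr : s <= r.
    rewrite /s mulrAC ler_pdivrMr // ler_wpM2l //; first exact: ltW.
    exact: set_diamP.
  have bx : between (r / D) p x (h s).
    have := @isometric_between _ _ h (d p x) s (d p x) ih; rewrite h0 h1 /s mulfK ?gt_eqF //.
    apply; [by rewrite -/s; move: s0 sx; fact_lra|by rewrite a0 lexx].
  exists (h s) => _; split => //.
  have ps : d p (h s) = s by case: bx.
  have H1 := hp x s h px Hh ltac:(move: s0 sx; fact_lra).
  (* Since [inner p q x + inner q p x = 2 * r ^+ 2], the estimate at [q] bounds [inner p q x] from
     above, and monotonicity passes this to the point [h s]. *)
  have H2 : hgt (h s) <= 3 * e * r ^+ 2.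
    rewrite hgtE; apply: le_trans (curved_inner cur (between1 p q) bx) _.
    have H3 := hq x qx; rewrite mul1r.
    have H4 : inner p q x <= 3 * e * D * r.
      move: H3; rewrite /inner (metric_sym q p) -/r.
      have := ler_wpM2l (ltW r0) dpq.
      have : e * d q x * r <= e * D * r.
        by rewrite ler_wpM2r ?(ltW r0) // ler_wpM2l ?(ltW e0) // set_diamP.
      have : 0 <= e * D * r by rewrite !mulr_ge0 // ltW.
      fact_lra.
    have rD0 : 0 <= r / D by rewrite divr_ge0 // ltW.
    apply: le_trans (ler_wpM2l rD0 H4) _.
    by rewrite le_eqVlt; apply/orP; left; apply/eqP; field; rewrite gt_eqF.
  split; first by rewrite ps.
    by have := metric_triangle q p (h s); rewrite (metric_sym q p) -/r ps; move: sr; fact_lra.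
  rewrite H2 andbT hgtE; apply: le_trans H1.
  have : e * s * r <= e * r * r by rewrite ler_wpM2r ?(ltW r0) // ler_wpM2l ?(ltW e0).
  fact_lra.
pose kap := r / D * 16^-1.
have kap0 : 0 < kap by rewrite mulr_gt0 ?divr_gt0 ?invr_gt0.
have packY ep : 0 < ep <= kap * d0 ->
    exists2 N, packing ep Y N & V * (kap / 2) ^+ n < N%:R * ep ^+ n.
  move=> /andP[ep0 epk].
  have [|N P NV] := Hpack (ep / kap).
    by rewrite divr_gt0 //= ler_pdivrMr // mulrC.
  exists N.
    have P1 := packing_image (B := X) (t := 16^-1) (proj1 (andP t1)) (fun x _ => c1X x) Ec1 P.
    case: P1 => f [fX fe]; exists (c2 \o f); split => [i|i j ij] /=.
      by have [] := Hc2 _ (fX i).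
    have [b1 _] := Hc2 _ (fX i); have [b2 _] := Hc2 _ (fX j).
    apply: le_trans (between_expand b1 b2).
    have := fe i j ij => {}fe.
    have rD : 0 <= r / D by rewrite divr_ge0 // ltW.
    apply: le_trans (ler_wpM2l rD fe).
    by rewrite le_eqVlt; apply/orP; left; apply/eqP; rewrite /kap; field; rewrite !gt_eqF.
  have P2 : 0 < (kap / 2) ^+ n by rewrite exprn_gt0 // divr_gt0.
  rewrite -(ltr_pM2r P2) in NV; apply: lt_le_trans NV _.
  rewrite -mulrA -exprMn le_eqVlt; apply/orP; left; apply/eqP; congr (_ * _ ^+ n).
  by field; rewrite gt_eqF.
pose S : set M := [set w | d q w <= 2 * r /\ - (2 * e * r ^+ 2) <= hgt w].
(* The contraction by [1 - th] towards [q] adds about [2 * th * r ^+ 2] to [hgt]. With this [th] the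
   lower bound [- (2 * e * r ^+ 2)] on [S] is lifted to [6 * e * r ^+ 2], well above the upper bound
   [3 * e * r ^+ 2] on [Y]. In the region concerned [hgt] varies by at most [8 * r] times the
   distance, which gives the gap in [sep]. *)
pose th := 4 * e.
have th01 : 0 <= 1 - th <= 1 by rewrite /th; move: e0 e1; fact_lra.
have [c3 [Hc3 Ec3]] := contraction q geo cur th01.
have r20 : 0 < r ^+ 2 by rewrite exprn_gt0.
have er2 : 0 < e * r ^+ 2 by rewrite mulr_gt0.
have c3S w : S w -> S (c3 w) /\ 6 * e * r ^+ 2 <= hgt (c3 w).
  move=> [qw hw]; have [_ qc _] := Hc3 w.
  have H := curved_between p cur (Hc3 w); rewrite -/r in H.
  have H6 : 6 * e * r ^+ 2 <= hgt (c3 w).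
    have : (1 - th) * hgt w + 2 * th * r ^+ 2 <= hgt (c3 w).
      rewrite /hgt qc; move: H; fact_lra.
    have : (1 - th) * - (2 * e * r ^+ 2) <= (1 - th) * hgt w by rewrite ler_wpM2l //; move: th01; fact_lra.
    have : 0 <= th * (e * r ^+ 2) by rewrite mulr_ge0 ?(ltW er2) // /th; move: e0; fact_lra.
    rewrite /th; fact_lra.
  split => //; split; last by move: H6 er2; fact_lra.
  rewrite qc; apply: le_trans qw; rewrite ler_piMl ?mdist_ge0 //; move: th01; fact_lra.
have YS : Y `<=` S by move=> y [h1 h2 /andP[h3 h4]]; split.
have sep w y : S w -> Y y -> 3 / 10 * e * r <= d (c3 w) y.
  move=> /c3S[[h1 _] h2] [h3 h4 /andP[_ h5]].
  have h6 := metric_triangle p (c3 w) y; have h7 := metric_triangle p y (c3 w).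
  have h8 := metric_triangle q (c3 w) y; have h9 := metric_triangle q y (c3 w).
  rewrite (metric_sym y (c3 w)) in h7 h9.
  have h10 := metric_triangle p q (c3 w); rewrite -/r in h10.
  have z1 := mdist_ge0 p y; have z2 := mdist_ge0 q y; have z3 := mdist_ge0 p (c3 w).
  have z4 := mdist_ge0 q (c3 w); have z5 := mdist_ge0 (c3 w) y.
  rewrite /hgt in h2 h5.
  have k1 : d p (c3 w) ^+ 2 - d p y ^+ 2 <= d (c3 w) y * (4 * r).
    by apply: sqr_sub_le => //; move: h1 h3 h4 h6 h7 h8 h9 h10 z1 z2 z3 z4 z5 r0; fact_lra.
  have k2 : d q y ^+ 2 - d q (c3 w) ^+ 2 <= d (c3 w) y * (4 * r).
    by apply: sqr_sub_le => //; move: h1 h3 h4 h6 h7 h8 h9 h10 z1 z2 z3 z4 z5 r0; fact_lra.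
  have k3 : 3 * (e * r) * r <= 8 * d (c3 w) y * r by move: h2 h5 k1 k2; fact_lra.
  rewrite ler_pM2r // in k3; move: k3 z5; fact_lra.
pose C := (24 * r) ^+ n.
pose B := V * (kap / 2) ^+ n.
have C0 : 0 < C by rewrite exprn_gt0 // mulr_gt0.
have nR : 1 <= (n%:R : R) by rewrite ler1n.
have BC : B = 8 * n%:R * e * C.
  rewrite /B /V -mulrA -exprMn /C; congr (_ * _ ^+ n).
  by rewrite /kap; field; rewrite gt_eqF.
have bern : 1 - (1 - th) ^+ n <= n%:R * th.
  by rewrite lerBlDr -lerBlDl; apply: bernoulli_le; rewrite /th; move: e0 e1; fact_lra.
pose bet := B - (n%:R * th) * C.
have bet0 : 0 < bet.
  have : 0 < n%:R * e * C by rewrite !mulr_gt0 //; move: nR; fact_lra.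
  by rewrite /bet BC /th; fact_lra.
pose ep0 := Num.min (kap * d0) (3 / 10 * e * r).
have ep00 : 0 < ep0 by rewrite lt_min (mulr_gt0 kap0 d00) !mulr_gt0 ?divr_gt0.
have ep01 : ep0 <= kap * d0 by rewrite ge_min lexx.
have ep02 : ep0 <= 3 / 10 * e * r by rewrite ge_min lexx orbT.
have th1 : 0 < 1 - th by rewrite /th; move: e1; fact_lra.
have epm m : 0 < ep0 * (1 - th) ^+ m <= ep0.
  rewrite mulr_gt0 ?exprn_gt0 //= ler_piMr ?(ltW ep00) // exprn_ile1 //; move: th1 th01; fact_lra.
have bnd m N : packing (ep0 * (1 - th) ^+ m) S N -> N%:R * (ep0 * (1 - th) ^+ m) ^+ n <= C.
  move=> [f [fS fe]]; have /andP[m1 m2] := epm m.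
  have er : e * r <= 1 / 100 * r by rewrite ler_wpM2r // ltW.
  have m3 : 0 < ep0 * (1 - th) ^+ m <= 2 * (2 * r) by rewrite m1; move: m2 ep02 er r0; fact_lra.
  have P : packing (ep0 * (1 - th) ^+ m) [set x | d q x <= 2 * r] N.
    by exists f; split => // i; have [] := fS i.
  have := packing_bound cM geo cur n0 dimM m3 P.
  have P2 : 0 < (ep0 * (1 - th) ^+ m) ^+ n by rewrite exprn_gt0.
  have EC : (12 * (2 * r) / (ep0 * (1 - th) ^+ m)) ^+ n * (ep0 * (1 - th) ^+ m) ^+ n = C.
    move: m1; move: (ep0 * _) => E E0; rewrite -[LHS]exprMn /C; congr (_ ^+ n).
    by field; rewrite gt_eqF.
  by move=> H; have := ler_wpM2r (ltW P2) H; rewrite EC.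
(* The number of points times the [n]-th power of the scale plays the role of the volume of [S].
   Contracting the packing costs at most [n%:R * th * C = 4 * n%:R * e * C], while a fresh packing
   of [Y] adds more than [B], which is twice as much. So this quantity grows by [bet] at every step,
   against [bnd]. *)
have grow m : exists2 N, packing (ep0 * (1 - th) ^+ m) S N &
    m%:R * bet <= N%:R * (ep0 * (1 - th) ^+ m) ^+ n.
  elim: m => [|m [N PN HN]].
    exists 0%N; last by rewrite !mul0r.
    have e00 : 'I_0 -> False by case.
    by exists (fun i => False_rect M (e00 i)); split; case.
  have /andP[m1 m2] := epm m.+1.
  have [|N' PN' HN'] := packY (ep0 * (1 - th) ^+ m.+1); first by rewrite m1; move: m2 ep01; fact_lra.
  exists (N + N')%N.
    apply: (@packing_union _ _ _ [set c3 w | w in S] Y) => //.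
    - by move=> _ [w Sw <-]; have [] := c3S w Sw.
    - by move=> _ y [w Sw <-] Yy; have := sep w y Sw Yy; move: m2 ep02; fact_lra.
    - rewrite exprS mulrCA; apply: packing_image PN => //; first by move: th01; fact_lra.
      by move=> w Sw; exists w.
  have HC := bnd m N PN.
  have E : N%:R * (ep0 * (1 - th) ^+ m.+1) ^+ n = N%:R * (ep0 * (1 - th) ^+ m) ^+ n * (1 - th) ^+ n.
    by rewrite exprSr mulrA exprMn mulrA.
  rewrite natrD mulrDl -natr1 mulrDl mul1r E.
  set u := N%:R * (ep0 * (1 - th) ^+ m) ^+ n in HN HC *.
  have u0 : 0 <= u by rewrite mulr_ge0 // exprn_ge0 //; have /andP[] := epm m; fact_lra.
  have q1 : (1 - th) ^+ n <= 1 by rewrite exprn_ile1 //; move: th1 th01; fact_lra.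
  have Hu : u * (1 - (1 - th) ^+ n) <= C * (n%:R * th).
    by apply: ler_pM => //; rewrite subr_ge0.
  have betE : bet = B - n%:R * th * C by [].
  rewrite -/B in HN'; clear -HN HN' Hu betE.
  by rewrite {2}betE; move: ((1 - th) ^+ n) Hu => v Hu; lra.
have [N PN HN] := grow (Num.truncn (C / bet)).+1.
have HC := bnd _ _ PN.
have := truncnS_gt (C / bet); rewrite ltr_pdivrMr //; move: HN HC; fact_lra.
Qed.

End noncollapsed.

(** * Strained coordinates *)

Section real_estimates.
Context {R : realType}.
Implicit Types (A B w t tau : R).

(** The strainer inequality linearized: [A' ^+ 2 - A ^+ 2] is at least [2 * A * (A' - A)], and the
    terms in [w ^+ 2] are negligible because [w] is small compared to [A] and [B]. *)
Lemma strained_sum_le tau w A B A' B' : 0 < A -> 0 < B -> 0 <= w -> 0 <= tau ->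
  w <= 2 * tau * A -> w <= 2 * tau * B ->
  - (6 * tau * w * A * B) <= (w ^+ 2 + A ^+ 2 - A' ^+ 2) * B + (w ^+ 2 + B ^+ 2 - B' ^+ 2) * A ->
  (A' + B') - (A + B) <= 5 * tau * w.
Proof.
move=> A0 B0 w0 t0 wA wB H.
have P : 0 < 2 * A * B by rewrite !mulr_gt0.
rewrite -(ler_pM2l P).
have h1 : 0 <= B * (A' - A) ^+ 2 by rewrite mulr_ge0 ?sqr_ge0 ?ltW.
have h2 : 0 <= A * (B' - B) ^+ 2 by rewrite mulr_ge0 ?sqr_ge0 ?ltW.
have h3 : w * (w * A) <= 2 * tau * B * (w * A) by rewrite ler_wpM2r // mulr_ge0 // ltW.
have h4 : w * (w * B) <= 2 * tau * A * (w * B) by rewrite ler_wpM2r // mulr_ge0 // ltW.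
lra.
Qed.

Lemma sqrt_perturb tau t A f D : 0 <= tau -> 0 <= t <= 1 -> 0 < A -> 0 <= f -> 0 <= D ->
  D <= 2 * tau * A -> tau <= 1 / 10 -> A ^+ 2 - t * D ^+ 2 <= f ^+ 2 -> A - 2 * tau * t * D <= f.
Proof.
move=> tau0 /andP[t0 t1] A0 f0 D0 DA tau1 H.
have tD : 0 <= t * D by rewrite mulr_ge0.
have tau01 : 0 <= tau * A by rewrite mulr_ge0 // ltW.
have DA' : D <= A.
  have : tau * A <= 1 / 10 * A by rewrite ler_wpM2r // ltW.
  lra.
have tDD : t * D <= D by rewrite ler_piMl.
have x0 : 0 <= 2 * tau * t * D by rewrite -mulrA !mulr_ge0.
have h1 : (2 * tau * t * D) <= A.
  have : tau * (t * D) <= 1 / 10 * A by apply: ler_pM => //; lra.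
  lra.
rewrite -ler_sqr ?nnegrE ?subr_ge0 //; apply: le_trans H.
have h2 : t * D * D <= t * D * (2 * tau * A) by rewrite ler_wpM2l.
have h3 : (2 * tau * t * D) * (2 * tau * t * D) <= (2 * tau * t * D) * A by rewrite ler_wpM2l.
lra.
Qed.

Lemma sqr_lower (u U x : R) : 0 <= u -> 0 <= U -> 0 <= x -> U - x <= u ->
  U ^+ 2 - 2 * U * x <= u ^+ 2.
Proof.
move=> u0 U0 x0 h.
have [hU|hU] := leP 0 (U - x).
  have : (U - x) ^+ 2 <= u ^+ 2 by rewrite ler_sqr ?nnegrE.
  have : 0 <= x ^+ 2 by exact: sqr_ge0.
  lra.
have : 0 <= U * (x - U) by rewrite mulr_ge0 // subr_ge0 ltW // -subr_lt0.
have := sqr_ge0 u; have : 0 <= U * x by rewrite mulr_ge0.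
lra.
Qed.

End real_estimates.

Section chart.
Context {R : realType} {M : metricType R}.
Local Notation d := (@mdist R M).

(* Strainers in the sense of Burago, Gromov and Perelman, over a ball: the
   opposite points of the [i]-th pair are [e true i] and [e false i]. *)
Record chart k (tau : R) (p : M) (sigma : R) (e : bool -> 'I_k -> M) : Prop := {
  chart_far : forall s i z, d p z <= sigma -> sigma <= tau * d z (e s i) ;
  chart_opp : forall i z, d p z <= sigma ->
    inner z (e true i) (e false i) <=
      2 * (tau ^+ 2 - 1) * d z (e true i) * d z (e false i) ;
  chart_orth : forall i j s s' z, i != j -> d p z <= sigma ->
    inner z (e s i) (e s' j) <= 2 * tau * d z (e s i) * d z (e s' j) }.

Hypotheses (geo : geodesic_space M) (cur : curved M).
Variables (k : nat) (tau : R) (p : M) (sigma : R) (e : bool -> 'I_k -> M).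
Hypotheses (tau0 : 0 < tau) (tau1 : tau <= 1 / 10) (sigma0 : 0 < sigma).
Hypothesis ch : chart tau p sigma e.
Local Notation B z := (d p z <= sigma).

Local Ltac chart_lra := have := tau0; have := tau1; have := sigma0; lra.

Lemma chart_gt0 s i z : B z -> 0 < d z (e s i).
Proof. by move=> /(chart_far ch s i); rewrite -(pmulr_rgt0 _ tau0); chart_lra. Qed.

Lemma chart_dist z z' : B z -> B z' -> d z z' <= 2 * sigma.
Proof. by move=> Bz Bz'; have := metric_triangle z p z'; rewrite (metric_sym z p); chart_lra. Qed.

Lemma chart_dist_far s i z z' : B z -> B z' -> d z z' <= 2 * tau * d z (e s i).
Proof.
by move=> Bz Bz'; have := chart_dist Bz Bz'; have := chart_far ch s i Bz; chart_lra.
Qed.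

Lemma chart_oppC s i z : B z -> inner z (e s i) (e (~~ s) i) <=
  2 * (tau ^+ 2 - 1) * d z (e s i) * d z (e (~~ s) i).
Proof.
case: s => Bz /=; first exact: (chart_opp ch i Bz).
by rewrite innerC; have := chart_opp ch i Bz; chart_lra.
Qed.

Lemma chart_excess i s z z' : B z -> B z' ->
  (d z' (e s i) + d z' (e (~~ s) i)) - (d z (e s i) + d z (e (~~ s) i)) <= 5 * tau * d z z'.
Proof.
move=> Bz Bz'; apply: strained_sum_le (chart_gt0 s i Bz) (chart_gt0 (~~ s) i Bz) _ _ _ _ _.
- exact: mdist_ge0.
- exact: ltW.
- exact: chart_dist_far.
- exact: chart_dist_far.
- exact: (@cur z z' (e s i) (e (~~ s) i) tau (ltW tau0) (chart_oppC s i Bz)).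
Qed.

Lemma chart_concave t s i z z' w : B z -> B z' -> between t z z' w ->
  (1 - t) * d z (e s i) + t * d z' (e s i) - 2 * tau * t * d z z' <= d w (e s i).
Proof.
move=> Bz Bz' bt; have [t01 _ _] := bt; have /andP[t0 t1] := t01.
have H := curved_between (e s i) cur bt.
rewrite !(metric_sym (e s i)) in H.
have g1 := chart_gt0 s i Bz; have g2 := chart_gt0 s i Bz'.
have t'0 : 0 <= 1 - t by rewrite subr_ge0.
set f := d z (e s i) in H g1 *; set f' := d z' (e s i) in H g2 *.
have Dz := mdist_ge0 z z'.
have Df : d z z' <= 2 * tau * f by exact: chart_dist_far.
have Df' : d z z' <= 2 * tau * f' by rewrite metric_sym; exact: chart_dist_far.
apply: sqrt_perturb (mdist_ge0 w _) Dz _ tau1 _ => //; first exact: ltW.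
- have [->|t'n] := eqVneq t 0; first by rewrite subr0 mul1r mul0r addr0.
  have tp : 0 < t by rewrite lt_def t'n.
  have : 0 < t * f' by rewrite mulr_gt0.
  have : 0 <= (1 - t) * f by rewrite mulr_ge0 // ltW.
  chart_lra.
- have h1 := ler_wpM2l t'0 Df; have h2 := ler_wpM2l t0 Df'; chart_lra.
- have h1 : 0 <= t * (1 - t) * (f - f') ^+ 2 by apply: mulr_ge0; [exact: mulr_ge0|exact: sqr_ge0].
  have h2 : 0 <= t * t * d z z' ^+ 2 by apply: mulr_ge0; [exact: mulr_ge0|exact: sqr_ge0].
  chart_lra.
Qed.

(** The distances to two opposite points are both nearly concave along a segment, and by
    [chart_excess] their sum is nearly constant. *)
Lemma chart_affine t s i z z' w : B z -> B z' -> B w -> between t z z' w ->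
  `|d w (e s i) - d z (e s i) - t * (d z' (e s i) - d z (e s i))| <= 12 * tau * t * d z z'.
Proof.
move=> Bz Bz' Bw bt; have [/andP[t0 t1] zw _] := bt.
have h1 := chart_concave s i Bz Bz' bt; have h2 := chart_concave (~~ s) i Bz Bz' bt.
have h3 := chart_excess i s Bz Bw; have h4 := chart_excess i s Bz' Bz.
rewrite zw in h3; rewrite (metric_sym z' z) in h4; have {}h4 := ler_wpM2l t0 h4.
have h5 : 0 <= tau * t * d z z' by rewrite !mulr_ge0 ?mdist_ge0 // ltW.
rewrite ler_norml; chart_lra.
Qed.

(** By [chart_orth] the distances to the points of the other pairs can hardly decrease. This holds
    for both points of a pair, so by [chart_excess] they can hardly increase either. *)
Lemma chart_move s i z (v : R) : B z -> 0 <= v -> d p z + v <= sigma ->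
  exists t w, [/\ between t z (e s i) w, B w, t * d z (e s i) = v, t <= tau & d z w = v] /\
    [/\ d w (e s i) = d z (e s i) - v,
        `|d w (e (~~ s) i) - d z (e (~~ s) i) - v| <= 5 * tau * v &
        forall (j : 'I_k) s', i != j -> `|d w (e s' j) - d z (e s' j)| <= 6 * tau * v].
Proof.
move=> Bz v0 pv.
have L0 := chart_gt0 s i Bz; have Lf := chart_far ch s i Bz.
have pz := mdist_ge0 p z.
pose t := v / d z (e s i).
have t0 : 0 <= t by rewrite divr_ge0 // ltW.
have tt : t <= tau by rewrite ler_pdivrMr //; chart_lra.
have t01 : 0 <= t <= 1 by rewrite t0 /=; chart_lra.
have [w bw] := between_exists z (e s i) geo t01.
have tv : t * d z (e s i) = v by rewrite divfK // gt_eqF.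
have [_ zw we] := bw; rewrite tv in zw.
have we' : d w (e s i) = d z (e s i) - v by rewrite we mulrBl tv mul1r.
have Bw : B w by have := metric_triangle p z w; chart_lra.
exists t, w; split => //; split => //.
  have h1 := chart_excess i s Bz Bw; have h2 := chart_excess i s Bw Bz.
  rewrite zw in h1; rewrite (metric_sym w z) zw in h2.
  by rewrite ler_norml; chart_lra.
have low j s' : i != j -> d z (e s' j) - tau * v <= d w (e s' j).
  move=> ij; have g1 := chart_gt0 s' j Bz; have f1 := chart_far ch s' j Bz.
  have := curved_between (e s' j) cur bw.
  have := chart_orth ch s s' ij Bz; rewrite /inner.
  rewrite !(metric_sym (e s' j)) (metric_sym (e s i) (e s' j)) => h1 h2.
  have tz := ler_wpM2l t0 h1.
  have tv0 : 0 <= tau * v by rewrite mulr_ge0 // ltW.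
  have : tau * v <= d z (e s' j).
    have : tau * v <= tau * sigma by rewrite ler_wpM2l ?(ltW tau0) //; chart_lra.
    have : sigma <= tau * d z (e s' j) by exact: f1.
    have : tau * d z (e s' j) <= 1 / 10 * d z (e s' j) by rewrite ler_wpM2r ?(ltW g1).
    have : tau * sigma <= 1 / 10 * sigma by rewrite ler_wpM2r ?(ltW sigma0).
    chart_lra.
  move=> h4; rewrite -ler_sqr ?nnegrE ?subr_ge0 ?mdist_ge0 //.
  apply: le_trans h2.
  have h5 : tau ^+ 2 * v ^+ 2 <= v ^+ 2.
    rewrite ler_piMl ?sqr_ge0 // expr_le1 ?(ltW tau0) //; chart_lra.
  have h6 : t * (t * d z (e s i) ^+ 2) = v ^+ 2 by rewrite -tv; ring.
  have h7 : t * (2 * tau * d z (e s i) * d z (e s' j)) = 2 * tau * v * d z (e s' j).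
    by rewrite -tv; ring.
  rewrite h7 in tz; chart_lra.
move=> j s' ij; have h1 := low j s' ij; have h2 := low j (~~ s') ij.
have h3 := chart_excess j s' Bz Bw; rewrite zw in h3.
have tv0 : 0 <= tau * v by rewrite mulr_ge0 // ltW.
rewrite ler_norml; chart_lra.
Qed.

(* The two Pythagorean estimates for a small step from [z] to [w] on the segment
   from [z] to [y]: from above for points [x] level with [w]; from below, in
   terms of the point [y'] opposite to [y]. *)
Lemma pythagoras_le t z y w x (eps1 : R) : between t z y w -> 0 <= eps1 -> t <= tau ->
  d w y - eps1 <= d x y ->
  d x z ^+ 2 <= (1 + 2 * tau) * d x w ^+ 2 + (t * d z y) ^+ 2 + 2 * (t * d z y) * eps1.
Proof.
move=> bw eps0 tt H; have [/andP[t0 t1] zw wy] := bw.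
have := curved_between x cur bw.
have t'0 : 0 < 1 - t by chart_lra.
rewrite wy in H; have L0 := mdist_ge0 z y.
have := sqr_lower (mdist_ge0 x y) (mulr_ge0 (ltW t'0) L0) eps0 H => H1.
have := ler_wpM2l t0 H1 => {}H1 H2.
rewrite -(ler_pM2l t'0).
have h3 : 0 <= (tau - t + tau * (1 - 2 * t)) * d x w ^+ 2.
  apply: mulr_ge0; last exact: sqr_ge0.
  have : 0 <= tau * (1 - 2 * t) by apply: mulr_ge0; [exact: ltW|chart_lra].
  chart_lra.
chart_lra.
Qed.

Lemma pythagoras_ge t s i z w x : B z -> between t z (e s i) w -> d z x <= 2 * sigma ->
  d x w ^+ 2 <= d x z ^+ 2 + (t * d z (e s i)) ^+ 2 +
    8 * tau * d x z * (t * d z (e s i)) +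
    2 * (t * d z (e s i)) * (d z (e (~~ s) i) - d x (e (~~ s) i)).
Proof.
move=> Bz bw zx; have [/andP[t0 t1] zw wy] := bw.
set y' := e (~~ s) i.
have U0 : 0 < d z y' by exact: chart_gt0.
have Uf : sigma <= tau * d z y' by exact: (chart_far ch _ _ Bz).
have L0 : 0 < d z (e s i) by exact: chart_gt0.
have v0 : 0 <= t * d z (e s i) by rewrite mulr_ge0 // ltW.
have H1 : inner z w y' <= 2 * (tau ^+ 2 - 1) * d z w * d z y'.
  apply: le_trans (curved_inner cur bw (between1 z y')) _.
  have := ler_wpM2l t0 (chart_oppC s i Bz); rewrite zw -/y'; chart_lra.
have := @cur z x w y' tau (ltW tau0) H1.
rewrite zw /inner (metric_sym z x) => H2.
set v := t * d z (e s i) in v0 zw H2 *; rewrite zw in H2.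
rewrite -(ler_pM2r U0).
have h1 : v * (d x z * d x z) <= v * (2 * tau * d z y' * d x z).
  rewrite ler_wpM2l // ler_wpM2r ?mdist_ge0 //.
  by rewrite (metric_sym x z); chart_lra.
have h2 : 0 <= v * (d z y' - d x y') ^+ 2 by rewrite mulr_ge0 ?sqr_ge0.
chart_lra.
Qed.

End chart.

Section moves.
Context {R : realType} {M : metricType R}.
Local Notation d := (@mdist R M).
Hypotheses (geo : geodesic_space M) (cur : curved M).
Variables (k : nat) (tau : R) (p : M) (sigma : R) (e : bool -> 'I_k -> M).
Hypotheses (tau0 : 0 < tau) (tau1 : tau <= 1 / 10) (sigma0 : 0 < sigma).
Hypothesis ch : chart tau p sigma e.
Local Notation B z := (d p z <= sigma).
Local Notation f i z := (d z (e true i)).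
Local Ltac fact_lra := clear_facts (tau0, tau1, sigma0); lra.

(** To change the [i]-th coordinate by [v], move towards [e false i] if [0 <= v] and towards
    [e true i] otherwise. *)
Lemma chart_step i z (v : R) : B z -> d p z + `|v| <= sigma ->
  exists w, [/\ B w, d z w = `|v|, `|f i w - f i z - v| <= 5 * tau * `|v|,
    (forall j : 'I_k, i != j -> `|f j w - f j z| <= 6 * tau * `|v|) &
    (forall x, B x ->
      (forall eps : R, 0 <= eps -> `|f i x - f i w| <= eps ->
        d x z ^+ 2 <= (1 + 2 * tau) * d x w ^+ 2 + v ^+ 2 + 2 * `|v| * (eps + 5 * tau * d w x)) /\
      d x w ^+ 2 <= d x z ^+ 2 + v ^+ 2 + 18 * tau * d x z * `|v| + 2 * v * (f i z - f i x))].
Proof.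
move=> Bz; have t0 := tau0; have [v0|v0] := leP 0 v.
  rewrite (ger0_norm v0) => pv; have [t [w [[bw Bw tv tt zw] [we wo wj]]]] := chart_move geo cur tau0 tau1 sigma0 ch false i Bz v0 pv.
  exists w; split => //; first by move=> j ij; exact: wj.
  move=> x Bx; split.
    move=> eps eps0 H.
    have dwx : 0 <= tau * d w x by rewrite mulr_ge0 ?mdist_ge0 // ltW.
    rewrite -{1 2}tv; apply: (pythagoras_le cur tau0 tau1 sigma0) => //.
    - lra.
    - have := chart_excess cur tau0 tau1 sigma0 ch i true Bx Bw; rewrite (metric_sym x w) /=.
      by move: H; rewrite ler_norml; lra.
  have := pythagoras_ge cur tau0 tau1 sigma0 ch Bz bw (chart_dist tau0 tau1 sigma0 Bz Bx); rewrite tv /=.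
  have : 0 <= tau * d x z * v by rewrite !mulr_ge0 ?mdist_ge0 // ltW.
  lra.
have v'0 : 0 <= - v by lra.
rewrite (ltr0_norm v0) => pv.
have [t [w [[bw Bw tv tt zw] [we wo wj]]]] := chart_move geo cur tau0 tau1 sigma0 ch true i Bz v'0 pv.
exists w; split => //.
- rewrite we (_ : _ - _ = 0) ?normr0; last by ring.
  have : 0 <= tau * - v by rewrite mulr_ge0 // ltW.
  lra.
- by move=> j ij; exact: wj.
move=> x Bx; split.
  move=> eps eps0 H.
  have dwx : 0 <= tau * d w x by rewrite mulr_ge0 ?mdist_ge0 // ltW.
  rewrite -(sqrrN v) -{1 2}tv; apply: (pythagoras_le cur tau0 tau1 sigma0) => //.
  - lra.
  - by move: H; rewrite ler_norml; lra.
have := pythagoras_ge cur tau0 tau1 sigma0 ch Bz bw (chart_dist tau0 tau1 sigma0 Bz Bx); rewrite tv /=.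
have h := chart_excess cur tau0 tau1 sigma0 ch i true Bx Bz; rewrite /= in h.
have {}h := ler_wpM2l v'0 h.
lra.
Qed.

Lemma sum_ord_lt_rec (F : 'I_k -> R) m (mk : (m < k)%N) :
  \sum_(j < k | (j < m.+1)%N) F j = \sum_(j < k | (j < m)%N) F j + F (Ordinal mk).
Proof.
rewrite (bigD1 (Ordinal mk)) //= addrC; congr (_ + _).
by apply: eq_bigl => j; rewrite -val_eqE /= ltnS ltn_neqAle andbC.
Qed.

(* Moving from [X] by [v j] along the [j]-th coordinate for all [j] in turn leads
   to a point [Z] with about the same coordinates as [P]. *)
Lemma chart_moves (P X : M) (v := fun j => f j P - f j X) (s := d P X) :
  d p P + k.+1%:R * s <= sigma ->
  exists Z, [/\ d P Z <= k.+1%:R * s, forall j, `|f j Z - f j P| <= 6 * k%:R * tau * s,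
    d P Z ^+ 2 <= s ^+ 2 - \sum_j v j ^+ 2 + 30 * k%:R ^+ 2 * tau * s ^+ 2 &
    forall x, d P x <= s -> (forall j, `|f j x - f j P| <= 20 * tau * s) ->
      d x X ^+ 2 <= d x Z ^+ 2 + \sum_j v j ^+ 2 + 100 * k%:R ^+ 3 * tau * s ^+ 2].
Proof.
move=> HP; have t0 := tau0; have t1 := tau1.
have s0 : 0 <= s by exact: mdist_ge0.
have Es : d P X = s by [].
have Ev j : v j = f j P - f j X by [].
clearbody s v.
have ts0 : 0 <= tau * s by rewrite mulr_ge0 // ltW.
have ts20 : 0 <= tau * s ^+ 2 by rewrite mulr_ge0 ?sqr_ge0 // ltW.
have k0s : 0 <= k.+1%:R * s by rewrite mulr_ge0.
have BP : B P by move: HP k0s; fact_lra.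
have vs j : `|v j| <= s.
  rewrite Ev ler_norml.
  have := metric_triangle P X (e true j); have := metric_triangle X P (e true j).
  by rewrite (metric_sym X P) Es; lra.
(* After [m] steps the first [m] coordinates are about those of [P] and the others still about those
   of [X]. Each step takes [v j ^+ 2] off the squared distance to [P], as orthogonal moves would. *)
suff H m : (m <= k)%N -> exists z, [/\ d X z <= m%:R * s,
    forall j : 'I_k, (j < m)%N -> `|f j z - f j P| <= 6 * m%:R * tau * s,
    forall j : 'I_k, (m <= j)%N -> `|f j z - f j X| <= 6 * m%:R * tau * s,
    d P z ^+ 2 <= s ^+ 2 - \sum_(j < k | (j < m)%N) v j ^+ 2 + m%:R * (30 * k%:R * tau * s ^+ 2) &
    forall x, d P x <= s -> (forall j, `|f j x - f j P| <= 20 * tau * s) ->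
      d x X ^+ 2 <= d x z ^+ 2 + \sum_(j < k | (j < m)%N) v j ^+ 2 + m%:R * (100 * k%:R ^+ 2 * tau * s ^+ 2)].
  have [z [z1 z2 z3 z4 z5]] := H k (leqnn k); exists z; split.
  - have := metric_triangle P X z; rewrite Es -natr1; move: z1 k0s; fact_lra.
  - by move=> j; apply: z2.
  - rewrite (eq_bigl (fun j : 'I_k => (j < k)%N)) => [|j]; last by rewrite ltn_ord.
    by apply: le_trans z4 _; rewrite le_eqVlt; apply/orP; left; apply/eqP; ring.
  - move=> x Px Hx; rewrite (eq_bigl (fun j : 'I_k => (j < k)%N)) => [|j]; last by rewrite ltn_ord.
    by apply: le_trans (z5 x Px Hx) _; rewrite le_eqVlt; apply/orP; left; apply/eqP; ring.
elim: m => [_|m IH mk].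
  exists X; rewrite mdistxx mul0r; split => //.
  - by move=> j _; rewrite subrr normr0 mulr0 !mul0r.
  - by rewrite Es big_pred0 // subr0 mul0r addr0.
  - by move=> x _ _; rewrite big_pred0 // mul0r !addr0.
have [z [z1 z2 z3 z4 z5]] := IH (ltnW mk).
have mR : 0 <= (m%:R : R) by [].
have mkR : (m%:R : R) + 1 <= k%:R by rewrite natr1 ler_nat.
pose i := Ordinal mk; have vi := vs i.
have vi0 := normr_ge0 (v i).
have kts : (m%:R + 1) * s <= k%:R * s by rewrite ler_wpM2r.
have HP' : d p P + (k%:R * s + s) <= sigma by rewrite -natr1 in HP; move: HP; fact_lra.
have pX : d p X <= d p P + s by rewrite -Es; exact: metric_triangle.
have pz : d p z <= d p P + s + m%:R * s by have := metric_triangle p X z; move: pX z1; fact_lra.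
have Bz : B z by move: pz HP' kts s0; fact_lra.
have [w [Bw zw wi wj wx]] := @chart_step i z (v i) Bz ltac:(move: pz HP' kts vi; fact_lra).
have tvs : tau * `|v i| <= tau * s by rewrite ler_wpM2l // ltW.
have Xw : d X w <= (m%:R + 1) * s by have := metric_triangle X z w; move: z1 zw vi; fact_lra.
have Pz : d P z <= (m%:R + 1) * s by have := metric_triangle P X z; rewrite Es; move: z1; fact_lra.
have fi : `|f i w - f i P| <= 6 * (m%:R + 1) * tau * s.
  have h := z3 i (leqnn m).
  move: wi h; rewrite {1}Ev !ler_norml => wi h; move: wi h tvs ts0; fact_lra.
exists w; rewrite -natr1; split => //.
- move=> j; rewrite ltnS leq_eqVlt => /orP[/eqP jm|jm].
    by have -> : j = i by exact: val_inj.
  have h := z2 j jm; have ij : i != j by rewrite -val_eqE /= neq_ltn jm orbT.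
  have h' := wj j ij; move: h h'; rewrite !ler_norml => h h'; move: h h' tvs; fact_lra.
- move=> j mj; have h := z3 j (ltnW mj).
  have ij : i != j by rewrite -val_eqE /= neq_ltn mj.
  have h' := wj j ij; move: h h'; rewrite !ler_norml => h h'; move: h h' tvs; fact_lra.
- have [_ h] := wx P BP.
  rewrite (sum_ord_lt_rec _ mk) -/i.
  have h1 : 2 * v i * (f i z - f i P) <= - (2 * v i ^+ 2) + 2 * (s * (6 * m%:R * tau * s)).
    have -> : 2 * v i * (f i z - f i P) = 2 * (v i * (f i z - f i X)) - 2 * v i ^+ 2.
      by rewrite Ev; ring.
    have : v i * (f i z - f i X) <= s * (6 * m%:R * tau * s).
      apply: le_trans (ler_norm _) _; rewrite normrM; apply: ler_pM => //.
      exact: z3.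
    fact_lra.
  have h2 : tau * d P z * `|v i| <= tau * ((m%:R + 1) * s) * s.
    apply: ler_pM => //; first by rewrite mulr_ge0 ?mdist_ge0 // ltW.
    by rewrite ler_wpM2l // ltW.
  have h3 : (m%:R + 1) * (tau * s ^+ 2) <= k%:R * (tau * s ^+ 2) by rewrite ler_wpM2r.
  move: h h1 h2 h3 z4 ts20; fact_lra.
- move=> x Px Hx.
  have Bx : B x.
    have := metric_triangle p P x.
    have : 0 <= k%:R * s by rewrite mulr_ge0.
    move: Px HP' s0; fact_lra.
  have [h _] := wx x Bx.
  have eps0 : 0 <= 20 * tau * s + 6 * (m%:R + 1) * tau * s.
    have : 0 <= m%:R * (tau * s) by exact: mulr_ge0.
    by move: ts0; fact_lra.
  have {h} := h _ eps0 _.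
  have Hxi := Hx i; move: (Hxi) (fi); rewrite !ler_norml => a1 a2 /(_ ltac:(move: a1 a2; fact_lra)) h.
  rewrite (sum_ord_lt_rec _ mk) -/i; apply: le_trans (z5 x Px Hx) _.
  have dwx : d w x <= (k%:R + 2) * s.
    have := metric_triangle w X x; have := metric_triangle X P x.
    rewrite (metric_sym w X) (metric_sym X P) Es; move: Px Xw mkR kts; fact_lra.
  have dxw : d x w ^+ 2 <= (k%:R + 2) ^+ 2 * s ^+ 2.
    by rewrite -exprMn (metric_sym x w) ler_sqr ?nnegrE ?mdist_ge0 // mulr_ge0 // addr_ge0.
  have h1 : tau * d x w ^+ 2 <= tau * ((k%:R + 2) ^+ 2 * s ^+ 2) by rewrite ler_wpM2l // ltW.
  have h2 : `|v i| * (20 * tau * s + 6 * (m%:R + 1) * tau * s + 5 * tau * d w x) <=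
    s * (20 * tau * s + 6 * k%:R * tau * s + 5 * tau * ((k%:R + 2) * s)).
    have q1 : tau * d w x <= tau * ((k%:R + 2) * s) by rewrite ler_wpM2l // ltW.
    have q2 : (m%:R + 1) * (tau * s) <= k%:R * (tau * s) by rewrite ler_wpM2r.
    have q3 : 0 <= tau * d w x by rewrite mulr_ge0 ?mdist_ge0 // ltW.
    apply: ler_pM => //; first by apply: addr_ge0 => //; move: eps0 q3; fact_lra.
    move: q1 q2 ts0; fact_lra.
  have k1 : 1 <= (k%:R : R) by move: mkR mR; fact_lra.
  have k2 : k%:R <= (k%:R : R) ^+ 2 by rewrite expr2 ler_peMl //; move: k1; fact_lra.
  have h3 : 0 <= ((k%:R : R) ^+ 2 - k%:R) * (tau * s ^+ 2) by rewrite mulr_ge0 // subr_ge0.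
  have h4 : 0 <= ((k%:R : R) - 1) * (tau * s ^+ 2) by rewrite mulr_ge0 // subr_ge0.
  move: h dxw h1 h2 h3 h4; fact_lra.
Qed.

End moves.

(** * Pairs on one level and additional strainers *)

Section fibre.
Context {R : realType} {M : metricType R}.
Local Notation d := (@mdist R M).
Hypotheses (cM : compact [set: M]) (geo : geodesic_space M) (cur : curved M).
Variable n : nat.
Hypothesis dimM : hausdorff_dim M = n%:R%:E.

Lemma truncn_eq_dist (x y : R) : 0 <= x -> 0 <= y -> Num.truncn x = Num.truncn y -> `|x - y| < 1.
Proof.
move=> x0 y0 xy; have := truncn_itv x0; have := truncn_itv y0.
by rewrite xy -!natr1 => /andP[a1 a2] /andP[a3 a4]; rewrite ltr_norml; lra.
Qed.

(* Otherwise [F] would map a shrunk copy of [M], injectively at every scale, to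
   a grid in dimension [k]. *)
Lemma fibre_pair k (F : 'I_k -> M -> R) (p : M) (beta r0 tau : R) :
  (k < n)%N -> (forall i x y, `|F i x - F i y| <= d x y) ->
  0 < beta -> 0 < r0 -> 0 < tau ->
  exists p' q', [/\ p' != q', d p p' <= beta, d p q' <= beta, d p' q' < r0 &
    forall i, `|F i p' - F i q'| <= tau * d p' q'].
Proof.
move=> kn FL b0 r00 t0; apply: contrapT => H.
have diam0 : 0 <= set_diam [set: M] by apply: le_trans (set_diamP p p cM); rewrite mdistxx.
pose b : R := Num.min beta (Num.min (r0 / 3) 1); pose t := b / (set_diam [set: M] + 1).
have bp : 0 < b by rewrite !lt_min b0 ltr01 andbT /= divr_gt0.
have [bb br b1] : [/\ b <= beta, b <= r0 / 3 & b <= 1] by split; rewrite !ge_min lexx ?orbT.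
have tp : 0 < t by rewrite divr_gt0 //; lra.
have t1 : t <= 1 by rewrite ler_pdivrMr; lra.
have t01 : 0 <= t <= 1 by rewrite (ltW tp) t1.
have [c [bc ce]] := contraction p geo cur t01.
have pc x : d p (c x) <= b.
  have [_ -> _] := bc x; have : t * d p x <= t * (set_diam [set: M] + 1).
    by rewrite ler_pM2l //; have := set_diamP p x cM; lra.
  by rewrite /t divfK // gt_eqF //; lra.
clearbody t b.
have F0 i x : 0 <= F i (c x) - F i p + b.
  by have := FL i (c x) p; rewrite metric_sym ler_norml; have := pc x; lra.
have F1 i x : F i (c x) - F i p + b <= 2 * b.
  by have := FL i (c x) p; rewrite metric_sym ler_norml; have := pc x; lra.
have C0 : 0 <= 2 * b / (tau * t) by rewrite ltW // divr_gt0 // mulr_gt0.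
apply: (@packing_dim _ _ _ dimM k ((2 * b / (tau * t) + 1) ^+ k) 1) => //.
  by apply: exprn_ge0; lra.
move=> e /andP[e0 e1].
have cell0 : 0 < tau * t * e by rewrite !mulr_gt0.
(* The contracted points are at least [t * e] apart, so two of them in one cell of side
   [tau * t * e] would form the required pair. *)
pose K := Num.truncn (2 * b / (tau * t * e)).
exists (K.+1 ^ k)%N; last first.
  rewrite natrX -exprMn; apply: lerXn2r; rewrite ?nnegrE.
  - by rewrite mulr_ge0 // ltW.
  - lra.
  - have : K%:R <= 2 * b / (tau * t * e).
      by have /truncn_itv/andP[] : 0 <= 2 * b / (tau * t * e) by rewrite divr_ge0 // ltW // mulr_gt0.
    move=> /(ler_wpM2r (ltW e0)); rewrite -natr1 (_ : 2 * b / _ * e = 2 * b / (tau * t)).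
      lra.
    by field; rewrite !gt_eqF.
move=> [f [_ fe]].
pose cell i x := (F i (c x) - F i p + b) / (tau * t * e).
have cell_ge0 i x : 0 <= cell i x by apply: divr_ge0; [exact: F0|exact: ltW].
pose code (a : 'I_(K.+1 ^ k).+1) : {ffun 'I_k -> 'I_K.+1} :=
  [ffun i => inord (Num.truncn (cell i (f a)))].
have code_inj : injective code.
  move=> a a' aa'; apply/eqP/negP => /negP neq; apply: H.
  have te : t * e <= d (c (f a)) (c (f a')).
    by apply: le_trans (ce _ _); rewrite ler_pM2l //; exact: fe.
  have cc : 0 < d (c (f a)) (c (f a')) by apply: lt_le_trans te; rewrite mulr_gt0.
  exists (c (f a)), (c (f a')); split.
  - by rewrite -mdist_gt0.
  - by have := pc (f a); lra.
  - by have := pc (f a'); lra.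
  - have := metric_triangle (c (f a)) p (c (f a')); rewrite (metric_sym (c (f a)) p).
    by have := pc (f a); have := pc (f a'); lra.
  move=> i.
  have le_K x : (Num.truncn (cell i x) < K.+1)%N.
    by rewrite ltnS; apply: le_truncn; rewrite ler_pM2r ?invr_gt0.
  have := congr1 (fun g : {ffun 'I_k -> 'I_K.+1} => val (g i)) aa'.
  rewrite /= !ffunE !inordK // => /(truncn_eq_dist (cell_ge0 _ _) (cell_ge0 _ _)).
  rewrite /cell -mulrBl normrM (gtr0_norm (_ : 0 < (tau * t * e)^-1)) ?invr_gt0 //.
  rewrite ltr_pdivrMr // mul1r (_ : _ + b - _ = F i (c (f a)) - F i (c (f a'))); last by ring.
  move=> /ltW h; apply: le_trans h _.
  by rewrite -mulrA ler_pM2l.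
have := leq_card code code_inj.
by rewrite card_ord card_ffun !card_ord ltnn.
Qed.

End fibre.

Section extension_estimates.
Context {R : realType}.
Implicit Types (T U D a b x : R).
Local Ltac fact_lra := clear_facts I; lra.

Lemma cross_inner_le T U a D x : 0 < T <= 1 / 10 -> 0 <= U -> 0 <= D ->
  9 / 20 * D <= a <= 11 / 20 * D -> D <= T / 200 * U -> x <= T / 8 * D ->
  a ^+ 2 + 2 * U * x <= 2 * T * U * a.
Proof.
move=> /andP[T0 T1] U0 D0 /andP[a1 a2] DU xD.
have a0 : 0 <= a by lra.
have h1 : a * a <= a * (11 / 20 * (T / 200 * U)) by rewrite ler_wpM2l //; lra.
have h2 : U * x <= U * (T / 8 * D) by rewrite ler_wpM2l.
have h3 : T * U * (9 / 20 * D) <= T * U * a by rewrite ler_wpM2l // mulr_ge0 // ltW.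
have h4 : 0 <= T * U * a by rewrite !mulr_ge0 // ltW.
rewrite expr2; lra.
Qed.

Lemma opposite_inner_le T D a b x : 0 < T <= 1 / 10 -> 0 <= D -> x = T ^+ 2 / 32 * D ->
  `|a - D / 2| <= x -> `|b - D / 2| <= x ->
  a ^+ 2 + b ^+ 2 - D ^+ 2 <= 2 * (T ^+ 2 - 1) * a * b.
Proof.
move=> /andP[T0 T1] D0 xE; rewrite !ler_norml => /andP[a1 a2] /andP[b1 b2].
have t2 : T ^+ 2 <= 1 / 100 by have := ler_pM (ltW T0) (ltW T0) T1 T1; lra.
have t20 : 0 < T ^+ 2 by rewrite exprn_gt0.
have Tx : T ^+ 2 * D <= 1 / 100 * D by rewrite ler_wpM2r.
have T0D : 0 <= T ^+ 2 * D by rewrite mulr_ge0 // ltW.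
have a0 : D * (9 / 20) <= a by move: a1 D0 Tx; fact_lra.
have b0 : D * (9 / 20) <= b by move: b1 D0 Tx; fact_lra.
have h1 : (D * (9 / 20)) * (D * (9 / 20)) <= a * b by apply: ler_pM => //; move: D0; fact_lra.
have h2 : T ^+ 2 * ((D * (9 / 20)) * (D * (9 / 20))) <= T ^+ 2 * (a * b) by rewrite ler_pM2l.
have h3 : (a + b) * (a + b) <= (D + 2 * x) * (D + 2 * x) by apply: ler_pM; move: a0 b0 a2 b2 D0; fact_lra.
have h4 : x * D <= T ^+ 2 / 32 * D * D by rewrite xE.
have h5 : x * x <= T ^+ 2 / 32 * D * D by rewrite {1}xE ler_wpM2l; move: T0D Tx D0; fact_lra.
have h6 : 0 <= T ^+ 2 * D * D by rewrite mulr_ge0.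
move: h2 h3 h4 h5 h6; fact_lra.
Qed.

End extension_estimates.

Section extension.
Context {R : realType} {M : metricType R}.
Local Notation d := (@mdist R M).
Hypotheses (geo : geodesic_space M) (cur : curved M).
Variables (k : nat) (tau : R) (p : M) (sigma : R) (e : bool -> 'I_k -> M).
Hypotheses (tau0 : 0 < tau) (tau1 : tau <= 1 / 10) (sigma0 : 0 < sigma).
Hypothesis ch : chart tau p sigma e.
Local Notation B z := (d p z <= sigma).
Local Notation f i z := (d z (e true i)).
Local Ltac fact_lra := clear_facts (tau0, tau1, sigma0); lra.

(* The midpoint of a pair of far points at about the same level for all
   coordinates carries one more strainer. *)
Lemma chart_extend (T l : R) p1 q1 : 0 < T <= 1 / 10 -> tau <= T / 200 -> 0 < l ->
  l <= d p1 q1 -> d p p1 <= sigma / 4 -> d p q1 <= sigma / 4 ->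
  (forall i, `|f i p1 - f i q1| <= T / 10 * d p1 q1) ->
  exists m (e' : bool -> 'I_k.+1 -> M), chart T m (T ^+ 2 / 32 * l) e'.
Proof.
move=> T01 tT l0; set D := d p1 q1 => lD pp1 pq1 fpq.
have /andP[T0 T1] := T01; have s0 := sigma0; have t0 := tau0.
have half01 : 0 <= (1 / 2 : R) <= 1 by lra.
have [m bm] := between_exists p1 q1 geo half01.
have [_ p1m mq1] := bm.
have D0 : 0 < D by lra.
have Ds : D <= sigma / 2.
  by have := metric_triangle p1 p q1; rewrite (metric_sym p1 p) -/D; lra.
have pm : d p m <= sigma / 2 by have := metric_triangle p p1 m; rewrite p1m -/D; lra.
have T2 : T ^+ 2 <= 1 / 100 by have := ler_pM (ltW T0) (ltW T0) T1 T1; lra.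
have T20 : 0 < T ^+ 2 by rewrite exprn_gt0.
set rho := T ^+ 2 / 32 * l.
have rhoD : rho <= T ^+ 2 / 32 * D by rewrite ler_pM2l //; lra.
have TT : T ^+ 2 <= T / 10 by have := ler_wpM2l (ltW T0) T1; lra.
have TD : T ^+ 2 * D <= T / 10 * D by rewrite ler_wpM2r // ltW.
have TD1 : T * D <= 1 / 10 * D by rewrite ler_wpM2r // ltW.
have rho0 : 0 < rho by rewrite mulr_gt0 // divr_gt0.
have Bz z : d m z <= rho -> B z by have := metric_triangle p m z; lra.
pose c (s : bool) := if s then p1 else q1.
have cm s : d m (c s) = D / 2.
  by case: s; rewrite /c ?mq1 -/D; [rewrite metric_sym p1m -/D|]; fact_lra.
have near z s : d m z <= rho -> `|d z (c s) - D / 2| <= rho.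
  move=> mz; rewrite -(cm s) ler_norml.
  have := metric_triangle z m (c s); have := metric_triangle m z (c s).
  by rewrite (metric_sym z m); move: mz; fact_lra.
(* The coordinates are almost affine along the segment and nearly equal at its ends, so [p1] and
   [q1] are about on the level of [m]. That makes the new pair nearly orthogonal to the old
   strainers. *)
have level s i : `|d m (e s i) - d p1 (e s i)| <= T * D / 10 /\
                 `|d m (e s i) - d q1 (e s i)| <= T * D / 10.
  have Bp1 : B p1 by move: pp1 s0; fact_lra.
  have Bq1 : B q1 by move: pq1 s0; fact_lra.
  have Bm : B m by move: pm s0; fact_lra.
  have := chart_affine cur tau0 tau1 sigma0 ch s i Bp1 Bq1 Bm bm.
  have tD : tau * D <= T / 200 * D by rewrite ler_wpM2r // ltW.
  have : `|d p1 (e s i) - d q1 (e s i)| <= T / 10 * D + 5 * (tau * D).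
    have tD0 : 0 <= tau * D by rewrite mulr_ge0 // ltW.
    case: s; first by have := fpq i; rewrite -/D; move: tD0; fact_lra.
    have := fpq i; rewrite -/D !ler_norml.
    have := chart_excess cur tau0 tau1 sigma0 ch i true Bp1 Bq1.
    have := chart_excess cur tau0 tau1 sigma0 ch i true Bq1 Bp1.
    rewrite (metric_sym q1 p1) -/D /=; fact_lra.
  by rewrite -/D !ler_norml; move: tD rho0 rhoD TD; fact_lra.
have cross z s i b : d m z <= rho -> inner z (e s i) (c b) <= 2 * T * d z (e s i) * d z (c b).
  move=> mz; have Bz' := Bz z mz.
  have U0 := chart_gt0 tau0 tau1 sigma0 ch s i Bz'.
  have Uf := chart_far ch s i Bz'.
  have lev : d z (e s i) - (T * D / 10 + rho) <= d (c b) (e s i).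
    have [] := level s i; rewrite !ler_norml.
    have := metric_triangle z m (e s i); rewrite (metric_sym z m).
    by move: mz; case: b => /=; fact_lra.
  have x0 : 0 <= T * D / 10 + rho by have : 0 <= T * D by [rewrite mulr_ge0 // ltW]; move: rho0; fact_lra.
  have := sqr_lower (mdist_ge0 (c b) (e s i)) (ltW U0) x0 lev.
  have tU : tau * d z (e s i) <= T / 200 * d z (e s i) by rewrite ler_wpM2r // ltW.
  have := near z b mz; rewrite ler_norml => nzb.
  have := @cross_inner_le R T (d z (e s i)) (d z (c b)) D (T * D / 10 + rho) T01 (ltW U0) (ltW D0).
  move=> /(_ ltac:(move: nzb rhoD TD TD1 D0; fact_lra) ltac:(move: D0 Ds Uf tU; fact_lra)
    ltac:(move: rho0 rhoD TD; fact_lra)).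
  rewrite /inner (metric_sym (e s i) (c b)); fact_lra.
pose e' (s : bool) (j : 'I_k.+1) := if unlift ord_max j is Some i then e s i else c s.
have e'l s i : e' s (lift ord_max i) = e s i by rewrite /e' liftK.
have e'm s : e' s ord_max = c s by rewrite /e' unlift_none.
have tauT : tau <= T by move: tT T0; fact_lra.
exists m, e'; split.
- move=> s j z mz; case: (unliftP ord_max j) => [i|] ->; rewrite ?e'l ?e'm.
    have U0 := chart_gt0 tau0 tau1 sigma0 ch s i (Bz z mz).
    have := chart_far ch s i (Bz z mz).
    have : tau * d z (e s i) <= T * d z (e s i) by rewrite ler_wpM2r // ltW.
    move: rhoD TD TD1 Ds D0; fact_lra.
  have := near z s mz; rewrite ler_norml => /andP[h _].
  have : T * (9 / 20 * D) <= T * d z (c s) by rewrite ler_pM2l //; move: h rhoD TD TD1 D0; fact_lra.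
  move: rho0 rhoD TD; fact_lra.
- move=> j z mz; case: (unliftP ord_max j) => [i|] ->; rewrite ?e'l ?e'm.
    apply: le_trans (chart_opp ch i (Bz z mz)) _.
    rewrite -!mulrA ler_pM2l // ler_wpM2r ?mulr_ge0 ?mdist_ge0 // lerB // lerXn2r ?nnegrE //; exact: ltW.
  rewrite /inner /c -/D; apply: (@opposite_inner_le _ _ _ _ _ (T ^+ 2 / 32 * D)) => //.
  + exact: ltW.
  + exact: le_trans (near z true mz) rhoD.
  + exact: le_trans (near z false mz) rhoD.
- move=> i j s s' z; case: (unliftP ord_max i) => [i'|] ->; case: (unliftP ord_max j) => [j'|] ->;
    rewrite ?eqxx // ?e'l ?e'm => ij mz.
  + rewrite (inj_eq lift_inj) in ij; apply: le_trans (chart_orth ch s s' ij (Bz z mz)) _.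
    by rewrite -!mulrA ler_pM2l // ler_wpM2r ?mulr_ge0 ?mdist_ge0.
  + exact: cross.
  + rewrite innerC; apply: le_trans (cross _ _ _ _ mz) _.
    by rewrite le_eqVlt; apply/orP; left; apply/eqP; ring.
Qed.

End extension.

(** * Obtuse directions and the next strainer *)

Section fibre_obtuse.
Context {R : realType} {M : metricType R}.
Local Notation d := (@mdist R M).
Hypotheses (geo : geodesic_space M) (cur : curved M).
Variables (k n : nat) (tau : R) (p : M) (sigma : R) (e : bool -> 'I_k -> M).
Hypotheses (tau0 : 0 < tau) (tau1 : tau <= 1 / 10) (sigma0 : 0 < sigma).
Hypothesis ch : chart tau p sigma e.
Hypothesis kn : (k < n)%N.
Local Notation B z := (d p z <= sigma).
Local Notation f i z := (d z (e true i)).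
Local Ltac fact_lra := clear_facts (tau0, tau1, sigma0, kn); lra.
Local Notation c := (100 * n%:R ^+ 3 : R).

Lemma dim_coeffs : [/\ 6 * k%:R <= 6 * (n%:R : R), 54 * k%:R ^+ 2 <= c, 24 * k%:R <= 24 * (k%:R : R) ^+ 2 &
  100 * k%:R ^+ 3 <= c].
Proof.
have k0 : 0 <= (k%:R : R) by [].
have k1 : (k%:R : R) + 1 <= n%:R by rewrite natr1 ler_nat.
have kk : (k%:R : R) <= k%:R ^+ 2 by rewrite -natrX ler_nat; case: (k) => // m; rewrite -[leqLHS]expn1 leq_pexp2l.
have n1 : 1 <= (n%:R : R) by lra.
have h2 : (k%:R : R) ^+ 2 <= n%:R ^+ 2 by rewrite lerXn2r ?nnegrE //; lra.
have h3 : (k%:R : R) ^+ 3 <= n%:R ^+ 3 by rewrite lerXn2r ?nnegrE //; lra.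
have h4 : (n%:R : R) ^+ 2 * 1 <= n%:R ^+ 2 * n%:R by rewrite ler_wpM2l // sqr_ge0.
by split; lra.
Qed.

(** The point [Z] reached from [X] has about the coordinates of [P], so by hypothesis it is within
    [eta * s] of [P]. Pythagoras then attributes nearly all of [s ^+ 2] to the coordinate
    differences. *)
Lemma coarse_level (eta T : R) (P X : M) (s := d P X) : 0 < T -> 0 < eta -> 6 * n%:R * tau <= T / 10 * eta ->
  d p P <= sigma / 8 -> 0 < s -> k.+1%:R * s <= sigma / 16 ->
  (forall Z, d p Z <= sigma / 4 -> (forall i, `|f i Z - f i P| <= T / 10 * d P Z) -> d P Z < eta * s) ->
  (1 - eta ^+ 2 - c * tau) * s ^+ 2 <= \sum_j (f j P - f j X) ^+ 2.
Proof.
move=> T0 eta0 H pP s0 ks nA; have [c1 c2 _ c3] := dim_coeffs.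
have pos := sigma0; have t0 := tau0.
have ksP : d p P + k.+1%:R * d P X <= sigma by rewrite -/s; lra.
have [Z [PZ fZ _ /(_ P)]] := chart_moves geo cur tau0 tau1 sigma0 ch ksP.
rewrite mdistxx -/s in PZ fZ * => /(_ (ltW s0)) hP.
have {}hP : s ^+ 2 <= d P Z ^+ 2 + \sum_j (f j P - f j X) ^+ 2 + 100 * k%:R ^+ 3 * tau * s ^+ 2.
  by apply: hP => j; rewrite subrr normr0 !mulr_ge0 // ltW.
have pZ : d p Z <= sigma / 4 by have := metric_triangle p P Z; lra.
have PZs : d P Z < eta * s.
  rewrite ltNge; apply/negP => big; have : d P Z < eta * s; last lra.
  apply: nA => // i; apply: le_trans (fZ i) _.
  have h1 : 6 * k%:R * (tau * s) <= 6 * n%:R * (tau * s) by rewrite ler_wpM2r // mulr_ge0 // ltW.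
  have h2 : 6 * n%:R * tau * s <= T / 10 * eta * s by rewrite ler_wpM2r // ltW.
  have h3 : T / 10 * (eta * s) <= T / 10 * d P Z by rewrite ler_wpM2l //; lra.
  lra.
have h1 : d P Z ^+ 2 <= eta ^+ 2 * s ^+ 2.
  by rewrite -exprMn ler_sqr ?nnegrE ?mdist_ge0 ?(ltW PZs) // mulr_ge0 // ltW.
have h2 : 100 * k%:R ^+ 3 * (tau * s ^+ 2) <= c * (tau * s ^+ 2).
  by rewrite ler_wpM2r // mulr_ge0 ?sqr_ge0 // ltW.
lra.
Qed.

(** The coordinates are almost affine, so [X'] inherits the estimate of [coarse_level] at the scale
    [v], however small. Hence the moves from [X'] end within [omega * v] of [P]. As [Y] is about on
    the level of [P], Pythagoras makes the angle between [Y] and [X'] at [P] not much larger than a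
    right one. *)
Lemma fine_level (eta omega t u : R) (P Q X X' Y : M) (s := d P X) (v := d P Y) :
  0 <= omega -> eta ^+ 2 + 2 * (c * tau) <= omega ^+ 2 ->
  d p P <= sigma / 8 -> B Q -> B X -> 0 < v -> k.+1%:R * v <= sigma / 16 ->
  between t P X X' -> t * s = v -> between u P Q Y -> (forall i, `|f i P - f i Q| <= tau * d P Q) ->
  (1 - eta ^+ 2 - c * tau) * s ^+ 2 <= \sum_j (f j P - f j X) ^+ 2 ->
  d Y X' ^+ 2 <= ((1 + omega) ^+ 2 + 1 + 2 * (c * tau)) * v ^+ 2.
Proof.
move=> om0 Hom pP BQ BX v0 kv bX tsv bY fPQ coarse.
have [_ c2 c3 c4] := dim_coeffs; have pos := sigma0; have t0 := tau0; have t1 := tau1.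
have [/andP[tt0 tt1] PX' _] := bX; have [/andP[u0 u1] PY _] := bY.
rewrite -/s tsv in PX'.
have kvP : d p P + k.+1%:R * d P X' <= sigma by rewrite PX'; move: pP kv pos; fact_lra.
have v_le : v <= k.+1%:R * v by rewrite ler_peMl ?(ltW v0) // ler1n.
have BP : B P by move: pP pos; fact_lra.
have BX' : B X' by have := metric_triangle p P X'; move: pP PX' kv v_le pos; fact_lra.
have BY : B Y by have := metric_triangle p P Y; rewrite -/v; move: pP kv v_le pos; fact_lra.
have tv0 : 0 <= tau * v by rewrite mulr_ge0 // ltW.
have tv20 : 0 <= tau * v ^+ 2 by rewrite mulr_ge0 ?sqr_ge0 // ltW.
have [Z [_ _ PZ far]] := chart_moves geo cur tau0 tau1 sigma0 ch kvP.
rewrite PX' in PZ far.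
have {far} : d Y X' ^+ 2 <= d Y Z ^+ 2 + \sum_j (f j P - f j X') ^+ 2 + 100 * k%:R ^+ 3 * tau * v ^+ 2.
  apply: far => // j.
  have := chart_affine cur tau0 tau1 sigma0 ch true j BP BQ BY bY.
  have h1 : `|u * (f j Q - f j P)| <= tau * v.
    rewrite normrM ger0_norm // distrC /v PY mulrCA ler_wpM2l //; exact: fPQ.
  rewrite -[12 * tau * u * _]mulrA -PY -/v; move: h1; rewrite !ler_norml; move: tv0; fact_lra.
have sumX' : (1 - eta ^+ 2 - c * tau) * v ^+ 2 - 24 * k%:R * (tau * v ^+ 2) <= \sum_j (f j P - f j X') ^+ 2.
  have -> : 24 * k%:R * (tau * v ^+ 2) = \sum_(j < k) (24 * (tau * v ^+ 2)).
    by rewrite sumr_const card_ord -mulr_natr; ring.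
  apply: (@le_trans _ _ (t ^+ 2 * \sum_j (f j P - f j X) ^+ 2 - \sum_(j < k) (24 * (tau * v ^+ 2)))).
    by rewrite lerB // -tsv exprMn mulrCA ler_wpM2l // sqr_ge0.
  rewrite mulr_sumr -sumrB; apply: ler_sum => j _.
  have := chart_affine cur tau0 tau1 sigma0 ch true j BP BX BX' bX.
  rewrite -[12 * tau * t * _]mulrA -/s tsv.
  have h2 : `|t * (f j P - f j X)| <= v.
    rewrite normrM ger0_norm // -tsv ler_wpM2l // ler_norml.
    have := metric_triangle P X (e true j); have := metric_triangle X P (e true j).
    by rewrite (metric_sym X P) -/s; fact_lra.
  set y := f j P - f j X'; set x := t * (f j P - f j X).
  rewrite (_ : f j X' - f j P - _ = x - y); last by rewrite /x /y; ring.
  move=> h3; have h4 : x * (x - y) <= v * (12 * tau * v).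
    by apply: le_trans (ler_norm _) _; rewrite normrM ler_pM.
  have -> : t ^+ 2 * (f j P - f j X) ^+ 2 = x ^+ 2 by rewrite /x; ring.
  have := sqr_ge0 (x - y); move: h4; fact_lra.
have kt : 54 * k%:R ^+ 2 * (tau * v ^+ 2) <= c * (tau * v ^+ 2) by rewrite ler_wpM2r.
have kt3 : 24 * k%:R * (tau * v ^+ 2) <= 24 * k%:R ^+ 2 * (tau * v ^+ 2) by rewrite ler_wpM2r.
have kt4 : 100 * k%:R ^+ 3 * (tau * v ^+ 2) <= c * (tau * v ^+ 2) by rewrite ler_wpM2r.
have kt2 : 0 <= k%:R ^+ 2 * (tau * v ^+ 2) by rewrite mulr_ge0 // sqr_ge0.
have omv : (eta ^+ 2 + 2 * (c * tau)) * v ^+ 2 <= omega ^+ 2 * v ^+ 2 by rewrite ler_wpM2r // sqr_ge0.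
have PZv : d P Z <= omega * v.
  rewrite -ler_sqr ?nnegrE ?mdist_ge0 ?mulr_ge0 ?(ltW v0) // exprMn; move: PZ sumX' kt kt2 kt3 omv; fact_lra.
have YZ : d Y Z ^+ 2 <= (1 + omega) ^+ 2 * v ^+ 2.
  rewrite -exprMn ler_sqr ?nnegrE ?mdist_ge0 //; last by rewrite mulr_ge0 ?addr_ge0 // ltW.
  by have := metric_triangle Y P Z; rewrite (metric_sym Y P) -/v; move: PZv; fact_lra.
have := sqr_ge0 (d P Z); move: PZ kt kt2 kt4 YZ tv20; fact_lra.
Qed.

End fibre_obtuse.

Definition obtuse {R : realType} (M : metricType R) (delta : R) : Prop :=
  exists2 r0 : R, 0 < r0 & forall p q : M, p != q -> mdist p q < r0 -> delta < ob_pair p q.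

Section next_chart.
Context {R : realType} {M : metricType R}.
Local Notation d := (@mdist R M).
Hypotheses (cM : compact [set: M]) (geo : geodesic_space M) (cur : curved M).
Variables (n k : nat) (delta T tau : R) (p : M) (sigma : R) (e : bool -> 'I_k -> M).
Hypotheses (dimM : hausdorff_dim M = n%:R%:E) (kn : (k < n)%N).
Hypotheses (delta_gt0 : 0 < delta) (delta_le : delta <= pi / 2) (T01 : 0 < T <= 1 / 10).
Local Notation c := (100 * n%:R ^+ 3 : R).
Local Notation omega := (sin delta / 2).
Local Notation eta := (omega / 2).
Hypotheses (tau0 : 0 < tau) (tau_le : tau <= T / 200) (tau_le_om : 6 * (c * tau) <= omega ^+ 2)
  (tau_le_eta : 10 * (c * tau) <= eta * T).
Hypotheses (sigma0 : 0 < sigma) (sigma_le : 8 * sigma <= set_diam [set: M]).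
Hypotheses (ob : obtuse M delta) (ch : chart tau p sigma e).
Local Notation f i z := (d z (e true i)).
Local Ltac fact_lra :=
  clear_facts (kn, delta_gt0, delta_le, T01, tau0, tau_le, tau_le_om, tau_le_eta, sigma0, sigma_le); lra.

Lemma obtuse_fibre_pair : exists P Q, [/\ P != Q, d p P <= sigma / 8, d p Q <= sigma / 8,
  forall i, `|f i P - f i Q| <= tau * d P Q & delta < ob_at P Q].
Proof.
have [r0 r00 H] := ob.
have lip (i : 'I_k) x y : `|f i x - f i y| <= d x y.
  rewrite ler_norml; have := metric_triangle x y (e true i); have := metric_triangle y x (e true i).
  by rewrite (metric_sym y x); lra.
have s0 : 0 < sigma / 8 by have := sigma0; lra.
have [P [Q [PQ pP pQ PQr fPQ]]] := fibre_pair cM geo cur dimM p kn lip s0 r00 tau0.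
have := H P Q PQ PQr; rewrite /ob_pair lt_max => /orP[obPQ|obQP]; first by exists P, Q; split.
by exists Q, P; split => //; [rewrite eq_sym|move=> i; rewrite distrC (metric_sym Q P); exact: fPQ].
Qed.

(* Otherwise, at a distance that is small compared to [sigma], points with about
   the same coordinates are close to each other. A direction at [P] making an
   obtuse angle with that of [Q], where [P] and [Q] have about the same
   coordinates, is then nearly determined by the differentials of the
   coordinates, so that it is nearly orthogonal to [Q]. *)
Lemma chart_next : exists m (e' : bool -> 'I_k.+1 -> M),
  chart T m (T ^+ 2 / 32 * (eta * (sigma / (16 * n%:R)))) e'.
Proof.
apply: contrapT => H.
have t0 := tau0; have sg0 := sigma0; have /andP[T0 T1] := T01; have dl0 := delta_gt0.
have tl := tau_le; have dle := delta_le; have sgl := sigma_le.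
have sin0 : 0 < sin delta.
  by rewrite sin_gt0_pi //; have := pi_gt0 R; lra.
have om0 : 0 < omega by lra.
have eta0 : 0 < eta by lra.
have om1 : omega <= 1 / 2 by have := sin_le1 delta; lra.
have tau1 : tau <= 1 / 10 by lra.
have n1 : 1 <= (n%:R : R) by rewrite ler1n; case: (n) kn.
have n30 : n%:R * tau <= n%:R ^+ 3 * tau.
  by rewrite ler_pM2r // exprS ler_peMr ?exprn_ege1 //; lra.
pose s := sigma / (16 * n%:R).
have s0 : 0 < s by rewrite divr_gt0 // mulr_gt0 //; lra.
have ks : k.+1%:R * s <= sigma / 16.
  have : k.+1%:R * s <= n%:R * s by rewrite ler_pM2r // ler_nat.
  rewrite (_ : n%:R * s = sigma / 16) // /s; field; rewrite gt_eqF //; lra.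
have s16 : s <= sigma / 16.
  by apply: le_trans ks; rewrite ler_peMl ?(ltW s0) // ler1n.
have nA p1 q1 : d p p1 <= sigma / 4 -> d p q1 <= sigma / 4 ->
    (forall i, `|f i q1 - f i p1| <= T / 10 * d p1 q1) -> d p1 q1 < eta * s.
  move=> pp1 pq1 fpq; rewrite ltNge; apply/negP => big; apply: H.
  apply: (chart_extend geo cur tau0 tau1 sigma0 ch T01 tau_le _ big) => //.
    by rewrite mulr_gt0.
  by move=> i; rewrite distrC.
have [P [Q [PQ pP pQ fPQ obPQ]]] := obtuse_fibre_pair.
have rad := diam_le_radius cM p; have rad0 : 0 < Defs.radius M by move: sg0 sgl rad; fact_lra.
have [x [h [far [h0 hx ih] ang]]] := ob_at_gt cur PQ rad0 (ltW delta_gt0) obPQ.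
have [g [g0 gQ ig]] := geo P Q.
have {}ang := ang g ltac:(by split).
have PQ0 : 0 < d P Q by rewrite mdist_gt0.
have Px0 : 0 < d P x by move: rad0 far; fact_lra.
have delta_itv : 0 <= delta <= pi / 2 by rewrite (ltW dl0).
have gh0 : g 0 = h 0 by rewrite g0.
have [s1 s10 hinge] := obtuse_hinge cur PQ0 Px0 gh0 ig ih delta_itv ang.
have sx : s <= d P x by move: s16 sgl rad far sg0; fact_lra.
have PX : d P (h s) = s by rewrite -h0 (isometric_on0 ih) // (ltW s0).
have coarse : (1 - eta ^+ 2 - c * tau) * d P (h s) ^+ 2 <= \sum_j (f j P - f j (h s)) ^+ 2.
  apply: (coarse_level geo cur tau0 tau1 sigma0 ch kn (T := T)) => //.
  - have c_eta := tau_le_eta; have : 0 <= n%:R * tau by rewrite mulr_ge0 // ltW. move: c_eta n30; fact_lra.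
  - by rewrite PX.
  - by rewrite PX.
  - rewrite PX => Z pZ HZ; apply: nA => //; move: pP sg0; fact_lra.
(* The obtuse angle is visible only up to the scale [s1], over which there is no control. *)
pose v := Num.min s1 s.
have v0 : 0 < v by rewrite lt_min s10.
have vs : v <= s by rewrite ge_min lexx orbT.
have v1 : 0 < v <= s1 by rewrite v0 ge_min lexx.
have [s1Q [s1x big]] := hinge v v1; have {v1}/andP[_ v1] := v1.
have PY : d P (g v) = v by rewrite -g0 (isometric_on0 ig) //; move: v0 v1 s1Q; fact_lra.
have kv : k.+1%:R * v <= sigma / 16 by apply: le_trans ks; rewrite ler_pM2l // ltr0n.
have bX : between (v / s) P (h s) (h v).
  rewrite -h0; apply: isometric_between ih _ _; [by rewrite (ltW v0)|by rewrite s0].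
have bY : between (v / d P Q) P Q (g v).
  have := @isometric_between _ _ g (d P Q) v (d P Q) ig; rewrite g0 gQ; apply; rewrite ?(ltW v0) ?PQ0 ?lexx //=; move: v1 s1Q; fact_lra.
have ot := tau_le_om.
have cond : eta ^+ 2 + 2 * (c * tau) <= omega ^+ 2 by have := sqr_ge0 omega; move: ot; fact_lra.
have BQ : d p Q <= sigma by move: pQ sg0; fact_lra.
have BX : d p (h s) <= sigma by have := metric_triangle p P (h s); move: pP PX s16 sg0; fact_lra.
have := fine_level geo cur tau0 tau1 sigma0 ch kn (ltW om0) cond pP BQ BX _ _ bX _ bY fPQ coarse.
rewrite PY PX divfK ?gt_eqF // => /(_ v0 kv erefl) le.
have {le}lt := lt_le_trans big le.
have v20 : 0 < v ^+ 2 by rewrite exprn_gt0.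
have om2 : 0 <= omega * (1 / 2 - omega) by rewrite mulr_ge0 ?(ltW om0) // subr_ge0.
(* As [sin delta = 2 * omega], the obtuse hinge has squared chord above [(2 + 4 * omega) * v ^+ 2],
   while [fine_level] allows at most [(2 + 2 * omega + 4 / 3 * omega ^+ 2) * v ^+ 2]. This is
   smaller because [omega <= 1 / 2]. *)
have /ltW := om0; have : (1 + omega) ^+ 2 + 1 + 2 * (c * tau) <= 2 * (1 + sin delta) by move: ot om0 om2; fact_lra.
rewrite -(ler_pM2r v20); move: lt; fact_lra.
Qed.

End next_chart.

(** * Volume of a space with strainers of full multiplicity *)

Section strained_volume.
Context {R : realType} {M : metricType R}.
Local Notation d := (@mdist R M).
Hypotheses (cM : compact [set: M]) (geo : geodesic_space M) (cur : curved M).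
Variables (n : nat) (p : M) (sigma : R) (e : bool -> 'I_n -> M).
Hypotheses (n0 : (0 < n)%N) (sigma0 : 0 < sigma).
Hypothesis ch : chart ((100 * n%:R)^-1) p sigma e.
Local Notation f i z := (d z (e true i)).

(* A minimiser [z] of [\sum_j `|f j z - w j| + d p z / 2] has coordinates [w],
   for it could be improved by a step along the coordinates. *)
Lemma chart_open (w : 'I_n -> R) : (forall i, f i p <= w i <= f i p + sigma / (10 * n%:R)) ->
  exists z, forall i, f i z = w i.
Proof.
move=> Hw; have sg0 := sigma0.
have n1 : 1 <= (n%:R : R) by rewrite ler1n.
pose tau : R := (100 * n%:R)^-1; have tn : n%:R * tau = 1 / 100.
  by rewrite /tau; field; rewrite gt_eqF //; lra.
have tau0 : 0 < tau by rewrite invr_gt0 mulr_gt0 //; lra.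
have tau1 : tau <= 1 / 10 by have : 1 * tau <= n%:R * tau by [rewrite ler_wpM2r // ltW]; lra.
(* The last term keeps the minimiser inside the chart. Its weight 1/2 is small enough for a step to
   pay off: correcting a coordinate by [v] gains the length of [v], and loses half of it there and
   6/100 of it in the errors of all coordinates. *)
pose Phi (z : M) : R := \sum_j `|d (e true j) z - w j| + d p z / 2.
have contPhi : continuous Phi.
  move=> z; apply: cvgD; last by apply: cvgM; [exact: mdist_continuousr|exact: cvg_cst].
  apply: cvg_big => [|j _]; first exact: add_continuous.
  apply: cvg_norm; apply: cvgB; first exact: mdist_continuousr.
  exact: cvg_cst.
have [|z _ min] := compact_EVT_min _ cM (continuous_subspaceT contPhi); first by exists p.
have {}min x : Phi z <= Phi x by apply: min; rewrite inE.
have wp j : `|f j p - w j| <= sigma / (10 * n%:R).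
  by have := Hw j; rewrite ler_norml => /andP[h1 h2]; lra.
have pz : d p z <= sigma / 5.
  have := min p; rewrite /Phi mdistxx.
  have : \sum_j `|d (e true j) p - w j| <= \sum_(j < n) sigma / (10 * n%:R).
    by apply: ler_sum => j _; rewrite metric_sym.
  have -> : \sum_(j < n) sigma / (10 * n%:R) = sigma / 10.
    by rewrite sumr_const card_ord -(mulr_natl (sigma / _)); field; rewrite gt_eqF //; lra.
  have : 0 <= \sum_j `|d (e true j) z - w j| by exact: sumr_ge0.
  lra.
exists z => i; apply/eqP/negP => /negP neq.
pose v := w i - f i z.
have v0 : 0 < `|v| by rewrite normr_gt0 subr_eq0 eq_sym.
have sn : sigma / (10 * n%:R) <= sigma / 10.
  by rewrite ler_pM2l // lef_pV2 ?posrE //; lra.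
have vle : `|v| <= sigma / 10 + sigma / 5.
  have := wp i; have := metric_triangle p z (e true i); have := metric_triangle z p (e true i).
  rewrite (metric_sym z p) /v !ler_norml => h1 h2 /andP[h3 h4]; lra.
have pzv : d p z + `|v| <= sigma by lra.
have Bz : d p z <= sigma by lra.
have [x [_ zx fi fj _]] := chart_step geo cur tau0 tau1 sigma0 ch i Bz pzv.
have step j : `|f j x - w j| <= `|f j z - w j| + 6 * tau * `|v| - (if j == i then `|v| else 0).
  have tv : 0 <= tau * `|v| by rewrite mulr_ge0 // ltW.
  have [->|ji] := eqVneq j i.
    rewrite (distrC (f i z)) -/v (_ : f i x - w i = f i x - f i z - v); last by rewrite /v; ring.
    lra.
  have ij : i != j by rewrite eq_sym.
  rewrite subr0 (_ : f j x - w j = (f j z - w j) + (f j x - f j z)); last by ring.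
  by apply: le_trans (ler_normD _ _) _; rewrite lerD2l; exact: fj.
have := min x; rewrite /Phi leNgt => /negP; apply.
have : \sum_j `|d (e true j) x - w j| <=
    \sum_j (`|d (e true j) z - w j| + 6 * tau * `|v| - (if j == i then `|v| else 0)).
  by apply: ler_sum => j _; rewrite !(metric_sym (e true j)).
rewrite sumrB big_split /= sumr_const card_ord -big_mkcond big_pred1_eq.
rewrite -(mulr_natl (6 * tau * `|v|) n) (_ : n%:R * (6 * tau * `|v|) = 6 * (n%:R * tau) * `|v|); last by ring.
rewrite tn; have := metric_triangle p z x; rewrite zx; lra.
Qed.

Lemma strained_volume : (((sigma / (40 * n%:R)) ^+ n)%:E <= hausdorff_outer n%:R [set: M])%E.
Proof.
have n1 : 0 < (n%:R : R) by rewrite ltr0n.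
have a0 : 0 < sigma / (10 * n%:R) by rewrite divr_gt0 // mulr_gt0.
rewrite (_ : sigma / (40 * n%:R) = sigma / (10 * n%:R) / 4); last by field; rewrite gt_eqF.
apply: (@hausdorff_outer_cube _ _ n (fun i z => f i z) (fun i => f i p)) => //.
  move=> i x y; rewrite ler_norml; have := metric_triangle x y (e true i).
  by have := metric_triangle y x (e true i); rewrite (metric_sym y x); lra.
exact: chart_open.
Qed.

End strained_volume.

Section obtuse_volume.
Context {R : realType}.
Variables (n : nat) (delta : R).
Hypotheses (n0 : (0 < n)%N) (delta_gt0 : 0 < delta) (delta_le : delta <= pi / 2).

(** The induction is for all [T] at once, because quality [T] with one more strainer requires a much
    finer quality [tau] before. Scales are measured against the diameter, so that [lam] does not
    depend on [M]. A chart without strainers is vacuous. *)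
Lemma chart_exists k (T : R) : (k <= n)%N -> 0 < T <= 1 / 10 ->
  exists2 lam : R, 0 < lam <= 1 / 8 & forall M : metricType R, compact [set: M] ->
    geodesic_space M -> curved M -> hausdorff_dim M = n%:R%:E -> obtuse M delta ->
    0 < set_diam [set: M] -> M ->
    exists p (e : bool -> 'I_k -> M), chart T p (lam * set_diam [set: M]) e.
Proof.
elim: k T => [|k IH] T kn /andP[T0 T1].
  exists (1 / 8); first by lra.
  by move=> M _ _ _ _ _ _ p; exists p, (fun _ _ => p); split => [s []|[]|[]].
have dl0 := delta_gt0; have dle := delta_le.
have sin0 : 0 < sin delta by rewrite sin_gt0_pi //; have := pi_gt0 R; lra.
have [c cE] : exists c : R, c = 100 * n%:R ^+ 3 by exists (100 * n%:R ^+ 3).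
have c0 : 0 < c by rewrite cE mulr_gt0 // exprn_gt0 // ltr0n.
have [c6 c10] : 0 < 6 * c /\ 0 < 10 * c by split; lra.
pose omega := sin delta / 2; have om0 : 0 < omega by rewrite divr_gt0.
pose eta := omega / 2; have eta0 : 0 < eta by rewrite divr_gt0.
pose tau := Num.min (T / 200) (Num.min (omega ^+ 2 / (6 * c)) (eta * T / (10 * c))).
have t1 : tau <= T / 200 by rewrite ge_min lexx.
have t2 : 6 * (c * tau) <= omega ^+ 2.
  have : tau <= omega ^+ 2 / (6 * c) by rewrite !ge_min lexx !orbT.
  by rewrite ler_pdivlMr // => h; rewrite mulrA mulrC.
have t3 : 10 * (c * tau) <= eta * T.
  have : tau <= eta * T / (10 * c) by rewrite !ge_min lexx !orbT.
  by rewrite ler_pdivlMr // => h; rewrite mulrA mulrC.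
have t0 : 0 < tau.
  by rewrite !lt_min divr_gt0 // (divr_gt0 (exprn_gt0 _ om0) c6) (divr_gt0 (mulr_gt0 eta0 T0) c10).
have tau01 : 0 < tau <= 1 / 10 by lra.
have [lam lam01 H] := IH tau (ltnW kn) tau01; have /andP[lam0 lam1] := lam01.
have n1 : 1 <= (n%:R : R) by rewrite ler1n.
exists (T ^+ 2 / 32 * (eta * (lam / (16 * n%:R)))).
  have T01 : 0 < T <= 1 by lra.
  have eta1 : eta <= 1 by rewrite /eta /omega; have := sin_le1 delta; lra.
  have h1 : 0 < lam / (16 * n%:R) <= 1 / 8.
    rewrite divr_gt0 ?mulr_gt0 //=; last lra.
    by rewrite ler_pdivrMr; lra.
  have h2 : 0 < T ^+ 2 / 32 <= 1.
    by have := exprn_gt0 2 T0; have := @exprn_ile1 _ 2 T (ltW T0) ltac:(lra); lra.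
  have le1M (x y : R) : 0 < x <= 1 -> 0 < y <= 1 / 8 -> 0 < x * y <= 1 / 8.
    by move=> /andP[x0 x1] /andP[y0 y1]; rewrite mulr_gt0 //= (le_trans _ y1) // ler_piMl // ltW.
  by apply/le1M/le1M => //; rewrite eta0.
move=> M cM geo cur dimM ob D0 x0; have [p [e ch]] := H M cM geo cur dimM ob D0 x0.
have sg0 : 0 < lam * set_diam [set: M] by rewrite mulr_gt0.
have sg1 : 8 * (lam * set_diam [set: M]) <= set_diam [set: M].
  by have := ler_wpM2r (ltW D0) lam1; lra.
have T01 : 0 < T <= 1 / 10 by rewrite T0.
rewrite cE in t2 t3; have [m [e' ch']] := chart_next cM geo cur dimM kn delta_gt0 delta_le T01 t0 t1 t2 t3 sg0 sg1 ob ch.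
exists m, e'; move: ch'; congr chart; rewrite /eta /omega; ring.
Qed.

Lemma obtuse_volume : exists2 v : R, 0 < v <= 1 & forall M : metricType R, compact [set: M] ->
    geodesic_space M -> curved M -> hausdorff_dim M = n%:R%:E -> obtuse M delta ->
    0 < set_diam [set: M] -> M ->
    ((v * set_diam [set: M] ^+ n)%:E <= hausdorff_outer n%:R [set: M])%E.
Proof.
have n1 : 1 <= (n%:R : R) by rewrite ler1n.
have n100 : 0 < (100 * n%:R : R)^-1 <= 1 / 10.
  by rewrite invr_gt0 mulr_gt0 //=; [rewrite invf_ple ?posrE; lra|lra].
have [lam /andP[lam0 lam1] H] := chart_exists (leqnn n) n100.
have l0 : 0 < lam / (40 * n%:R) by rewrite divr_gt0 // mulr_gt0 //; lra.
exists ((lam / (40 * n%:R)) ^+ n).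
  rewrite exprn_gt0 //= exprn_ile1 ?ltW //.
  by rewrite ltr_pdivrMr; lra.
move=> M cM geo cur dimM ob D0 x0; have [p [e ch]] := H M cM geo cur dimM ob D0 x0.
rewrite -exprMn (_ : _ / _ * _ = lam * set_diam [set: M] / (40 * n%:R)); last by ring.
by apply: (strained_volume cM geo cur n0 _ ch); rewrite mulr_gt0.
Qed.

End obtuse_volume.

(** * A continuous modulus from arbitrary thresholds *)

Section moduli.
Context {R : realType}.
Implicit Types (g h : R -> R) (s t : R).

Lemma continuous_if_pos g h t : 0 < t -> {for t, continuous g} ->
  {for t, continuous (fun s => if 0 < s then g s else h s)}.
Proof.
move=> t0; rewrite /prop_for /continuous_at /= t0; apply: cvg_trans.
apply: near_eq_cvg; near=> s; rewrite ifT //; near: s; exact: lt_nbhsr.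
Unshelve. all: by end_near. Qed.

Lemma cvg_if_pos g h (l : R) : g s @[s --> 0^'+] --> l ->
  (if 0 < s then g s else h s) @[s --> 0^'+] --> l.
Proof.
apply: cvg_trans; apply: near_eq_cvg; near=> s; rewrite ifT //; near: s; exact: nbhs_right_gt.
Unshelve. all: by end_near. Qed.

Variables (b a0 : R) (a : R -> R).
Hypotheses (b0 : 0 < b) (a00 : 0 < a0) (a0_le : forall x, 0 < x <= b -> a0 <= a x).

(** As an infimum of affine functions of [t] it is continuous without any regularity of [a]. It is
    positive for positive [t] since [a] is bounded below, and tends to 0 with [t] because the
    constant terms [x] are arbitrarily small. *)
Definition infimum_affine t := inf [set x + t * a x | x in [set x | 0 < x <= b]].

Lemma infimum_affine_le t x : 0 <= t -> 0 < x <= b -> infimum_affine t <= x + t * a x.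
Proof.
move=> t0 xb; apply: ge_inf; last by exists x.
exists 0 => _ [y /= yb <-]; have := a0_le yb; move: yb => /andP[y0 _] ay.
by rewrite addr_ge0 ?(ltW y0) // mulr_ge0 // (le_trans _ ay) // ltW.
Qed.

Lemma infimum_affine_ge t c : (forall x, 0 < x <= b -> c <= x + t * a x) -> c <= infimum_affine t.
Proof.
move=> H; apply: lb_le_inf; first by exists (b + t * a b), b => //=; rewrite b0 lexx.
by move=> _ [x /= xb <-]; exact: H.
Qed.

Lemma infimum_affine_gt0 t : 0 < t -> 0 < infimum_affine t.
Proof.
move=> t0; apply: (@lt_le_trans _ _ (t * a0)); first by rewrite mulr_gt0.
apply: infimum_affine_ge => x xb; have := a0_le xb; move: xb => /andP[x0 _] ax.
by have : t * a0 <= t * a x by [rewrite ler_pM2l]; lra.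
Qed.

(** Replacing [t] by [s] changes each [x + t * a x] by at most the fraction [y] of itself, which
    carries over to the infimum. *)
Lemma infimum_affine_dist s t : 0 < s -> 0 < t ->
  `|infimum_affine s - infimum_affine t| <= infimum_affine t / t * `|s - t|.
Proof.
move=> s0 t0; have C0 := infimum_affine_gt0 t0; set C := infimum_affine t in C0 *.
pose y := `|s - t| / t; have y0 : 0 <= y by rewrite divr_ge0 // ltW.
have yt : y * t = `|s - t| by rewrite divfK // gt_eqF.
have -> : C / t * `|s - t| = y * C by rewrite /y; ring.
have aux x : 0 < x <= b -> `|(s - t) * a x| <= y * t * a x.
  move=> xb; have ax : 0 < a x by exact: lt_le_trans a00 (a0_le xb).
  by rewrite yt normrM (gtr0_norm ax).
clearbody y.
rewrite ler_norml; apply/andP; split.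
  have [y1|y1] := leP y 1; last first.
    have : 1 * C < y * C by rewrite ltr_pM2r.
    have := infimum_affine_gt0 s0; lra.
  rewrite lerBrDr; apply: infimum_affine_ge => x xb.
  have := aux x xb; rewrite ler_norml => /andP[h1 h2].
  have hC := infimum_affine_le (ltW t0) xb; rewrite -/C in hC.
  have y1' : 0 <= 1 - y by lra.
  have := ler_wpM2l y1' hC; have /andP[x0 _] := xb.
  have : 0 <= y * x by rewrite mulr_ge0 // ltW.
  lra.
suff : infimum_affine s <= (1 + y) * C by lra.
have y1 : 0 < 1 + y by lra.
rewrite mulrC -ler_pdivrMr //; apply: infimum_affine_ge => x xb.
rewrite ler_pdivrMr //; apply: le_trans (infimum_affine_le (ltW s0) xb) _.
have := aux x xb; rewrite ler_norml => /andP[h1 h2]; have /andP[x0 _] := xb.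
have : 0 <= y * x by rewrite mulr_ge0 // ltW.
lra.
Qed.

Lemma infimum_affine_continuous t : 0 < t -> {for t, continuous infimum_affine}.
Proof.
move=> t0; apply/cvgrPdist_le => e' e0; set e : R := e' in e0 *.
have C0 := infimum_affine_gt0 t0.
have d0 : 0 < e / (infimum_affine t / t) by rewrite !divr_gt0.
have near_t : \forall s \near t, `|t - s| <= e / (infimum_affine t / t).
  by apply: (@cvgr_dist_le _ _ _ (nbhs t) _ id t) => //; exact: cvg_id.
apply: filterS2 (lt_nbhsr t0) near_t => s s0 st.
rewrite distrC; apply: le_trans (infimum_affine_dist s0 t0) _.
by rewrite mulrC -ler_pdivlMr ?divr_gt0 // distrC.
Qed.

Lemma infimum_affine_cvg0 : infimum_affine t @[t --> 0^'+] --> (0 : R).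
Proof.
apply/cvgrPdist_le => /= e e0.
pose x := Num.min (e / 2) b.
have xb : 0 < x <= b by rewrite lt_min b0 divr_gt0 // ge_min lexx orbT.
have ax : 0 < a x by exact: lt_le_trans a00 (a0_le xb).
have xe : x <= e / 2 by rewrite ge_min lexx.
clearbody x; near=> t.
have t0 : 0 < t by near: t; exact: nbhs_right_gt.
rewrite sub0r normrN gtr0_norm ?infimum_affine_gt0 //.
apply: le_trans (infimum_affine_le (ltW t0) xb) _.
have : t <= e / 2 / a x by near: t; apply: nbhs_right_le; rewrite !divr_gt0.
rewrite ler_pdivlMr //; lra.
Unshelve. all: by end_near. Qed.

End moduli.

(** * Bounds for the obtuse constant *)

Section obtuse_constant_bounds.
Context {R : realType} {M : metricType R}.
Local Notation d := (@mdist R M).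

Lemma obtuse_constant_ge (c r : R) : 0 < r ->
  (forall p q : M, p != q -> d p q < r -> c <= ob_pair p q) -> (c%:E <= obtuse_constant M)%E.
Proof.
move=> r0 H; rewrite /obtuse_constant limf_einfE; apply: le_ereal_sup_tmp.
exists (ereal_inf [set (ob_pair pq.1 pq.2)%:E | pq in [set pq : M * M | pq.1 != pq.2 /\ d pq.1 pq.2 < r]]).
  exists [set pq : M * M | pq.1 != pq.2 /\ d pq.1 pq.2 < r] => //.
  rewrite /within /=; apply: filterS (entourage_ball M (PosNum r0)) => -[p q] /=.
  by rewrite ballEmdist /= => pq neq; split.
by apply: le_ereal_inf_tmp => _ [[p q] /= [neq pq] <-]; rewrite lee_fin; exact: H.
Qed.

Lemma obtuse_constant_le (delta : R) : ~ obtuse M delta -> (obtuse_constant M <= delta%:E)%E.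
Proof.
move=> H; rewrite /obtuse_constant limf_einfE; apply: ge_ereal_sup => y [V FV <-].
move: FV; rewrite /within /= -entourage_from_ballE => -[r /= r0 rV].
apply: contrapT => /negP; rewrite -ltNge => lt; apply: H; exists r => // p q neq pq.
rewrite -lte_fin; apply: lt_le_trans lt _; apply: ereal_inf_lbound.
by exists (p, q) => //; apply: rV => //=; rewrite ballEmdist.
Qed.

Lemma diam_gt0_point : 0 < set_diam [set: M] -> exists p : M, True.
Proof.
have [//|noM] := pselect (exists p : M, True).
rewrite /set_diam (_ : [set d x y | x in _ & y in _] = set0) ?sup0 ?ltxx //.
by apply/seteqP; split => // y [x _]; case: noM; exists x.
Qed.

Hypotheses (cM : compact [set: M]) (geo : geodesic_space M) (cur : curved M).

Lemma ob_at_ge (p q : M) : p != q -> 0 < Defs.radius M -> - (pi / 2) <= ob_at p q.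
Proof.
move=> pq r0; rewrite /ob_at lerBDr addNr.
have [x far] := radius_attained cM p.
have px : p != x by rewrite -mdist_gt0; lra.
have [h Hh] := geo p x.
have /andP[h0 _] := angle_to_set_itv geo cur pq px Hh; apply: le_trans h0 _.
apply: (ub_le_sup (ex_intro _ pi (ob_at_ubound geo cur pq r0))).
exists (direction p h) => //; exists x; last by exists h.
by rewrite ballEmdist /= /setC /=; apply/negP; rewrite -leNgt; lra.
Qed.

(** With diameter 0 there would be no two separated points at any scale, against [packing_dim] with
    exponent 0. *)
Lemma diam_gt0 n : (0 < n)%N -> hausdorff_dim M = n%:R%:E -> 0 < set_diam [set: M].
Proof.
move=> n0 dimM; rewrite ltNge; apply/negP => D0.
apply: (@packing_dim _ _ _ dimM 0 1 1) => // e /andP[e0 _]; exists 1%N; last by rewrite expr0 mulr1.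
move=> [f [_ fe]]; have := fe ord0 ord_max isT.
have := set_diamP (f ord0) (f ord_max) cM; lra.
Qed.

Lemma dist_between0r (p q : M) r : p != q -> 0 < r -> exists2 x, p != x & d p x < r.
Proof.
move=> pq r0; have pq0 : 0 < d p q by rewrite mdist_gt0.
pose t := Num.min 1 (r / 2 / d p q).
have t0 : 0 < t by rewrite lt_min ltr01 !divr_gt0.
have t01 : 0 <= t <= 1 by rewrite (ltW t0) ge_min lexx.
have tr : t * d p q <= r / 2 by rewrite -ler_pdivlMr // ge_min lexx orbT.
have [x [_ px _]] := between_exists p q geo t01.
by exists x; rewrite -?mdist_gt0 px ?mulr_gt0 //; lra.
Qed.

Lemma obtuse_constant_le_pihalf : 0 < set_diam [set: M] -> (obtuse_constant M <= (pi / 2)%:E)%E.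
Proof.
move=> D0; apply: obtuse_constant_le => -[r r0 H].
have [p _] := diam_gt0_point D0.
have rad : 0 < Defs.radius M by have := diam_le_radius cM p; lra.
have [q far] := radius_attained cM p.
have pq : p != q by rewrite -mdist_gt0; lra.
have [x px pxr] := dist_between0r pq r0.
have := H p x px pxr; rewrite /ob_pair lt_max !ltNge !ob_at_le //.
by rewrite eq_sym.
Qed.

End obtuse_constant_bounds.

Lemma unit_ball_volume_gt0 {R : realType} n : 0 < (unit_ball_volume n : R).
Proof.
suff [] : 0 < (unit_ball_volume n : R) /\ 0 < (unit_ball_volume n.+1 : R) by [].
elim: n => [|n [IH1 IH2]] /=; first by [].
by split => //; rewrite mulr_gt0 // divr_gt0 // mulr_gt0 // pi_gt0.
Qed.

Lemma ob_pair_volume_const {R : realType} n : (0 < n)%N -> exists2 c : R, 0 < c &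
  forall M : metricType R, compact [set: M] -> geodesic_space M -> curved M ->
    hausdorff_dim M = n%:R%:E -> forall (p q : M) (e : R), p != q -> 0 < e <= 1 / 100 ->
    mdist p q <= e * set_diam [set: M] / 4 -> ob_pair p q < e ->
    (hausdorff_outer n%:R [set: M] <= (c * e * set_diam [set: M] ^+ n)%:E)%E.
Proof.
move=> n0; exists (8 * n%:R * 768 ^+ n).
  by apply: mulr_gt0; [rewrite mulr_gt0 ?ltr0n|apply: exprn_gt0; rewrite ltr0n].
move=> M cM geo cur dimM p q e pq e01 pqe ob.
apply: le_trans (ob_pair_volume cM geo cur n0 dimM pq e01 pqe ob) _.
by rewrite exprMn lee_fin le_eqVlt; apply/orP; left; apply/eqP; ring.
Qed.

Section bounds.
Context {R : realType} {M : metricType R}.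
Local Notation d := (@mdist R M).
Variable n : nat.
Hypotheses (n0 : (0 < n)%N) (cM : compact [set: M]) (alex : alexandrov_ge0 M)
  (dimM : hausdorff_dim M = n%:R%:E).
Local Notation K := (unit_ball_volume n / 2 ^+ n : R).
Local Notation D := (set_diam [set: M]).

Lemma alexandrov_geodesic_space : geodesic_space M.
Proof. exact: geodesic_exists cM (alexandrov_intrinsic alex). Qed.

Lemma alexandrov_curved : curved M.
Proof.
have [rho rho0 H] := curvature_ge0_curved_within cM (alexandrov_curvature alex).
move=> z x a b; move: H rho0; apply: strainer_ineq_global => //; exact: alexandrov_intrinsic alex.
Qed.

Let geo := alexandrov_geodesic_space.
Let cur := alexandrov_curved.
Let D0 : 0 < D := diam_gt0 cM n0 dimM.

Lemma volume_const_gt0 : 0 < K.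
Proof. by rewrite divr_gt0 ?unit_ball_volume_gt0 // exprn_gt0. Qed.

(** [fine] sends infinite values to 0, so a positive normalized volume comes from a finite
    measure. *)
Lemma normalized_volumeP : 0 < normalized_volume n M ->
  exists2 h : R, hausdorff_outer n%:R [set: M] = h%:E & normalized_volume n M = K * h / D ^+ n.
Proof.
rewrite /normalized_volume /hausdorff_measure.
have K0 := volume_const_gt0.
case: (hausdorff_outer n%:R [set: M]) => [h _||]; first by exists h.
  by rewrite gt0_muley ?lte_fin //= mul0r ltxx.
by rewrite gt0_muleNy ?lte_fin //= mul0r ltxx.
Qed.

Lemma radius_gt0 : 0 < Defs.radius M.
Proof. by have [p _] := diam_gt0_point D0; have := diam_le_radius cM p; have := D0; lra. Qed.

Lemma obtuse_constant_lower (c : R) (t := normalized_volume n M) : 0 < c ->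
  (forall (p q : M) (e : R), p != q -> 0 < e <= 1 / 100 -> d p q <= e * D / 4 -> ob_pair p q < e ->
    (hausdorff_outer n%:R [set: M] <= (c * e * D ^+ n)%:E)%E) ->
  ((if 0 < t then t / (2 * (K * c) + 100 * t) else - (pi / 2))%:E <= obtuse_constant M)%E.
Proof.
move=> c0 H; have K0 := volume_const_gt0; have d0 := D0.
case: ifPn => [t0|_]; last first.
  apply: (@obtuse_constant_ge _ _ _ 1) => // p q pq _.
  by rewrite /ob_pair le_max (ob_at_ge cM geo cur pq radius_gt0).
have [h Hh tE] := normalized_volumeP t0.
have Kc0 : 0 < K * c by rewrite mulr_gt0.
(* This choice ensures both [e <= 1 / 100] and [K * c * e < t / 2], the second of which contradicts
   the volume bound for a pair with [ob_pair p q < e]. *)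
set e := t / _.
have den : 0 < 2 * (K * c) + 100 * t by lra.
have e0 : 0 < e by rewrite divr_gt0.
have e1 : e <= 1 / 100 by rewrite ler_pdivrMr //; lra.
have ec : 2 * (K * c * e) < t.
  have : e * (2 * (K * c) + 100 * t) = t by rewrite divfK // gt_eqF.
  have : 0 < e * t by rewrite mulr_gt0.
  lra.
apply: (@obtuse_constant_ge _ _ _ (e * D / 4)); first by rewrite divr_gt0 // mulr_gt0.
move=> p q pq lt; rewrite leNgt; apply/negP => ob.
have e01 : 0 < e <= 1 / 100 by rewrite e0.
have := H p q e pq e01 (ltW lt) ob.
rewrite Hh lee_fin => hle.
have Dn0 : 0 < D ^+ n by rewrite exprn_gt0.
have : t <= K * c * e.
  by rewrite /t tE ler_pdivrMr //; apply: le_trans (ler_wpM2l (ltW K0) hle) _; rewrite !mulrA.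
have : 0 <= K * c * e by rewrite mulr_ge0 ?ltW.
lra.
Qed.

(** For each [delta] there are two cases. If [M] is not obtuse for [delta], its obtuse constant is
    at most [delta]. Otherwise the normalized volume is at least [K * v delta], so the linear term
    alone reaches the trivial bound [pi / 2]. Either way the affine expression is an upper bound. *)
Lemma obtuse_constant_upper (v : R -> R) :
  (forall delta : R, 0 < delta <= pi / 2 -> 0 < v delta /\
    (obtuse M delta -> (v delta * D ^+ n)%:E <= hausdorff_outer n%:R [set: M])%E) ->
  (obtuse_constant M <= (if (0 < normalized_volume n M)%R then
    infimum_affine (pi / 2) (fun delta => pi / 2 / (K * v delta)) (normalized_volume n M)
    else pi / 2)%:E)%E.
Proof.
move=> Hv; have K0 := volume_const_gt0; have d0 := D0.
have le2 := obtuse_constant_le_pihalf cM geo cur D0.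
case: ifPn => [t0|_ //]; have [h Hh tE] := normalized_volumeP t0.
have pi2 : 0 < pi / 2 :> R by rewrite divr_gt0 // pi_gt0.
have ge_all (delta : R) : 0 < delta <= pi / 2 ->
    (obtuse_constant M <= (delta + normalized_volume n M * (pi / 2 / (K * v delta)))%:E)%E.
  move=> dl; have [v0 H] := Hv _ dl; have /andP[dl0 _] := dl.
  have Kv : 0 < K * v delta by rewrite mulr_gt0.
  have x0 : 0 < pi / 2 / (K * v delta) by rewrite divr_gt0.
  have [ob|/obtuse_constant_le nob] := pselect (obtuse M delta).
    apply: le_trans le2 _; rewrite lee_fin.
    have {H} := H ob; rewrite Hh lee_fin => vh.
    have : K * v delta <= normalized_volume n M.
      rewrite tE ler_pdivlMr ?exprn_gt0 //.
      by apply: le_trans (ler_wpM2l (ltW K0) vh); rewrite mulrA.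
    move=> /(ler_wpM2r (ltW x0)); rewrite [leLHS]mulrC divfK ?gt_eqF //; lra.
  by apply: le_trans nob _; rewrite lee_fin lerDl mulr_ge0 // ltW.
case E : (obtuse_constant M) ge_all => [c||] ge_all.
- rewrite lee_fin; exact: infimum_affine_ge.
- by move: le2; rewrite E.
- exact: leNye.
Qed.

End bounds.

Theorem corollary1p3 (R : realType) (n : nat) (n_gt0 : (0 < n)%N) :
  exists eps C : R -> R,
    [/\ (forall t : R, 0 < t -> 0 < eps t /\ 0 < C t),
        (forall t : R, 0 < t -> {for t, continuous eps} /\ {for t, continuous C}),
        eps t @[t --> 0^'+] --> (0 : R) /\ C t @[t --> 0^'+] --> (0 : R) &
        forall M : metricType R,
          compact [set: M] -> alexandrov_ge0 M -> hausdorff_dim M = n%:R%:E ->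
          ((eps (normalized_volume n M))%:E <= obtuse_constant M)%E /\
          (obtuse_constant M <= (C (normalized_volume n M))%:E)%E].
Proof.
pose K : R := unit_ball_volume n / 2 ^+ n; have K0 : 0 < K by exact: volume_const_gt0.
have pi2 : 0 < pi / 2 :> R by rewrite divr_gt0 // pi_gt0.
have [c c0 Hc] := @ob_pair_volume_const R n n_gt0.
have Kc0 : 0 < K * c by rewrite mulr_gt0.
have /choice[v Hv] (delta : R) : exists v : R, 0 < delta <= pi / 2 -> 0 < v <= 1 /\
    forall M : metricType R, compact [set: M] -> geodesic_space M -> curved M ->
    hausdorff_dim M = n%:R%:E -> obtuse M delta -> 0 < set_diam [set: M] -> M ->
    ((v * set_diam [set: M] ^+ n)%:E <= hausdorff_outer n%:R [set: M])%E.
  have [/andP[d0 d1]|h] := pselect (0 < delta <= pi / 2); last by exists 0 => /h.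
  by have [v v01 H] := obtuse_volume n_gt0 d0 d1; exists v.
pose a (delta : R) : R := pi / 2 / (K * v delta).
have a0 : 0 < pi / 2 / K by rewrite divr_gt0.
have a_ge (delta : R) : 0 < delta <= pi / 2 -> pi / 2 / K <= a delta.
  move=> /Hv[/andP[v0 v1] _]; have Kv0 : 0 < K * v delta by exact: mulr_gt0.
  by rewrite /a ler_pM2l // lef_pV2 ?posrE // ler_piMr // ltW.
(* For [t <= 0] the two functions take the values of the trivial bounds, [- (pi / 2)] and [pi / 2].
   This covers the value 0 that [fine] would give to an infinite measure. *)
exists (fun t : R => if 0 < t then t / (2 * (K * c) + 100 * t) else - (pi / 2)).
exists (fun t : R => if 0 < t then infimum_affine (pi / 2) a t else pi / 2).
have den (t : R) : 0 <= t -> 0 < 2 * (K * c) + 100 * t by lra.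
have cont (t : R) : 0 <= t -> {for t, continuous (fun t : R => t / (2 * (K * c) + 100 * t))}.
  move=> t0; apply: cvgM; first exact: cvg_id.
  apply: cvgV; first by rewrite gt_eqF // den.
  by apply: cvgD; [exact: cvg_cst|apply: cvgM; [exact: cvg_cst|exact: cvg_id]].
split.
- move=> t t0; rewrite t0 divr_gt0 ?den ?(ltW t0) //; split => //.
  exact: (infimum_affine_gt0 pi2 a0 a_ge).
- move=> t t0; split; apply: continuous_if_pos => //; first exact: (cont _ (ltW t0)).
  exact: (infimum_affine_continuous pi2 a0 a_ge).
- split; apply: cvg_if_pos; last exact: (infimum_affine_cvg0 pi2 a0 a_ge).
  have := cvg_at_right_filter (cont 0 (lexx 0)); by rewrite mul0r.
move=> M cM alex dimM; have geo := alexandrov_geodesic_space cM alex; have cur := alexandrov_curved cM alex.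
split; first exact: (obtuse_constant_lower n_gt0 cM alex dimM c0 (Hc M cM geo cur dimM)).
apply: obtuse_constant_upper => // delta dl; have [/andP[v0 _] H] := Hv _ dl; split => // ob.
have D0 := diam_gt0 cM n_gt0 dimM; have [p _] := diam_gt0_point D0.
exact: (H M cM geo cur dimM ob D0 p).
Qed.
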